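(* Let $\overline{M}$ be a smooth manifold of dimension $n+1$ with boundary $\partial M$ and interior $M$. Let $\nabla$ be a special affine connection on $M$ which is projectively compact of order $\alpha=1$, and let $\sigma\in\Gamma(\mathcal{E}(1))$ be the canonical defining density for $\partial M$ determined by $\nabla$. Then $\sigma$ is a solution of the first BGG operator defined on $\mathcal{E}(1)$ if and only if the connection $\nabla$ is Ricci flat. In this case, the boundary $\partial M$ is totally geodesic and hence inherits a projective structure. Moreover, in this case $\sigma$ automatically is a normal solution of the first BGG operator, i.e. $L(\sigma)$ is a parallel section of the cotractor bundle $\mathcal{T}^*$ over $\overline{M}$, so that one has a reduction of projective holonomy, i.e. the holonomy of the tractor connection is contained in the stabilizer of a non-zero covector.
   Context: All affine connections are torsion free; smooth means $C^\infty$. For a one-form $\Upsilon$, write $\hat\nabla=\nabla+\Upsilon$ for $\hat\nabla_\xi\eta=\nabla_\xi\eta+\Upsilon(\xi)\eta+\Upsilon(\eta)\xi$; connections so related are projectively equivalent, and a projective structure is an equivalence class. A local defining function for $\partial M$ is a smooth $\rho:U\to\mathbb{R}_{\ge0}$, $U\subset\overline{M}$ open, with $\rho^{-1}(\{0\})=U\cap\partial M$ and $d\rho\neq0$ along $U\cap\partial M$. $\nabla$ on $M$ is projectively compact of order $\alpha>0$ if near each boundary point there is a defining function $\rho$ such that $\nabla+\frac{d\rho}{\alpha\rho}$ extends smoothly to the boundary. Then the projective class of $\nabla$ extends uniquely to a projective structure on $\overline{M}$. Densities: $\mathrm{vol}(N)$ is the bundle of volume densities and $\mathcal{E}(w)=\mathrm{vol}(N)^{-w/(n+2)}$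 for $\dim N=n+1$. An affine connection is special if it admits a nowhere vanishing parallel section of $\mathrm{vol}(N)$; it then has parallel sections of each $\mathcal{E}(w)$, unique up to constant multiples. A defining density for $\partial M$ is a section of a density bundle over $\overline M$ with zero locus $\partial M$ that in local trivializations is represented (up to sign) by a defining function. If $\nabla$ is special and projectively compact of order $\alpha$, then a non-zero $\nabla$-parallel section of $\mathcal{E}(\alpha)$ extends by $0$ to a defining density for $\partial M$: the canonical defining density (unique up to a constant factor). Tractors: on a manifold $N$ of dimension $n+1\ge 2$ with projective structure, the cotractor bundle is $\mathcal{T}^*=J^1(\mathcal{E}(1))$, which sits in an exact sequence $0\to T^*N\otimes\mathcal{E}(1)\to\mathcal{T}^*\to\mathcal{E}(1)\to0$. A connection $\tilde\nabla$ in the class gives an isomorphism $\mathcal{T}^*\cong\mathcal{E}(1)\oplus T^*N\otimes\mathcal{E}(1)$, with elements written $\binom{\sigma}{\mu_a}$; replacing $\tilde\nabla$ by $\tilde\nabla+\Upsilon$ changes this to $\binom{\sigma}{\mu_a+\Upsilon_a\sigma}$. The tractor connection is $\nabla^{\mathcal{T}^*}_a\binom{\sigma}{\mu_b}=\binom{\tilde\nabla_a\sigma-\mu_a}{\tilde\nabla_a\mu_b+\tilde{\mathsf P}_{ab}\sigma}$, where for special $\tilde\nabla$ the Schouten tensor is $\tilde{\mathsf P}_{ab}=\frac1{\dim N-1}\widetilde{\mathrm{Ric}}_{ab}$ (symmetric). Both are independent of the choice of $\tilde\nabla$. Projective holonomy means the holonomy of the tractor connection. Splitting operator: $L(\sigma)=\binom{\sigma}{\tilde\nabla_a\sigma}\in\Gamma(\mathcal{T}^*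 )$. First BGG operator on $\mathcal{E}(1)$: $\sigma\mapsto\tilde\nabla_{(a}\tilde\nabla_{b)}\sigma+\tilde{\mathsf P}_{(ab)}\sigma$; it is projectively invariant, and here is considered on $\overline{M}$. A solution $\sigma$ is normal if $\nabla^{\mathcal{T}^*}L(\sigma)=0$. $\partial M$ is totally geodesic if, for any connection $\tilde\nabla$ in the projective class that is smooth up to the boundary, $\tilde\nabla_\xi\eta$ is tangent to $\partial M$ along $\partial M$ whenever $\xi,\eta$ are tangent to $\partial M$; the induced projective structure on $\partial M$ is the class of the restricted connections. *)

(* Defs.v *)
From HB Require Import structures.
From mathcomp Require Import all_boot all_order all_algebra.
From mathcomp Require Import all_classical all_reals all_analysis.
Set Implicit Arguments.
Unset Strict Implicit.
Unset Printing Implicit Defensive.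
Import Order.TTheory GRing.Theory Num.Theory numFieldNormedType.Exports.
Local Open Scope classical_set_scope.
Local Open Scope ring_scope.

(* Manifolds are given by atlases, and geometric objects by
   their components in the charts together with the transformation law under
   change of charts (classical tensor calculus). *)

(** * Calculus *)

Section Calculus.
Context {R : realType}.

Definition iter_derive {V : normedModType R} (vs : seq V) (f : V -> R) : V -> R :=
  foldr (fun v g => (fun x => 'D_v (g : V -> R^o) x)) f vs.

Definition smooth_open {V : normedModType R} (O : set V) (f : V -> R) : Prop :=
  open O /\ forall vs x, O x ->
    {for x, continuous (iter_derive vs f)} /\
    forall v, derivable (iter_derive vs f : V -> R^o) x v.

(* Smoothness on an arbitrary subset (e.g. a relatively open subset of a
   half-space): existence of local smooth extensions. *)
Definition smooth_on {V : normedModType R} (S : set V) (f : V -> R) : Prop :=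
  forall x, S x -> exists O F,
    [/\ O x, smooth_open O F & forall y, O y -> S y -> F y = f y].

(* The a-th partial derivative, taken as a limit of difference quotients from
   the right: this makes sense at every point of a relatively open subset of
   the half-space x_0 >= 0, boundary points included.  For f smooth (in the
   above sense) it is the partial derivative of any local smooth extension. *)
Definition pd {d : nat} (a : 'I_d) (f : 'rV[R]_d -> R) (x : 'rV[R]_d) : R :=
  lim ((fun h : R => h^-1 * (f (x + h *: delta_mx 0 a) - f x)) @ 0^'+).

(* Derivative on the interval [0, 1], one-sided at the end points. *)
Definition unit_derive (f : R -> R) (t : R) : R :=
  lim ((fun h : R => h^-1 * (f (t + h) - f t))
       @ within [set h | 0 <= t + h <= 1] 0^').

Definition halfspace (n : nat) : set 'rV[R]_n.+1 := [set x | 0 <= x 0 ord0].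

End Calculus.

Arguments halfspace {R} n.

(** * Manifolds *)

(* [crd i] and [par i] are mutually inverse on [dom i] and its image;
   their values elsewhere are irrelevant. *)
Record atlas (R : realType) (X : topologicalType) (d : nat) := Atlas {
  ix : Type;
  dom : ix -> set X;
  crd : ix -> X -> 'rV[R]_d;
  par : ix -> 'rV[R]_d -> X }.

Section Atlas.
Context {R : realType} {X : topologicalType} {d : nat} (A : atlas R X d).
Implicit Types (i j : ix A) (U : set X).

(* The points covered by the charts; this is a proper subset of X in the case
   of the atlas of the boundary (see [boundary_atlas]). *)
Definition carrier : set X := [set p | exists i, dom i p].

Definition open_in U : Prop := exists V, open V /\ U = V `&` carrier.

Definition reg U i : set 'rV[R]_d := crd i @` (dom i `&` U).

Definition trans i j (x : 'rV[R]_d) : 'rV[R]_d := crd j (par i x).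

(* With x = crd i and y = crd j, the (a, b) entry is dy^b/dx^a. *)
Definition jac i j (x : 'rV[R]_d) : 'M[R]_d :=
  \matrix_(a, b) pd a (fun z => trans i j z 0 b) x.

Definition smooth_fun U (f : X -> R) : Prop :=
  forall i, smooth_on (reg U i) (fun x => f (par i x)).

Definition one_form U (ups : ix A -> 'rV[R]_d -> 'rV[R]_d) : Prop :=
  (forall i a, smooth_on (reg U i) (fun x => ups i x 0 a)) /\
  forall i j p, dom i p -> dom j p -> U p -> forall a,
    ups i (crd i p) 0 a = \sum_b jac i j (crd i p) a b * ups j (crd j p) 0 b.

Definition vector_field U (xi : ix A -> 'rV[R]_d -> 'rV[R]_d) : Prop :=
  (forall i a, smooth_on (reg U i) (fun x => xi i x 0 a)) /\
  forall i j p, dom i p -> dom j p -> U p -> forall b,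
    xi j (crd j p) 0 b = \sum_a jac i j (crd i p) a b * xi i (crd i p) 0 a.

(* The density bundle of weight w is vol^(-w/(d+1)), and volume densities
   transform by |det dy/dx|. *)
Definition density_factor (w : R) i j (x : 'rV[R]_d) : R :=
  `|\det (jac i j x)| `^ (- w / d.+1%:R).

Definition density (w : R) U (s : ix A -> 'rV[R]_d -> R) : Prop :=
  (forall i, smooth_on (reg U i) (s i)) /\
  forall i j p, dom i p -> dom j p -> U p ->
    s i (crd i p) = density_factor w i j (crd i p) * s j (crd j p).

(* Volume densities are the densities of weight -(d+1). *)
Definition vol_weight : R := - d.+1%:R.

(* G x c a b is the Christoffel symbol Gamma^c_{ab} at x in one chart. *)
Definition christoffel := 'rV[R]_d -> 'I_d -> 'I_d -> 'I_d -> R.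

(* Torsion-free affine connections on U. *)
Definition connection U (Gam : ix A -> christoffel) : Prop :=
  [/\ forall i c a b, smooth_on (reg U i) (fun x => Gam i x c a b),
      forall i x, reg U i x -> forall c a b, Gam i x c a b = Gam i x c b a &
      forall i j p, dom i p -> dom j p -> U p -> forall f a b,
        \sum_c Gam i (crd i p) c a b * jac i j (crd i p) c f =
        pd a (fun z => jac i j z b f) (crd i p) +
        \sum_k \sum_l jac i j (crd i p) a k * jac i j (crd i p) b l *
                      Gam j (crd j p) f k l].

(* hGam = Gam + ups in the sense of projective change, on U. *)
Definition proj_change U (Gam hGam : ix A -> christoffel)
    (ups : ix A -> 'rV[R]_d -> 'rV[R]_d) : Prop :=
  forall i x, reg U i x -> forall c a b,
    hGam i x c a b =
    Gam i x c a b + ups i x 0 a * (c == b)%:R + ups i x 0 b * (c == a)%:R.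

Definition proj_equiv U (Gam hGam : ix A -> christoffel) : Prop :=
  exists ups, one_form U ups /\ proj_change U Gam hGam ups.

(* A projective structure, as the sheaf of connections, on open subsets,
   belonging to it. *)
Definition projective_structure (P : set X -> (ix A -> christoffel) -> Prop) :=
  [/\ forall U Gam, P U Gam -> open_in U /\ connection U Gam,
      forall p, carrier p -> exists U Gam, U p /\ P U Gam,
      forall U V Gam Gam', P U Gam -> P V Gam' -> proj_equiv (U `&` V) Gam Gam' &
      forall U Gam, open_in U -> connection U Gam ->
        (forall V Gam', P V Gam' -> proj_equiv (U `&` V) Gam Gam') -> P U Gam].

(** ** Covariant derivatives and curvature in a chart *)

Implicit Types (G : christoffel) (s : 'rV[R]_d -> R) (x : 'rV[R]_d).

Definition nabla_density (w : R) G s x : 'rV[R]_d :=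
  \row_a (pd a s x + w / d.+1%:R * (\sum_c G x c a c) * s x).

(* On one-forms with values in densities of weight w; the index a of the
   derivative comes first. *)
Definition nabla_form (w : R) G (mu : 'rV[R]_d -> 'rV[R]_d) x : 'M[R]_d :=
  \matrix_(a, b) (pd a (fun y => mu y 0 b) x - \sum_c G x c a b * mu x 0 c
                  + w / d.+1%:R * (\sum_c G x c a c) * mu x 0 b).

Definition nabla_vector G (xi eta : 'rV[R]_d -> 'rV[R]_d) x : 'rV[R]_d :=
  \row_c \sum_a xi x 0 a *
    (pd a (fun y => eta y 0 c) x + \sum_b G x c a b * eta x 0 b).

Definition ricci G x : 'M[R]_d :=
  \matrix_(a, b) \sum_c (pd c (fun y => G y c a b) x - pd a (fun y => G y c c b) x
    + \sum_e (G x c c e * G x e a b - G x c a e * G x e c b)).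

Definition schouten G x : 'M[R]_d := (d%:R - 1)^-1 *: ricci G x.

Definition special U (Gam : ix A -> christoffel) : Prop :=
  exists nu, [/\ density vol_weight U nu,
    forall i x, reg U i x -> nu i x != 0 &
    forall i x, reg U i x -> nabla_density vol_weight (Gam i) (nu i) x = 0].

Definition ricci_flat U (Gam : ix A -> christoffel) : Prop :=
  forall i x, reg U i x -> ricci (Gam i) x = 0.

(* The first BGG operator on weight 1, in terms of a special connection. *)
Definition bgg G s x : 'M[R]_d :=
  let hess := nabla_form 1 G (nabla_density 1 G s) x in
  2^-1 *: (hess + hess^T) + (2^-1 * s x) *: (schouten G x + (schouten G x)^T).

(** ** Cotractors *)

(* Elements of the fibre of J^1(E(1)) in a chart: the value and the first
   partial derivatives of a density of weight 1. *)
Definition jet : Type := (R * 'rV[R]_d)%type.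

(* u, in chart i, and v, in chart j, represent the same 1-jet at the point
   with coordinates x in chart i: the law of [density] differentiated. *)
Definition jet_change i j x (u v : jet) : Prop :=
  u.1 = density_factor 1 i j x * v.1 /\
  forall a, u.2 0 a = pd a (density_factor 1 i j) x * v.1 +
    density_factor 1 i j x * \sum_b jac i j x a b * v.2 0 b.

Definition cotractor_section U (t : ix A -> 'rV[R]_d -> jet) : Prop :=
  [/\ forall i, smooth_on (reg U i) (fun x => (t i x).1),
      forall i a, smooth_on (reg U i) (fun x => (t i x).2 0 a) &
      forall i j p, dom i p -> dom j p -> U p ->
        jet_change i j (crd i p) (t i (crd i p)) (t j (crd j p))].

(* The isomorphism J^1(E(1)) = E(1) + T^*(1) given by a connection: it maps the
   1-jet of s to (s, nabla s). *)
Definition splitting G x (u : jet) : R * 'rV[R]_d :=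
  (u.1, \row_a (u.2 0 a + 1 / d.+1%:R * (\sum_c G x c a c) * u.1)).

(* The tractor connection in the direction a, in the splitting given by G. *)
Definition tractor_nabla G (t : 'rV[R]_d -> jet) x (a : 'I_d) : R * 'rV[R]_d :=
  let sigma y := (splitting G y (t y)).1 in
  let mu y := (splitting G y (t y)).2 in
  (nabla_density 1 G sigma x 0 a - mu x 0 a,
   row a (nabla_form 1 G mu x) + sigma x *: row a (schouten G x)).

Definition splitting_operator s x : jet := (s x, \row_a pd a s x).

Lemma splitting_operatorE G s x :
  splitting G x (splitting_operator s x) = (s x, nabla_density 1 G s x).
Proof.
by rewrite /splitting /=; congr pair; apply/rowP => a; rewrite !mxE.
Qed.

End Atlas.

Arguments christoffel : clear implicits.
Arguments jet : clear implicits.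

(** * Manifolds with boundary and projective compactness *)

Section Boundary.
Context {R : realType} {X : topologicalType} {n : nat} (A : atlas R X n.+1).
Implicit Types (i j : ix A) (U : set X) (Gam : ix A -> christoffel R n.+1).

Definition manifold_with_boundary : Prop :=
  [/\ hausdorff_space X, @second_countable X, carrier A = setT,
      (forall i, [/\ open (dom i),
        exists O, open O /\ reg setT i = O `&` halfspace n,
        forall p, dom i p -> par i (crd i p) = p,
        forall p, dom i p -> {for p, continuous (crd i)} &
        {within reg setT i, continuous (par i)}]) &
      forall i j a, smooth_on (reg (dom j) i) (fun x => trans i j x 0 a)].

Definition boundary : set X :=
  [set p | exists i, dom i p /\ crd i p 0 ord0 = 0].

Definition interior_part : set X := ~` boundary.

(* The charts of A restricted to the boundary, with the coordinate number 0
   (which vanishes there) omitted. *)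
Definition boundary_atlas : atlas R X n :=
  @Atlas R X n (ix A)
    (fun i => dom i `&` boundary)
    (fun i p => \row_k crd i p 0 (lift ord0 k))
    (fun i y => par i (\row_a (if unlift ord0 a is Some k then y 0 k else 0))).

Definition restrict_conn Gam : ix boundary_atlas -> christoffel R n :=
  fun i y c a b =>
    Gam i (\row_e (if unlift ord0 e is Some k then y 0 k else 0))
      (lift ord0 c) (lift ord0 a) (lift ord0 b).

Definition defining_function U (rho : X -> R) : Prop :=
  [/\ open U, smooth_fun A U rho, forall p, U p -> 0 <= rho p,
      forall p, U p -> (rho p = 0 <-> boundary p) &
      forall i p, dom i p -> U p -> boundary p ->
        exists a, pd a (fun x => rho (par i x)) (crd i p) != 0].

(* Gam is a connection on the interior. *)
Definition projectively_compact (alpha : R) Gam : Prop :=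
  forall p, boundary p -> exists U rho hGam,
    [/\ U p, defining_function U rho, connection U hGam &
      proj_change (U `&` interior_part) Gam hGam
        (fun i x => \row_a (pd a (fun y => rho (par i y)) x /
                            (alpha * rho (par i x))))].

(* The extension to the manifold with boundary of the projective class of a
   connection Gam on the interior: the connections tGam, on open subsets U of
   the manifold with boundary and smooth up to the boundary, that are
   projectively equivalent to Gam on the interior. *)
Definition extended_class Gam U tGam : Prop :=
  [/\ open U, connection U tGam & proj_equiv (U `&` interior_part) Gam tGam].

Definition defining_density (w : R) (s : ix A -> 'rV[R]_n.+1 -> R) : Prop :=
  [/\ density w setT s,
      forall i p, dom i p -> (s i (crd i p) = 0 <-> boundary p) &
      forall i p, dom i p -> boundary p ->
        exists U e, [/\ U p, U `<=` dom i, e = 1 \/ e = -1 &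
          defining_function U (fun q => e * s i (crd i q))]].

Definition canonical_defining_density (alpha : R) Gam s : Prop :=
  defining_density alpha s /\
  forall i x, reg interior_part i x -> nabla_density alpha (Gam i) (s i) x = 0.

Definition tangent_to_boundary U (xi : ix A -> 'rV[R]_n.+1 -> 'rV[R]_n.+1) :=
  forall i p, dom i p -> U p -> boundary p -> xi i (crd i p) 0 ord0 = 0.

Definition totally_geodesic_boundary Gam : Prop :=
  forall U tGam, extended_class Gam U tGam ->
  forall xi eta, vector_field U xi -> vector_field U eta ->
    tangent_to_boundary U xi -> tangent_to_boundary U eta ->
    tangent_to_boundary U (fun i => nabla_vector (tGam i) (xi i) (eta i)).

(* The restrictions to the boundary of the connections in the class belong to
   a projective structure on the boundary (which is then unique). *)
Definition boundary_inherits_projective_structure Gam : Prop :=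
  exists P, projective_structure P /\
    forall U tGam, extended_class Gam U tGam ->
      P (U `&` boundary) (restrict_conn tGam).

(** ** The BGG equation and the tractor connection, up to the boundary *)

(* As usual, the invariant operators are evaluated by means of the special
   connections, defined on open subsets, in the extended class. *)
Definition special_in_class Gam U tGam : Prop :=
  extended_class Gam U tGam /\ special U tGam.

Definition bgg_solution Gam (s : ix A -> 'rV[R]_n.+1 -> R) : Prop :=
  forall U tGam, special_in_class Gam U tGam ->
  forall i x, reg U i x -> bgg (tGam i) (s i) x = 0.

Definition parallel_cotractor Gam (t : ix A -> 'rV[R]_n.+1 -> jet R n.+1) :=
  cotractor_section setT t /\
  forall U tGam, special_in_class Gam U tGam ->
  forall i x, reg U i x -> forall a, tractor_nabla (tGam i) (t i) x a = (0, 0).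

Definition normal_bgg_solution Gam s : Prop :=
  bgg_solution Gam s /\
  parallel_cotractor Gam (fun i => splitting_operator (s i)).

(** ** Holonomy of the tractor connection on the cotractor bundle *)

Definition unit_part (gam : R -> X) i : set R :=
  [set t | 0 <= t <= 1 /\ dom i (gam t)].

Definition smooth_curve (gam : R -> X) : Prop :=
  {within [set t : R | 0 <= t <= 1], continuous gam} /\
  forall i a, smooth_on (V := R^o) (unit_part gam i) (fun t => crd i (gam t) 0 a).

Definition cotractor_along (gam : R -> X) (u : R -> ix A -> jet R n.+1) : Prop :=
  [/\ forall i, smooth_on (V := R^o) (unit_part gam i) (fun t => (u t i).1),
      forall i a, smooth_on (V := R^o) (unit_part gam i) (fun t => (u t i).2 0 a) &
      forall t i j, 0 <= t <= 1 -> dom i (gam t) -> dom j (gam t) ->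
        jet_change i j (crd i (gam t)) (u t i) (u t j)].

(* The covariant derivative along gam, induced by the tractor connection,
   vanishes. *)
Definition parallel_along Gam (gam : R -> X) (u : R -> ix A -> jet R n.+1) :=
  cotractor_along gam u /\
  forall U tGam, special_in_class Gam U tGam ->
  forall t i, 0 <= t <= 1 -> dom i (gam t) -> U (gam t) ->
    let x := crd i (gam t) in
    let G := tGam i x in
    let vel a := unit_derive (fun r => crd i (gam r) 0 a) t in
    let sigma r := (splitting (tGam i) (crd i (gam r)) (u r i)).1 in
    let mu r := (splitting (tGam i) (crd i (gam r)) (u r i)).2 in
    let trace := \sum_a vel a * (1 / n.+2%:R * \sum_c G c a c) in
    unit_derive sigma t + trace * sigma t - \sum_a vel a * mu t 0 a = 0 /\
    forall b,
      unit_derive (fun r => mu r 0 b) t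
      - \sum_a \sum_c vel a * G c a b * mu t 0 c
      + trace * mu t 0 b
      + (\sum_a vel a * schouten (tGam i) x a b) * sigma t = 0.

(* [transport Gam p i q j F]: F is the parallel transport along some piecewise
   smooth curve from p to q, the fibres at p and q being identified with
   [jet] through the charts i and j. *)
Inductive transport Gam :
    X -> ix A -> X -> ix A -> (jet R n.+1 -> jet R n.+1) -> Prop :=
| transport_smooth gam i j F :
    smooth_curve gam -> dom i (gam 0) -> dom j (gam 1) ->
    (forall v, exists u, [/\ parallel_along Gam gam u, u 0 i = v & u 1 j = F v]) ->
    transport Gam (gam 0) i (gam 1) j F
| transport_cat p i q j r k F F' :
    transport Gam p i q j F -> transport Gam q j r k F' ->
    transport Gam p i r k (F' \o F).

Definition holonomy Gam p i (F : jet R n.+1 -> jet R n.+1) : Prop :=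
  transport Gam p i p i F.

(* A cotractor v is a covector on the standard tractor space, and its
   stabilizer consists of the elements whose (dual) action fixes v. *)
Definition holonomy_stabilizes_covector Gam : Prop :=
  forall p i, dom i p ->
    exists v, v <> (0, 0) /\ forall F, holonomy Gam p i F -> F v = v.

End Boundary.

(* Main.v *)
(* Let P be the projective Schouten tensor and let T(tnabla) denote
   [tnabla tnabla sigma + tP sigma] for a connection tnabla in the extended class.
   On the interior tnabla = nabla + Upsilon and nabla sigma = 0, so that
   tnabla sigma = Upsilon sigma, and the projective change of P gives
   T(tnabla)_ab = sigma (P_ab + (d_b Upsilon_a - d_a Upsilon_b) / (dim - 1)),
   where P belongs to nabla.  The curl disappears after symmetrization, and
   altogether if both connections are special; hence the BGG equation says that
   P = 0 on the interior, and by continuity T(tnabla) = 0 up to the boundary,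
   which is the equation that L(sigma) is parallel.  At a boundary point
   sigma = 0 and d sigma is conormal, so that T(tnabla) = 0 in tangential
   directions says that the second fundamental form of the boundary vanishes.
   Finally L(sigma) is the only parallel section along a curve with its initial
   value, by uniqueness for linear ODEs in charts carrying a special connection
   of the class; near the boundary, such a connection is obtained by normalizing
   a smooth extension of the class so that it preserves a coordinate volume. *)
Require Import Defs.
From mathcomp Require Import all_boot all_order perm all_algebra.
From mathcomp Require Import all_classical all_reals all_analysis.
From mathcomp Require Import ring lra.
Set Implicit Arguments.
Unset Strict Implicit.
Unset Printing Implicit Defensive.
Import Order.TTheory GRing.Theory Num.Theory numFieldNormedType.Exports.
Local Open Scope classical_set_scope.
Local Open Scope ring_scope.

(** * Smooth functions on open sets *)

(** Upsilon is singular at the boundary, so the formula for T(tnabla) lives on the interior; but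
    T(tnabla) itself is built from tnabla and sigma, both smooth up to the boundary, so that its
    vanishing extends. For the same reason projective equivalence is recast pointwise: the trace of
    the difference of two connections determines Upsilon, hence equivalence is a closed condition on
    Christoffel symbols, and two members of the extended class stay equivalent at boundary points.
    The curl disappears for special connections because the skew part of Ricci is the curl of the
    trace of the Christoffel symbols, and a parallel volume density makes this trace a logarithmic
    derivative. Total geodesy is tested on all connections of the class, special or not, hence with
    the symmetric part of T. Smoothness at the boundary means local extensions, and partial
    derivatives are right-hand limits. Calculus is therefore developed on open sets and transferred
    through extensions, whose right-hand quotients coincide with those of the given function. *)

Lemma near_open (T : topologicalType) (O : set T) (P : T -> Prop) x :
  open O -> O x -> (forall y, O y -> P y) -> \forall y \near x, P y.
Proof.
move=> oO Ox OP; apply: filterS (open_nbhs_nbhs (conj oO Ox)) => y; exact: OP.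
Qed.

Section SmoothOpen.
Context {R : realType} {V : normedModType R}.
Implicit Types (O : set V) (f g : V -> R) (v : V).

Definition dir v f : V -> R := fun x => 'D_v (f : V -> R^o) x.

Definition diffable O f := forall x, O x ->
  {for x, continuous f} /\ forall v, derivable (f : V -> R^o) x v.

Lemma dir_ext O f g v : open O -> (forall x, O x -> f x = g x) ->
  forall x, O x -> dir v f x = dir v g x.
Proof.
move=> oO fg x Ox; rewrite /dir; apply: near_eq_derive.
exact: near_open oO Ox fg.
Qed.

Lemma diffable_ext O f g : open O -> (forall x, O x -> f x = g x) ->
  diffable O f -> diffable O g.
Proof.
move=> oO fg df x Ox; have [cf dfx] := df x Ox.
have nfg : \forall y \near x, f y = g y by exact: near_open oO Ox fg.
split; last by move=> v; exact: near_eq_derivable nfg (dfx v).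
rewrite /prop_for /continuous_at -fg//.
by apply: cvg_trans cf; apply: near_eq_cvg; apply: filterS nfg => y ->.
Qed.

Lemma iter_derive_ext O f g vs : open O -> (forall x, O x -> f x = g x) ->
  forall x, O x -> iter_derive vs f x = iter_derive vs g x.
Proof.
move=> oO fg; elim: vs => [|v vs IH] //=.
exact: (dir_ext v oO IH).
Qed.

Lemma iter_derive_rcons vs v f :
  iter_derive (rcons vs v) f = iter_derive vs (dir v f).
Proof. by rewrite /iter_derive -cats1 foldr_cat. Qed.

Lemma smooth_open_ext O f g : (forall x, O x -> f x = g x) ->
  smooth_open O f -> smooth_open O g.
Proof.
move=> fg [oO sf]; split; first exact: oO.
move=> vs x Ox.
exact: (diffable_ext oO (iter_derive_ext vs oO fg) (sf vs)).
Qed.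

Lemma smooth_open_sub O O' f :
  open O' -> O' `<=` O -> smooth_open O f -> smooth_open O' f.
Proof. by move=> oO' O'O [oO sf]; split=> // vs x /O'O; exact: sf. Qed.

Lemma smooth_open_dir O f v : smooth_open O f -> smooth_open O (dir v f).
Proof.
move=> [oO sf]; split; first exact: oO.
move=> vs x Ox; have := sf (rcons vs v) x Ox.
by rewrite iter_derive_rcons.
Qed.

Lemma smooth_open_diffable O f : smooth_open O f -> diffable O f.
Proof. by move=> [_ sf]; exact: (sf [::]). Qed.

(* Coinduction: membership in a class of differentiable functions that is
   closed under directional derivatives. *)
Lemma smooth_open_class O (C : set (V -> R)) : open O ->
  (forall f, C f -> diffable O f) ->
  (forall f v, C f -> exists2 g, C g & forall x, O x -> dir v f x = g x) ->
  forall f, C f -> smooth_open O f.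
Proof.
move=> oO Cd CD f Cf; split=> // vs; elim/last_ind: vs f Cf => [|vs v IH] f Cf.
  exact: Cd.
have [g Cg fg] := CD f v Cf => x Ox; rewrite iter_derive_rcons.
apply: (diffable_ext oO _ (IH g Cg)) Ox => // y Oy.
by apply: (iter_derive_ext vs oO) Oy => z Oz; rewrite fg.
Qed.

Lemma smooth_open_cst O (k : R) : open O -> smooth_open O (fun=> k).
Proof.
move=> oO.
apply: (@smooth_open_class O [set f | exists k, f = fun=> k]) => //; last by exists k.
- move=> _ [l ->] x Ox; split; first exact: cst_continuous.
  by move=> v; exact: derivable_cst.
- move=> _ v [l ->]; exists (fun=> 0); first by exists 0.
  by move=> x _; exact: derive_cst.
Qed.

Lemma smooth_openD O f g :
  smooth_open O f -> smooth_open O g -> smooth_open O (fun x => f x + g x).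
Proof.
move=> sf sg; have oO := sf.1.
apply: (@smooth_open_class O [set h | exists p : (V -> R) * (V -> R),
  [/\ smooth_open O p.1, smooth_open O p.2 & h = fun x => p.1 x + p.2 x]] oO);
  last by exists (f, g); split; [exact: sf|exact: sg|].
- move=> _ [[a b] /= [/smooth_open_diffable sa /smooth_open_diffable sb ->]] x Ox.
  have [ca da] := sa x Ox; have [cb db] := sb x Ox; split; first exact: cvgD.
  by move=> v; apply: derivableD.
- move=> _ v [[a b] /= [sa sb ->]].
  exists (fun x => dir v a x + dir v b x).
    exists (dir v a, dir v b).
    by split; [exact: (smooth_open_dir v sa)|exact: (smooth_open_dir v sb)|].
  move=> x Ox; have [_ da] := smooth_open_diffable sa Ox.
  by have [_ db] := smooth_open_diffable sb Ox; exact: deriveD.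
Qed.

Lemma dirM O f g v x : smooth_open O f -> smooth_open O g -> O x ->
  dir v (fun x => f x * g x) x = f x * dir v g x + g x * dir v f x.
Proof.
move=> /smooth_open_diffable sf /smooth_open_diffable sg Ox.
have [_ df] := sf x Ox; have [_ dg] := sg x Ox; exact: deriveM.
Qed.

Lemma dirD O f g v x : smooth_open O f -> smooth_open O g -> O x ->
  dir v (fun x => f x + g x) x = dir v f x + dir v g x.
Proof.
move=> /smooth_open_diffable sf /smooth_open_diffable sg Ox.
have [_ df] := sf x Ox; have [_ dg] := sg x Ox; exact: deriveD.
Qed.

(** Products alone are not closed under [dir], but finite sums of products are, by the Leibniz rule;
    [good] lists encode such sums. *)
Lemma smooth_openM O f g :
  smooth_open O f -> smooth_open O g -> smooth_open O (fun x => f x * g x).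
Proof.
move=> sf sg; have oO := sf.1.
pose ev (s : seq ((V -> R) * (V -> R))) x := \sum_(p <- s) p.1 x * p.2 x.
pose good (s : seq ((V -> R) * (V -> R))) :=
  forall p, List.In p s -> smooth_open O p.1 /\ smooth_open O p.2.
have ev0 : ev [::] = fun=> 0 by apply/funext => x; rewrite /ev big_nil.
have evS p s : ev (p :: s) = fun x => p.1 x * p.2 x + ev s x.
  by apply/funext => x; rewrite /ev big_cons.
have goodS p s : good (p :: s) -> [/\ smooth_open O p.1, smooth_open O p.2 & good s].
  move=> H; have [s1 s2] := H p (or_introl erefl); split; [exact: s1|exact: s2|].
  by move=> q qs; apply: H; right.
have dM a b : smooth_open O a -> smooth_open O b -> diffable O (fun x => a x * b x).
  move=> /smooth_open_diffable sa /smooth_open_diffable sb x Ox.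
  have [ca da] := sa x Ox; have [cb db] := sb x Ox; split; first exact: cvgM.
  by move=> v; apply: derivableM.
have dev s : good s -> diffable O (ev s).
  elim: s => [_|p s IH].
    by rewrite ev0; apply: smooth_open_diffable; exact: smooth_open_cst.
  move=> /goodS[s1 s2 gs] x Ox; rewrite evS.
  have [ca da] := dM _ _ s1 s2 x Ox; have [cb db] := IH gs x Ox.
  by split; [exact: cvgD|move=> v; apply: derivableD].
apply: (@smooth_open_class O [set h | exists2 s, good s & h = ev s]) => //.
- by move=> _ [s gs ->]; exact: dev.
- move=> _ v [s gs ->]; elim: s gs => [_|p s IH].
    exists (ev [::]); first by exists [::].
    by move=> x Ox; rewrite ev0; exact: derive_cst.
  move=> gps; have [s1 s2 gs] := goodS _ _ gps; have [_ [s' gs' ->] e] := IH gs.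
  exists (ev [:: (p.1, dir v p.2), (p.2, dir v p.1) & s']).
    exists [:: (p.1, dir v p.2), (p.2, dir v p.1) & s']; last by [].
    move=> q /= [<-|[<-|/gs'//]].
      by split; [exact: s1|exact: (smooth_open_dir v s2)].
    by split; [exact: s2|exact: (smooth_open_dir v s1)].
  move=> x Ox; rewrite !evS addrA -e// -(dirM v s1 s2 Ox).
  have [_ da] := dM _ _ s1 s2 x Ox; have [_ db] := dev s gs x Ox.
  exact: deriveD.
- exists [:: (f, g)]; first by move=> p /= [<-|[]]; split; [exact: sf|exact: sg].
  by rewrite evS ev0; apply/funext => x; rewrite addr0.
Qed.

Lemma dirV O f v x : smooth_open O f -> O x -> f x != 0 ->
  dir v (fun x => (f x)^-1) x = - (f x) ^- 2 * dir v f x.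
Proof.
move=> /smooth_open_diffable sf Ox fx0.
by have [_ df] := sf x Ox; exact: deriveV.
Qed.

(** The class consists of the quotients [g / f ^+ m] with [g] smooth; the quotient rule, with
    denominator [f ^+ (m + m)], stays inside it. *)
Lemma smooth_openV O f : smooth_open O f -> (forall x, O x -> f x != 0) ->
  smooth_open O (fun x => (f x)^-1).
Proof.
move=> sf f0; have oO := sf.1.
have sX m : smooth_open O (fun x => f x ^+ m).
  elim: m => [|m IH].
    by apply: smooth_open_ext (smooth_open_cst 1 oO) => x; rewrite expr0.
  by apply: smooth_open_ext (smooth_openM sf IH) => x _; rewrite exprS.
have fm0 m x : O x -> f x ^+ m != 0 by move=> Ox; rewrite expf_neq0// f0.
have dV m : diffable O (fun x => (f x ^+ m)^-1).
  move=> x Ox; have [ca da] := smooth_open_diffable (sX m) Ox.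
  by split; [apply: cvgV => //; exact: fm0|move=> v; apply: derivableV => //; exact: fm0].
apply: (@smooth_open_class O [set h | exists m, exists2 g, smooth_open O g &
  h = fun x => g x * (f x ^+ m)^-1]) => //.
- move=> _ [m [g sg ->]] x Ox; have [ca da] := smooth_open_diffable sg Ox.
  have [cb db] := dV m x Ox.
  by split; [exact: cvgM|move=> v; apply: derivableM].
- move=> _ v [m [g sg ->]].
  exists (fun x => (dir v g x * (f x ^+ m) + -1 * (g x * dir v (fun x => f x ^+ m) x))
     * (f x ^+ (m + m))^-1).
    exists (m + m)%N, (fun x => dir v g x * (f x ^+ m) +
      -1 * (g x * dir v (fun x => f x ^+ m) x)); last by [].
    apply: smooth_openD; first exact: (smooth_openM (smooth_open_dir v sg) (sX m)).
    apply: smooth_openM; first exact: smooth_open_cst.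
    exact: (smooth_openM sg (smooth_open_dir v (sX m))).
  move=> x Ox; have [ca da] := smooth_open_diffable sg Ox.
  have [cb db] := dV m x Ox.
  rewrite [LHS](deriveM (da v) (db v)) -/(dir v (fun x => (f x ^+ m)^-1) x).
  rewrite (dirV v (sX m) Ox (fm0 m x Ox)) -/(dir v g x) exprD /GRing.scale /=.
  by have := fm0 m x Ox => ?; field.
- exists 1%N, (fun=> 1); first exact: smooth_open_cst.
  by apply/funext => x; rewrite expr1 mul1r.
Qed.

End SmoothOpen.

(** * Mean value theorem, symmetry of second derivatives, chain rule *)

Section DirLinear.
Context {R : realType} {V : normedModType R}.
Implicit Types (O : set V) (F : V -> R) (u v x : V).

Lemma is_derive_line F x v (t : R) : derivable (F : V -> R^o) (t *: v + x) v ->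
  is_derive t 1 (fun s => F (s *: v + x)) (dir v F (t *: v + x)).
Proof.
move=> dF.
have E : (fun h : R => h^-1 *: (((fun s : R => F (s *: v + x)) \o shift t) (h *: 1) -
      F (t *: v + x))) =
    (fun h : R => h^-1 *: ((F \o shift (t *: v + x)) (h *: v) - F (t *: v + x))).
  apply/funext => h /=; congr (_ *: (F _ - _)).
  by rewrite [h *: 1]mulr1 scalerDl addrA.
by split; rewrite /derivable /derive /dir E.
Qed.

Lemma dirZ O F v x (k : R) : smooth_open O F -> O x ->
  dir (k *: v) F x = k * dir v F x.
Proof.
move=> /smooth_open_diffable dF Ox.
have d0 w : is_derive (0 : R) (1 : R) (fun s => F (s *: w + x)) (dir w F x).
  have := @is_derive_line F x w 0; rewrite scale0r add0r; apply.
  exact: (dF x Ox).2.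
have dk : is_derive (0 : R) (1 : R) (fun s => k * s) k.
  have -> : (fun s => k * s) = k *: (id : R -> R) by [].
  by apply: is_derive_eq; rewrite /GRing.scale /= mulr1.
have Dw w : dir w F x = derive1 (fun s => F (s *: w + x)) 0.
  by rewrite derive1E; apply/esym; exact: (@derive_val _ _ _ _ _ _ _ (d0 w)).
have Dk : derive1 (fun s => k * s) 0 = k.
  by rewrite derive1E; exact: (@derive_val _ _ _ _ _ _ _ dk).
rewrite !Dw.
have -> : (fun s => F (s *: (k *: v) + x)) = (fun s => F (s *: v + x)) \o (fun s => k * s).
  by apply/funext => s /=; rewrite scalerA mulrC.
rewrite derive1_comp; [|exact: (@ex_derive _ _ _ _ _ _ _ dk)|]; first by rewrite Dk mulr0 mulrC.
rewrite mulr0; exact: (@ex_derive _ _ _ _ _ _ _ (d0 v)).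
Qed.

Lemma MVT_line O F x v (h : R) : smooth_open O F -> 0 < h ->
  (forall t, 0 <= t <= h -> O (t *: v + x)) ->
  exists2 t, 0 < t < h & F (h *: v + x) - F x = h * dir v F (t *: v + x).
Proof.
move=> /smooth_open_diffable sF h0 Oh.
have D t : 0 <= t <= h -> is_derive t 1 (fun s => F (s *: v + x)) (dir v F (t *: v + x)).
  by move=> th; apply: is_derive_line; exact: (sF _ (Oh t th)).2.
have [||t] := @MVT R (fun s => F (s *: v + x)) (fun t => dir v F (t *: v + x)) 0 h h0.
- by move=> t; rewrite in_itv /= => /andP[t0 th]; apply: D; rewrite !ltW.
- apply: derivable_within_continuous => t; rewrite in_itv /= => th.
  exact: (@ex_derive _ _ _ _ _ _ _ (D t th)).
rewrite in_itv /= => t0h; rewrite scale0r add0r subr0 => ->; exists t => //.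
by rewrite mulrC.
Qed.

Lemma derivable_right F x v : derivable (F : V -> R^o) x v ->
  (fun h : R => h^-1 * (F (h *: v + x) - F x)) @ 0^'+ --> dir v F x.
Proof.
by move=> dF; exact: (@cvg_dnbhs_at_right R R^o _ _ _ dF).
Qed.

Lemma open_ball O x : open O -> O x ->
  exists2 d : R, 0 < d & forall y, `|y - x| < d -> O y.
Proof.
move=> oO Ox; have /nbhs_ballP[d /= d0 dO] := open_nbhs_nbhs (conj oO Ox).
by exists d => // y yx; apply: dO; rewrite -ball_normE /= distrC.
Qed.

Lemma continuous_ball F x (e : R) : {for x, continuous F} -> 0 < e ->
  exists2 d : R, 0 < d & forall y, `|y - x| < d -> `|F y - F x| < e.
Proof.
move=> cF e0; have /cvgrPdist_lt/(_ e e0) := cF.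
move=> /nbhs_ballP[d /= d0 dO]; exists d => // y yx; rewrite distrC.
by apply: dO; rewrite -ball_normE /= distrC.
Qed.

Lemma near_right_lt (d : R) : 0 < d -> \forall h \near (0 : R)^'+, 0 < h < d.
Proof.
move=> d0; near=> h; apply/andP; split; first by near: h; exact: nbhs_right_gt.
by near: h; exact: nbhs_right_lt.
Unshelve. all: by end_near. Qed.

Lemma small_parallelogram u v (d : R) : 0 < d -> exists2 r : R, 0 < r &
  forall s t, 0 <= s <= r -> 0 <= t <= r -> `|s *: u + t *: v| < d.
Proof.
move=> d0; have N0 : 0 < `|u| + `|v| + 1 by rewrite ltr_wpDl// addr_ge0.
exists (d / (`|u| + `|v| + 1)); first by rewrite divr_gt0.
move=> s t /andP[s0 sr] /andP[t0 tr].
rewrite (le_lt_trans (ler_normD _ _))// !normrZ !ger0_norm//.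
apply: (@le_lt_trans _ _ (d / (`|u| + `|v| + 1) * `|u| + d / (`|u| + `|v| + 1) * `|v|)).
  by rewrite lerD// ler_wpM2r.
by rewrite -mulrDr mulrAC ltr_pdivrMr// ltr_pM2l// ltrDl.
Qed.

(** [smooth_open] speaks of single directions, so additivity in the direction has to be proved: move
    from [x] by [h v] and then by [h u], apply the mean value theorem to each leg, and use the
    continuity of [dir u F] and [dir v F]. *)
Lemma dirDv O F u v x : smooth_open O F -> O x ->
  dir (u + v) F x = dir u F x + dir v F x.
Proof.
move=> sF Ox; have oO := sF.1.
have L1 := derivable_right ((smooth_open_diffable sF Ox).2 (u + v)).
suff L2 : (fun h : R => h^-1 * (F (h *: (u + v) + x) - F x)) @ 0^'+ -->
    dir u F x + dir v F x by exact: cvg_unique L1 L2.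
apply/cvgrPdist_lt => e e0; have e20 : 0 < e / 2 by rewrite divr_gt0.
have cdir w : {for x, continuous (dir w F)}.
  exact: (smooth_open_diffable (smooth_open_dir w sF) Ox).1.
have [d0 d00 Od0] := open_ball oO Ox.
have [d1 d10 Fd1] := continuous_ball (cdir u) e20.
have [d2 d20 Fd2] := continuous_ball (cdir v) e20.
have d0' : 0 < Num.min d0 (Num.min d1 d2) by rewrite !lt_min d00 d10 d20.
have [r r0 rP] := small_parallelogram u v d0'.
apply: filterS (near_right_lt r0) => h /andP[h0 hr].
have near s t : 0 <= s <= h -> 0 <= t <= h ->
    [/\ `|s *: u + (t *: v + x) - x| < d0, `|s *: u + (t *: v + x) - x| < d1 &
        `|s *: u + (t *: v + x) - x| < d2].
  move=> /andP[s0 sh] /andP[t0 th]; have := rP s t; rewrite !lt_min addrA addrK.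
  by rewrite s0 t0 !(le_trans _ (ltW hr))// => /(_ isT isT)/and3P.
have h00 : 0 <= (0 : R) <= h by apply/andP; split; [|exact: ltW].
have h0h : 0 <= h <= h by apply/andP; split; [exact: ltW|].
have [|t1 /andP[t10 t1h] E1] := @MVT_line O F (h *: v + x) u h sF h0.
  by move=> t th; apply: Od0; have [] := near t h th h0h.
have [|t2 /andP[t20 t2h] E2] := @MVT_line O F x v h sF h0.
  by move=> t th; apply: Od0; have [] := near 0 t h00 th; rewrite scale0r add0r.
have -> : h^-1 * (F (h *: (u + v) + x) - F x) =
  dir u F (t1 *: u + (h *: v + x)) + dir v F (t2 *: v + x).
  have -> : F (h *: (u + v) + x) - F x = F (h *: u + (h *: v + x)) - F (h *: v + x)
    + (F (h *: v + x) - F x) by rewrite scalerDr -addrA subrKA.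
  by rewrite E1 E2 -mulrDr mulrA mulVf ?mul1r// gt_eqF.
rewrite opprD addrACA (le_lt_trans (ler_normD _ _))// [e]splitr ltrD// distrC.
- by apply: Fd1; have [] := near t1 h _ h0h; rewrite ?(ltW t10) ?ltW.
- by apply: Fd2; have [] := near 0 t2 h00; rewrite ?(ltW t20) ?(ltW t2h) // scale0r add0r.
Qed.

(** Two mean value theorems: in direction [u] for the increment of [F] under the shift by [h v],
    then in direction [v] for [dir u F]. *)
Lemma second_difference O F u v x (h : R) : smooth_open O F -> 0 < h ->
  (forall s t, 0 <= s <= h -> 0 <= t <= h -> O (s *: u + (t *: v + x))) ->
  exists s t, [/\ 0 <= s <= h, 0 <= t <= h &
    F (h *: u + (h *: v + x)) - F (h *: v + x) - (F (h *: u + x) - F x) =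
    h * h * dir v (dir u F) (s *: u + (t *: v + x))].
Proof.
move=> sF h0 Oh.
have h00 : 0 <= (0 : R) <= h by apply/andP; split; [|exact: ltW].
have h0h : 0 <= h <= h by apply/andP; split; [exact: ltW|].
have Oh0 s : 0 <= s <= h -> O (s *: u + x).
  by move=> sh; have := Oh s 0 sh h00; rewrite scale0r add0r.
pose g s := F (s *: u + (h *: v + x)) - F (s *: u + x).
pose dg s := dir u F (s *: u + (h *: v + x)) - dir u F (s *: u + x).
have D s : 0 <= s <= h -> is_derive s 1 (g : R -> R^o) (dg s).
  move=> sh; have [_ D1] := smooth_open_diffable sF (Oh s h sh h0h).
  have [_ D2] := smooth_open_diffable sF (Oh0 s sh).
  exact: is_deriveB (is_derive_line (D1 u)) (is_derive_line (D2 u)).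
have [||s] := @MVT R g dg 0 h h0.
- by move=> s; rewrite in_itv /= => /andP[s0 sh]; apply: D; rewrite !ltW.
- apply: derivable_within_continuous => s; rewrite in_itv /= => sh.
  exact: (@ex_derive _ _ _ _ _ _ _ (D s sh)).
rewrite in_itv /= => /andP[s0 sh]; rewrite {1 2}/g !scale0r !add0r subr0 => Eg.
have sh' : 0 <= s <= h by rewrite !ltW.
have [|t /andP[t0 th] E2] :=
  @MVT_line O (dir u F) (s *: u + x) v h (smooth_open_dir u sF) h0.
  by move=> t th; have := Oh s t sh' th; rewrite addrCA.
exists s, t; split; [exact: sh'|by rewrite !ltW|].
transitivity (dg s * h).
  by rewrite -Eg; ring.
have e1 : s *: u + (h *: v + x) = h *: v + (s *: u + x) by rewrite addrCA.
have e2 : s *: u + (t *: v + x) = t *: v + (s *: u + x) by rewrite addrCA.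
by rewrite /dg e1 e2 E2 mulrC mulrA.
Qed.

(** The second difference over the parallelogram spanned by [h u] and [h v] is symmetric in [u] and
    [v]. Hence the two mixed derivatives take equal values at two points near [x], and continuity
    carries this to [x]. *)
Lemma dir_dirC O F u v x : smooth_open O F -> O x ->
  dir v (dir u F) x = dir u (dir v F) x.
Proof.
move=> sF Ox; have oO := sF.1; apply/eqP; rewrite -subr_eq0 -normr_le0.
apply/ler_addgt0Pr => e e0; rewrite add0r; have e20 : 0 < e / 2 by rewrite divr_gt0.
have cdir w w' : {for x, continuous (dir w (dir w' F))}.
  exact: (smooth_open_diffable (smooth_open_dir w (smooth_open_dir w' sF)) Ox).1.
have [d0 d00 Od0] := open_ball oO Ox.
have [d1 d10 Fd1] := continuous_ball (cdir v u) e20.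
have [d2 d20 Fd2] := continuous_ball (cdir u v) e20.
have d0' : 0 < Num.min d0 (Num.min d1 d2) by rewrite !lt_min d00 d10 d20.
have [h h0 rP] := small_parallelogram u v d0'.
have near s t : 0 <= s <= h -> 0 <= t <= h ->
    [/\ `|s *: u + (t *: v + x) - x| < d0, `|s *: u + (t *: v + x) - x| < d1 &
        `|s *: u + (t *: v + x) - x| < d2].
  by move=> sh th; have := rP s t sh th; rewrite !lt_min addrA addrK => /and3P.
have [|s [t [sh th E1]]] := @second_difference O F u v x h sF h0.
  by move=> s t sh th; apply: Od0; have [] := near s t sh th.
have [|s' [t' [sh' th' E2]]] := @second_difference O F v u x h sF h0.
  by move=> s' t' sh' th'; apply: Od0; have [] := near t' s' th' sh'; rewrite addrCA.
have E : dir v (dir u F) (s *: u + (t *: v + x)) = dir u (dir v F) (s' *: v + (t' *: u + x)).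
  apply: (@mulfI _ (h * h)); first by rewrite mulf_neq0// gt_eqF.
  have e1 : h *: v + (h *: u + x) = h *: u + (h *: v + x) by rewrite addrCA.
  have e2 (p q r s0 : R) : p - q - (r - s0) = p - r - (q - s0) by ring.
  by apply: etrans (esym E1) (etrans _ E2); rewrite e1; exact: e2.
have [_ H1 _] := near s t sh th; have [_ _ H2] := near t' s' th' sh'.
have e1 : s' *: v + (t' *: u + x) = t' *: u + (s' *: v + x) by rewrite addrCA.
have G1 := Fd1 _ H1; have := Fd2 _ H2; rewrite -e1 -E.
move: G1; set p := dir v _ (_ + _); set q := dir v _ x; set r := dir u _ x => G1 G2.
clearbody p q r; apply/ltW/(le_lt_trans (ler_distD p q r)).
by rewrite [e]splitr; apply: ltrD; [rewrite distrC; exact: G1|exact: G2].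
Qed.

End DirLinear.

Section Partial.
Context {R : realType} {d : nat}.
Local Notation V := 'rV[R]_d.
Implicit Types (O : set V) (F : V -> R) (u v x : V).

Definition partial (a : 'I_d) F : V -> R := dir (delta_mx 0 a) F.

Lemma dir_partial O F v x : smooth_open O F -> O x ->
  dir v F x = \sum_a v 0 a * partial a F x.
Proof.
move=> sF Ox; rewrite [in LHS](row_sum_delta v).
have : forall s : seq 'I_d, dir (\sum_(a <- s) v 0 a *: delta_mx 0 a) F x =
    \sum_(a <- s) v 0 a * partial a F x.
  elim=> [|a s IH]; first by rewrite !big_nil /dir derive0.
  by rewrite !big_cons (dirDv _ _ sF Ox) IH (dirZ _ _ sF Ox).
exact.
Qed.

Lemma mvt O F x y (r : R) : smooth_open O F ->
  (forall z, `|z - x| < r -> O z) -> `|y - x| < r ->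
  exists2 z, `|z - x| <= `|y - x| &
    F y - F x = \sum_a (y - x) 0 a * partial a F z.
Proof.
move=> sF rO yr.
have inO (t : R) : 0 <= t <= 1 -> `|t *: (y - x) + x - x| <= `|y - x|.
  move=> /andP[t0 t1]; rewrite addrK normrZ ger0_norm//.
  by rewrite ler_piMl.
have [|t /andP[t0 t1]] := @MVT_line R V O F x (y - x) 1 sF ltr01.
  by move=> t t1; apply: rO; exact: le_lt_trans (inO t t1) yr.
rewrite mul1r scale1r subrK => E.
have t01 : 0 <= t <= 1 by rewrite !ltW.
exists (t *: (y - x) + x); first exact: inO.
rewrite E; apply: dir_partial sF _; apply: rO; exact: le_lt_trans (inO t t01) yr.
Qed.

(* First-order chain rule along an arbitrary filter; it serves both one-sided
   and two-sided difference quotients. *)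
Lemma chain_cvg (G : set_system R) {FG : Filter G} O F x (c : R -> V) (c' : V) :
  smooth_open O F -> O x -> c @ G --> x ->
  (forall a, (fun h => h^-1 * (c h 0 a - x 0 a)) @ G --> c' 0 a) ->
  (fun h => h^-1 * (F (c h) - F x)) @ G --> \sum_a c' 0 a * partial a F x.
Proof.
move=> sF Ox cx dc; have [r r0 rO] := open_ball sF.1 Ox.
pose z h := if pselect (exists2 z, `|z - x| <= `|c h - x| &
    F (c h) - F x = \sum_a (c h - x) 0 a * partial a F z) is left e
  then projT1 (cid2 e) else x.
have ncr (e : R) : 0 < e -> \forall h \near G, `|c h - x| < e.
  by move=> e0; have /cvgrPdist_lt/(_ e e0) := cx; apply: filterS => h; rewrite distrC.
have zP : \forall h \near G, `|z h - x| <= `|c h - x| /\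
    F (c h) - F x = \sum_a (c h - x) 0 a * partial a F (z h).
  apply: filterS (ncr r r0) => h hr; rewrite /z; case: pselect => [e|]; last first.
    by case; exact: mvt sF rO hr.
  by case: (cid2 e).
have zx : z @ G --> x.
  apply/cvgrPdist_lt => e e0; near=> h; rewrite distrC.
  have [zc _] : `|z h - x| <= `|c h - x| /\
    F (c h) - F x = \sum_a (c h - x) 0 a * partial a F (z h) by near: h.
  by apply: (le_lt_trans zc); near: h; exact: ncr.
have L : (fun h => \sum_a (h^-1 * (c h 0 a - x 0 a)) * partial a F (z h)) @ G -->
    \sum_a c' 0 a * partial a F x.
  apply: cvg_big => [|a _]; first exact: add_continuous.
  apply: cvgM; first exact: dc.
  apply: (@cvg_comp _ _ _ z (partial a F) G (nbhs x)); first exact: zx.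
  exact: (smooth_open_diffable (smooth_open_dir _ sF) Ox).1.
apply: cvg_trans L; apply: near_eq_cvg; apply: filterS zP => h [_ ->].
rewrite mulr_sumr; apply: eq_bigr => a _; rewrite !mxE mulrA //.
Unshelve. all: by end_near. Qed.

End Partial.

(** * Smooth functions on relatively open subsets of the half-space *)

Section SmoothOn.
Context {R : realType} {V : normedModType R}.
Implicit Types (O S : set V) (f g : V -> R).

Lemma smooth_on_sub S S' f : S' `<=` S -> smooth_on S f -> smooth_on S' f.
Proof.
move=> S'S sf x /S'S Sx; have [W [F [Wx sF FE]]] := sf x Sx.
by exists W, F; split=> // y Oy /S'S; exact: FE.
Qed.

Lemma smooth_on_ext S f g : (forall x, S x -> f x = g x) ->
  smooth_on S f -> smooth_on S g.
Proof.
move=> fg sf x Sx; have [W [F [Wx sF FE]]] := sf x Sx.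
by exists W, F; split=> // y Oy Sy; rewrite -fg//; exact: FE.
Qed.

Lemma smooth_on_cst S (k : R) : smooth_on S (fun=> k).
Proof.
move=> x Sx; exists setT, (fun=> k); split => //.
exact: (smooth_open_cst k openT).
Qed.

Lemma smooth_on2 S f g : smooth_on S f -> smooth_on S g -> forall x, S x ->
  exists O F G, [/\ O x, smooth_open O F, smooth_open O G,
    forall y, O y -> S y -> F y = f y & forall y, O y -> S y -> G y = g y].
Proof.
move=> sf sg x Sx; have [W [F [Wx sF FE]]] := sf x Sx.
have [W' [G [W'x sG GE]]] := sg x Sx.
have oI : open (W `&` W') by apply: openI; [exact: sF.1|exact: sG.1].
exists (W `&` W'), F, G; split => //.
- by apply: smooth_open_sub sF => // y [].
- by apply: smooth_open_sub sG => // y [].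
- by move=> y [Oy _]; exact: FE.
- by move=> y [_ Oy]; exact: GE.
Qed.

Lemma smooth_onD S f g :
  smooth_on S f -> smooth_on S g -> smooth_on S (fun x => f x + g x).
Proof.
move=> sf sg x Sx; have [W [F [G [Wx sF sG FE GE]]]] := smooth_on2 sf sg Sx.
exists W, (fun x => F x + G x); split; [exact: Wx|exact: smooth_openD|].
by move=> y Oy Sy; rewrite FE// GE.
Qed.

Lemma smooth_onM S f g :
  smooth_on S f -> smooth_on S g -> smooth_on S (fun x => f x * g x).
Proof.
move=> sf sg x Sx; have [W [F [G [Wx sF sG FE GE]]]] := smooth_on2 sf sg Sx.
exists W, (fun x => F x * G x); split; [exact: Wx|exact: smooth_openM|].
by move=> y Oy Sy; rewrite FE// GE.
Qed.

Lemma smooth_onN S f : smooth_on S f -> smooth_on S (fun x => - f x).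
Proof.
move=> sf; apply: (smooth_on_ext _ (smooth_onM (@smooth_on_cst S (-1)) sf)) => x _.
by rewrite mulN1r.
Qed.

Lemma smooth_onB S f g :
  smooth_on S f -> smooth_on S g -> smooth_on S (fun x => f x - g x).
Proof. by move=> sf sg; apply: smooth_onD => //; exact: smooth_onN. Qed.

Lemma smooth_on_sum (I : Type) (r : seq I) (P : pred I) S (F : I -> V -> R) :
  (forall i, P i -> smooth_on S (F i)) ->
  smooth_on S (fun x => \sum_(i <- r | P i) F i x).
Proof.
move=> sF; elim: r => [|i r IH].
  by apply: (smooth_on_ext _ (@smooth_on_cst S 0)) => x; rewrite big_nil.
case Pi: (P i).
  by apply: (smooth_on_ext _ (smooth_onD (sF i Pi) IH)) => x _; rewrite big_cons Pi.
by apply: (smooth_on_ext _ IH) => x _; rewrite big_cons Pi.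
Qed.

Lemma smooth_on_prod (I : Type) (r : seq I) (P : pred I) S (F : I -> V -> R) :
  (forall i, P i -> smooth_on S (F i)) ->
  smooth_on S (fun x => \prod_(i <- r | P i) F i x).
Proof.
move=> sF; elim: r => [|i r IH].
  by apply: (smooth_on_ext _ (@smooth_on_cst S 1)) => x; rewrite big_nil.
case Pi: (P i).
  by apply: (smooth_on_ext _ (smooth_onM (sF i Pi) IH)) => x _; rewrite big_cons Pi.
by apply: (smooth_on_ext _ IH) => x _; rewrite big_cons Pi.
Qed.

Lemma open_smooth_preimage O f (A : set R) : smooth_open O f -> open A ->
  open (O `&` f @^-1` A).
Proof.
move=> sf oA; rewrite openE => x [Ox Ax]; apply: filterI.
  by apply: open_nbhs_nbhs; split => //; exact: sf.1.
have [cf _] := smooth_open_diffable sf Ox; apply: cf.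
by apply: open_nbhs_nbhs; split.
Qed.

Lemma smooth_onV S f : smooth_on S f -> (forall x, S x -> f x != 0) ->
  smooth_on S (fun x => (f x)^-1).
Proof.
move=> sf f0 x Sx; have [W [F [Wx sF FE]]] := sf x Sx.
have o0 : open [set r : R | r != 0] by exact: open_neq.
have oO := open_smooth_preimage sF o0.
exists (W `&` F @^-1` [set r : R | r != 0]), (fun x => (F x)^-1); split.
- by split => //=; rewrite FE//; exact: f0.
- apply: smooth_openV; last by move=> y [].
  by apply: smooth_open_sub sF => // y [].
- by move=> y [Oy _] Sy; rewrite FE.
Qed.

Lemma smooth_on_norm S f : smooth_on S f -> (forall x, S x -> f x != 0) ->
  smooth_on S (fun x => `|f x|).
Proof.
move=> sf f0 x Sx; have [W [F [Wx sF FE]]] := sf x Sx.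
(* The sign of [f] is locally constant, so [e * F] extends the norm of [f] on the open set where it
   is positive. *)
pose e := Num.sg (f x).
have o0 : open [set r : R | 0 < e * r].
  apply: (@open_comp _ _ (fun r : R => e * r) [set r : R | 0 < r]).
    by move=> r _; exact: mulrl_continuous.
  exact: open_gt.
have oO := open_smooth_preimage sF o0.
exists (W `&` F @^-1` [set r : R | 0 < e * r]), (fun x => e * F x); split.
- by split => //=; rewrite FE// -normrEsg normr_gt0 f0.
- apply: smooth_openM; first exact: smooth_open_cst.
  by apply: smooth_open_sub sF => // y [].
- move=> y [Oy /=] p Sy; rewrite FE// in p *.
  by rewrite -[LHS]ger0_norm ?ltW// normrM normr_sg f0// mul1r.
Qed.

Lemma smooth_on_continuous S f x : smooth_on S f -> S x ->
  f @ within S (nbhs x) --> f x.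
Proof.
move=> sf Sx; have [W [F [Wx sF FE]]] := sf x Sx.
have [cF _] := smooth_open_diffable sF Wx.
rewrite -FE//.
have : F @ within S (nbhs x) --> F x by apply: cvg_trans cF; apply/cvg_app/cvg_within.
apply: cvg_trans; apply: near_eq_cvg; rewrite near_withinE.
by apply: (near_open sF.1 Wx) => y Oy Sy; rewrite FE.
Qed.

End SmoothOn.

Section Region.
Context {R : realType} {n : nat}.
Local Notation V := 'rV[R]_n.+1.
Implicit Types (O S T : set V) (f g : V -> R) (x y : V).

(* Relatively open subsets of the half-space. *)
Definition region S :=
  S `<=` halfspace n /\ forall x, S x -> \forall y \near x, halfspace n y -> S y.

Lemma near_right_shift (P : V -> Prop) x v : (\forall y \near x, P y) ->
  \forall h \near (0 : R)^'+, P (x + h *: v).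
Proof.
move=> /nbhs_ballP[e /= e0 eP].
have N0 : 0 < `|v| + 1 by rewrite ltr_wpDl.
have d0 : 0 < e / (`|v| + 1) by rewrite divr_gt0.
apply: filterS (near_right_lt d0) => h /andP[h0 hd]; apply: eP.
rewrite -ball_normE /= opprD addrA subrr sub0r normrN normrZ gtr0_norm//.
apply: (@le_lt_trans _ _ (e / (`|v| + 1) * `|v|)); first by rewrite ler_wpM2r// ltW.
by rewrite mulrAC ltr_pdivrMr// ltr_pM2l// ltrDl.
Qed.

(** Adding a nonnegative multiple of a coordinate vector never leaves the half-space, even from a
    boundary point; this is why [pd] is a limit from the right. *)
Lemma region_shift S x a : region S -> S x ->
  \forall h \near (0 : R)^'+, S (x + h *: delta_mx 0 a).
Proof.
move=> [SH Sn] Sx; near=> h.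
have : halfspace n (x + h *: delta_mx 0 a).
  rewrite /halfspace /= !mxE addr_ge0//; first exact: SH.
  by rewrite mulr_ge0.
by near: h; exact: near_right_shift (Sn x Sx).
Unshelve. all: by end_near. Qed.

Lemma pd_extension S O f F a x : region S -> S x -> O x -> smooth_open O F ->
  (forall y, O y -> S y -> F y = f y) ->
  (fun h : R => h^-1 * (f (x + h *: delta_mx 0 a) - f x)) @ 0^'+ --> partial a F x.
Proof.
move=> rS Sx Ox sF FE.
have L := derivable_right ((smooth_open_diffable sF Ox).2 (delta_mx 0 a)).
apply: cvg_trans L; apply: near_eq_cvg; near=> h.
rewrite [h *: _ + x]addrC FE//; last by near: h; exact: (region_shift a rS Sx).
  by rewrite FE.
by near: h; apply: (@near_right_shift O); apply: (near_open sF.1 Ox) => y.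
Unshelve. all: by end_near. Qed.

(** The right-hand quotients of [f] and of any extension agree for small [h]. The rules for [pd] are
    inherited from those for [smooth_open] in this way. *)
Lemma pdE S O f F a x : region S -> S x -> O x -> smooth_open O F ->
  (forall y, O y -> S y -> F y = f y) -> pd a f x = partial a F x.
Proof.
by move=> rS Sx Ox sF FE; exact: (cvg_lim (@Rhausdorff R) (pd_extension rS Sx Ox sF FE)).
Qed.

Lemma pd_cvg S f a x : region S -> smooth_on S f -> S x ->
  (fun h : R => h^-1 * (f (x + h *: delta_mx 0 a) - f x)) @ 0^'+ --> pd a f x.
Proof.
move=> rS sf Sx; have [W [F [Wx sF FE]]] := sf x Sx.
by rewrite (pdE a rS Sx Wx sF FE); exact: (pd_extension rS Sx Wx sF FE).
Qed.

Lemma smooth_on_pd S f a : region S -> smooth_on S f -> smooth_on S (pd a f).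
Proof.
move=> rS sf x Sx; have [W [F [Wx sF FE]]] := sf x Sx.
exists W, (partial a F); split; [exact: Wx|exact: (smooth_open_dir _ sF)|].
by move=> y Wy Sy; rewrite (pdE a rS Sy Wy sF FE).
Qed.

(** Agreement along one ray is enough. This gives tangential derivatives at the boundary of
    functions known there only along the boundary. *)
Lemma pd_eq f g a x :
  (\forall h \near (0 : R)^'+, f (x + h *: delta_mx 0 a) = g (x + h *: delta_mx 0 a)) ->
  f x = g x -> pd a f x = pd a g x.
Proof.
move=> fg fgx; rewrite /pd fgx; congr (lim _).
rewrite eqEsubset; split; apply: near_eq_cvg; apply: filterS fg => h -> //.
Qed.

Lemma pd_ext S f g a x : region S -> S x -> (forall y, S y -> f y = g y) ->
  pd a f x = pd a g x.
Proof.
move=> rS Sx fg; apply: pd_eq; last exact: fg.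
by apply: filterS (region_shift a rS Sx) => h; exact: fg.
Qed.

Lemma pd_cst (k : R) a x : pd a (fun=> k) x = 0.
Proof.
apply/lim_near_cst => //=; apply: nearW => h; by rewrite subrr mulr0.
Qed.

Lemma pdD S f g a x : region S -> smooth_on S f -> smooth_on S g -> S x ->
  pd a (fun y => f y + g y) x = pd a f x + pd a g x.
Proof.
move=> rS sf sg Sx; have [W [F [G [Wx sF sG FE GE]]]] := smooth_on2 sf sg Sx.
rewrite (pdE a rS Sx Wx sF FE) (pdE a rS Sx Wx sG GE) -(dirD _ sF sG Wx).
apply: (pdE a rS Sx Wx (smooth_openD sF sG)) => y Wy Sy; by rewrite FE// GE.
Qed.

Lemma pdM S f g a x : region S -> smooth_on S f -> smooth_on S g -> S x ->
  pd a (fun y => f y * g y) x = f x * pd a g x + g x * pd a f x.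
Proof.
move=> rS sf sg Sx; have [W [F [G [Wx sF sG FE GE]]]] := smooth_on2 sf sg Sx.
rewrite (pdE a rS Sx Wx sF FE) (pdE a rS Sx Wx sG GE) -FE// -GE// -(dirM _ sF sG Wx).
apply: (pdE a rS Sx Wx (smooth_openM sF sG)) => y Wy Sy; by rewrite FE// GE.
Qed.

Lemma pdZ S f (k : R) a x : region S -> smooth_on S f -> S x ->
  pd a (fun y => k * f y) x = k * pd a f x.
Proof.
by move=> rS sf Sx; rewrite (pdM a rS (@smooth_on_cst _ _ _ k) sf Sx) pd_cst mulr0 addr0.
Qed.

Lemma pdN S f a x : region S -> smooth_on S f -> S x ->
  pd a (fun y => - f y) x = - pd a f x.
Proof.
move=> rS sf Sx; rewrite -mulN1r -(pdZ _ _ rS sf Sx); congr (pd a _ x).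
by apply/funext => y; rewrite mulN1r.
Qed.

Lemma pdB S f g a x : region S -> smooth_on S f -> smooth_on S g -> S x ->
  pd a (fun y => f y - g y) x = pd a f x - pd a g x.
Proof.
move=> rS sf sg Sx; rewrite (pdD a rS sf (smooth_onN sg) Sx).
by rewrite (pdN a rS sg Sx).
Qed.

Lemma pd_sum (I : Type) (r : seq I) (P : pred I) S (F : I -> V -> R) a x :
  region S -> (forall i, P i -> smooth_on S (F i)) -> S x ->
  pd a (fun y => \sum_(i <- r | P i) F i y) x = \sum_(i <- r | P i) pd a (F i) x.
Proof.
move=> rS sF Sx; elim: r => [|i r IH].
  rewrite big_nil -[RHS](pd_cst 0 a x); congr (pd a _ x).
  by apply/funext => y; rewrite big_nil.
rewrite big_cons; case: ifPn => Pi.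
  rewrite -IH -(pdD a rS (sF i Pi) _ Sx); last exact: smooth_on_sum.
  by congr (pd a _ x); apply/funext => y; rewrite big_cons Pi.
by rewrite -IH; congr (pd a _ x); apply/funext => y; rewrite big_cons (negbTE Pi).
Qed.

Lemma pd_pd S f a b x : region S -> smooth_on S f -> S x ->
  pd a (pd b f) x = pd b (pd a f) x.
Proof.
move=> rS sf Sx; have [W [F [Wx sF FE]]] := sf x Sx.
have E c y : W y -> S y -> partial c F y = pd c f y.
  by move=> Wy Sy; rewrite (pdE c rS Sy Wy sF FE).
rewrite (pdE a rS Sx Wx (smooth_open_dir _ sF) (E b)).
rewrite (pdE b rS Sx Wx (smooth_open_dir _ sF) (E a)).
exact: dir_dirC sF Wx.
Qed.

Lemma cvg_row (T : Type) (G : set_system T) {FG : Filter G} (c : T -> V) (l : V) :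
  (forall a, (fun h => c h 0 a) @ G --> l 0 a) -> c @ G --> l.
Proof.
move=> cl; apply/cvgrPdist_le => e e0; near=> h.
rewrite /Num.Def.normr/= mx_normrE (bigmax_le _ (ltW e0))//= => -[i a] _.
rewrite !mxE (ord1 i)/=; move: a {i}; near: h; apply: filter_forall => a.
exact: ((cvgrPdist_le _ _).1 (cl a) e e0).
Unshelve. all: by end_near. Qed.

Lemma cvg_shift_right S f a x : region S -> smooth_on S f -> S x ->
  (fun h => f (x + h *: delta_mx 0 a)) @ (0 : R)^'+ --> f x.
Proof.
move=> rS sf Sx; have [W [F [Wx sF FE]]] := sf x Sx.
have [cF _] := smooth_open_diffable sF Wx.
rewrite -FE//; apply/cvgrPdist_lt => e e0.
have /cvgrPdist_lt/(_ e e0)/(@near_right_shift (fun y => `|F x - F y| < e) _ (delta_mx 0 a)) := cF.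
have := region_shift a rS Sx.
have := @near_right_shift W x (delta_mx 0 a) (near_open sF.1 Wx (fun y Wy => Wy)).
apply: filterS3 => h Wh Sh Fh; by rewrite -FE.
Qed.

(** The points [phi (x + h e_a)] tend to [phi x] along a curve in [T] and not along a coordinate
    ray, so [f] is first replaced by an extension. Convergence is stated, and not just the value of
    the limit, because a product rule for quotients builds on it. *)
Lemma pd_comp S T (phi : V -> V) f a x : region S -> region T ->
  (forall b, smooth_on S (fun y => phi y 0 b)) -> smooth_on T f ->
  (forall y, S y -> T (phi y)) -> S x ->
  (fun h : R => h^-1 * (f (phi (x + h *: delta_mx 0 a)) - f (phi x))) @ 0^'+ -->
  \sum_b pd a (fun y => phi y 0 b) x * pd b f (phi x).
Proof.
move=> rS rT sphi sf ST Sx; have Tx := ST x Sx.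
have [W [F [Wx sF FE]]] := sf _ Tx.
have cphi : (fun h => phi (x + h *: delta_mx 0 a)) @ (0 : R)^'+ --> phi x.
  by apply: cvg_row => b; exact: (cvg_shift_right a rS (sphi b) Sx).
have dphi b : (fun h : R => h^-1 * (phi (x + h *: delta_mx 0 a) 0 b - phi x 0 b)) @ 0^'+
    --> (\row_b pd a (fun y => phi y 0 b) x) 0 b.
  by rewrite mxE; exact: (pd_cvg rS (sphi b) Sx).
have -> : \sum_b pd a (fun y => phi y 0 b) x * pd b f (phi x) =
    \sum_b (\row_b pd a (fun y => phi y 0 b) x) 0 b * partial b F (phi x).
  by apply: eq_bigr => b _; rewrite mxE (pdE b rT Tx Wx sF FE).
have L : (fun h : R => h^-1 * (F (phi (x + h *: delta_mx 0 a)) - F (phi x))) @ 0^'+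
    --> \sum_b (\row_b pd a (fun y => phi y 0 b) x) 0 b * partial b F (phi x).
  exact: chain_cvg sF Wx cphi dphi.
apply: cvg_trans L; apply: near_eq_cvg.
have Hsh := region_shift a rS Sx.
have nW : \forall y \near phi x, W y.
  exact: (near_open sF.1 Wx (fun y Wy => Wy)).
have nW' : \forall h \near (0:R)^'+, W (phi (x + h *: delta_mx 0 a)) by exact: cphi nW.
move: nW' Hsh; apply: filterS2 => h Wh Sh.
by rewrite (FE _ Wh (ST _ Sh)) (FE _ Wx (ST _ Sx)).
Qed.

Lemma pd_chain S T (phi : V -> V) f a x : region S -> region T ->
  (forall b, smooth_on S (fun y => phi y 0 b)) -> smooth_on T f ->
  (forall y, S y -> T (phi y)) -> S x ->
  pd a (fun y => f (phi y)) x = \sum_b pd a (fun y => phi y 0 b) x * pd b f (phi x).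
Proof.
by move=> rS rT sphi sf ST Sx; exact: (cvg_lim (@Rhausdorff R) (pd_comp rS rT sphi sf ST Sx)).
Qed.

(** Moving in the direction of coordinate 0 reaches points with positive coordinate 0 from anywhere
    in a region. Every passage from the interior to the boundary rests on this. *)
Lemma smooth_on_closure S f g : region S -> smooth_on S f -> smooth_on S g ->
  (forall y, S y -> 0 < y 0 ord0 -> f y = g y) -> forall x, S x -> f x = g x.
Proof.
move=> rS sf sg fg x Sx.
have Lf := cvg_shift_right ord0 rS sf Sx.
have Lg := cvg_shift_right ord0 rS sg Sx.
apply: cvg_unique Lf _; first exact: norm_hausdorff.
apply: cvg_trans Lg; apply: near_eq_cvg.
have := nbhs_right_gt (0 : R); have := region_shift ord0 rS Sx.
apply: filterS2 => h Sh h0; rewrite fg// !mxE eqxx mulr1.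
by rewrite ltr_wpDl//; exact: rS.1.
Qed.

End Region.

(** * Charts of a manifold with boundary *)

Section Minimum.
Context {R : realType} {n : nat}.
Local Notation V := 'rV[R]_n.+1.

Lemma dir_min_ge0 (O : set V) (F : V -> R) (v x : V) : smooth_open O F -> O x ->
  (\forall y \near x, F x <= F y) -> 0 <= dir v F x.
Proof.
move=> sF Ox Fx.
have L := derivable_right ((smooth_open_diffable sF Ox).2 v).
apply: (cvgr_to_ge L); near=> h.
have h0 : 0 < h by near: h; exact: nbhs_right_gt.
rewrite mulr_ge0 ?invr_ge0 ?(ltW h0)// subr_ge0 addrC.
by near: h; exact: (@near_right_shift _ _ (fun y => F x <= F y) x v Fx).
Unshelve. all: by end_near. Qed.

Lemma dir_min (O : set V) (F : V -> R) (v x : V) : smooth_open O F -> O x ->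
  (\forall y \near x, F x <= F y) -> dir v F x = 0.
Proof.
move=> sF Ox Fx; apply/eqP; rewrite eq_le (dir_min_ge0 v sF Ox Fx) andbT.
have := dir_min_ge0 (-1 *: v) sF Ox Fx.
by rewrite (dirZ _ _ sF Ox) mulN1r oppr_ge0.
Qed.

Lemma pd_coord (a b : 'I_n.+1) (x : V) : pd a (fun z : V => z 0 b) x = (a == b)%:R.
Proof.
apply/lim_near_cst; first exact: Rhausdorff.
apply: filterS (nbhs_right_gt (0 : R)) => h h0.
rewrite !mxE eqxx /= [b == a]eq_sym addrAC subrr add0r mulrA mulVf ?mul1r//.
by rewrite gt_eqF.
Qed.

Lemma near_coord_gt0 (x : V) (a : 'I_n.+1) : 0 < x 0 a ->
  \forall y \near x, 0 < (y : V) 0 a.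
Proof.
have /cvgr_gt := @coord_continuous R 1 n.+1 0 a x; exact.
Qed.

End Minimum.

Section Manifold.
Context {R : realType} {X : topologicalType} {n : nat} {A : atlas R X n.+1}.
Context (HM : manifold_with_boundary A).
Implicit Types (i j k : ix A) (U : set X).
Local Notation V := 'rV[R]_n.+1.

Lemma reg_crd U i p : dom i p -> U p -> reg U i (crd i p).
Proof. by move=> ip Up; exists p. Qed.

Lemma par_crd i p : dom i p -> par i (crd i p) = p.
Proof. by case: HM => _ _ _ /(_ i)[_ _ + _ _] _; apply. Qed.

Lemma reg_par U i x : reg U i x -> [/\ dom i (par i x), U (par i x) & crd i (par i x) = x].
Proof. by move=> [p [ip Up] <-]; rewrite par_crd. Qed.

Lemma regI U U' i : reg (U `&` U') i = reg U i `&` reg U' i.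
Proof.
apply/seteqP; split => [x /reg_par[ix [Ux U'x] <-]|x [/reg_par[ix Ux e] /reg_par[_ U'x _]]].
  by split; exact: reg_crd.
by rewrite -e; exact: reg_crd.
Qed.

Lemma reg_halfspace U i x : reg U i x -> halfspace n x.
Proof.
move=> [p [ip Up] <-]; case: HM => _ _ _ /(_ i)[_ [W [_ WE]] _ _ _] _.
have : reg setT i (crd i p) by exact: reg_crd.
by rewrite WE => -[].
Qed.

Lemma dom_open i : open (dom i).
Proof. by case: HM => _ _ _ /(_ i)[]. Qed.

Lemma covered p : exists i, dom i p.
Proof. by case: HM => _ _ cT _ _; have : carrier A p by rewrite cT. Qed.

Lemma crd_continuous i p : dom i p -> {for p, continuous (crd i)}.
Proof. by case: HM => _ _ _ /(_ i)[_ _ _ + _] _; apply. Qed.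

(** The image of the chart is relatively open in the half-space, and continuity of [par] within this
    image pulls [U] back to a relatively open set. *)
Lemma region_reg U i : open U -> region (reg U i).
Proof.
move=> oU; split; first by move=> x; exact: reg_halfspace.
move=> _ [p [ip Up] <-].
have [_ [W [oW WE]] _ _ cpar] : [/\ open (dom i), exists O, open O /\ reg setT i = O `&` halfspace n,
        forall p, dom i p -> par i (crd i p) = p,
        forall p, dom i p -> {for p, continuous (crd i)} &
        {within reg setT i, continuous (par i)}] by case: HM.
have rp : reg setT i (crd i p) by exact: reg_crd.
have Wp : W (crd i p) by move: rp; rewrite WE => -[].
have C : par i @ within (reg setT i) (nbhs (crd i p)) --> p.
  rewrite -[X in _ --> X](par_crd ip).
  exact: ((subspace_continuousP _ _).1 cpar _ rp).
have H' : \forall y \near crd i p, reg setT i y -> U (par i y).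
  exact: (C U (open_nbhs_nbhs (conj oU Up))).
have H2 := near_open oW Wp (fun y Wy => Wy).
near=> y => Hy.
have Ty : reg setT i y by rewrite WE; split => //; near: y.
have [iy _ <-] := reg_par Ty; apply: reg_crd => //.
by move: Ty; near: y.
Unshelve. all: by end_near. Qed.

Lemma trans_crd i j p : dom i p -> trans i j (crd i p) = crd j p.
Proof. by move=> ip; rewrite /trans par_crd. Qed.

Lemma smooth_trans i j a : smooth_on (reg (dom j) i) (fun x => trans i j x 0 a).
Proof. by case: HM. Qed.

Lemma smooth_jac i j a b : smooth_on (reg (dom j) i) (fun x => jac i j x a b).
Proof.
have rS := region_reg i (dom_open j).
apply: (smooth_on_ext _ (smooth_on_pd a rS (@smooth_trans i j b))) => x _.
by rewrite mxE.
Qed.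

Lemma pd_trans_comp (f : V -> R) i j U a p : open U -> dom i p -> dom j p -> U p ->
  smooth_on (reg U j) f ->
  pd a (fun z => f (trans i j z)) (crd i p) =
  \sum_b jac i j (crd i p) a b * pd b f (crd j p).
Proof.
move=> oU ip jp Up sf.
have oI : open (dom j `&` U) by apply: openI => //; exact: dom_open.
rewrite (pd_chain a (region_reg i oI) (region_reg j oU) _ sf); last 2 first.
- by move=> y /reg_par[iy [jy Uy] <-]; rewrite trans_crd//; exact: reg_crd.
- exact: reg_crd.
- by rewrite trans_crd//; apply: eq_bigr => b _; rewrite mxE.
- by move=> b; apply: (smooth_on_sub _ (@smooth_trans i j b)); rewrite regI => y [].
Qed.

Lemma jac_cocycle i j k p : dom i p -> dom j p -> dom k p ->
  jac i k (crd i p) = jac i j (crd i p) *m jac j k (crd j p).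
Proof.
move=> ip jp kp; apply/matrixP => a b; rewrite mxE [RHS]mxE.
transitivity (pd a (fun z => trans j k (trans i j z) 0 b) (crd i p)); last first.
  rewrite (pd_trans_comp a (dom_open k) ip jp kp (@smooth_trans j k b)).
  by apply: eq_bigr => c _; congr (_ * _); rewrite mxE.
have oI : open (dom j `&` dom k) by apply: openI; exact: dom_open.
apply: (pd_ext _ (region_reg i oI)); first exact: reg_crd.
by move=> y /reg_par[iy [jy ky] <-]; rewrite !trans_crd.
Qed.

Lemma jac_id i p : dom i p -> jac i i (crd i p) = 1%:M.
Proof.
move=> ip; apply/matrixP => a b; rewrite !mxE -(pd_coord a b (crd i p)).
apply: (pd_ext _ (region_reg i (dom_open i))); first exact: reg_crd.
by move=> y /reg_par[iy _ <-]; rewrite trans_crd.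
Qed.

Lemma jac_inv i j p : dom i p -> dom j p ->
  jac i j (crd i p) *m jac j i (crd j p) = 1%:M.
Proof. by move=> ip jp; rewrite -jac_cocycle// jac_id. Qed.

Lemma jac_unit i j p : dom i p -> dom j p -> jac i j (crd i p) \in unitmx.
Proof. by move=> ip jp; case: (mulmx1_unit (jac_inv ip jp)). Qed.

Lemma jac_row_neq0 i j p a : dom i p -> dom j p ->
  exists b, jac i j (crd i p) a b != 0.
Proof.
move=> ip jp; apply/existsP; rewrite -[X in is_true X]negbK negb_exists.
apply/forallP => H; have /matrixP/(_ a a) := jac_inv ip jp.
rewrite !mxE eqxx big1 => [/esym/eqP|b _]; first by rewrite oner_eq0.
by have := H b; rewrite negbK => /eqP ->; rewrite mul0r.
Qed.

(** Invariance of the boundary. If [p] had coordinate 0 equal to zero in chart [j] but positive in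
    chart [i], then coordinate 0 of [trans i j], which is nonnegative, would have an interior
    minimum at [p]; a column of the Jacobian would vanish there, although the Jacobian is
    invertible. *)
Lemma boundaryE i p : dom i p -> boundary A p <-> crd i p 0 ord0 = 0.
Proof.
move=> ip; split=> [[j [jp j0]]|i0]; last by exists i.
apply/eqP; rewrite eq_le; apply/andP; split; last first.
  by apply: (@reg_halfspace setT i); exact: reg_crd.
rewrite leNgt; apply/negP => i0.
have Sx : reg (dom j) i (crd i p) by exact: reg_crd.
have rS := region_reg i (dom_open j).
have [W [F [Wx sF FE]]] := smooth_trans ord0 Sx.
have minF : \forall y \near crd i p, F (crd i p) <= F y.
  have H1 := rS.2 _ Sx; have H2 := near_open sF.1 Wx (fun y Wy => Wy).
  have H3 := near_coord_gt0 i0.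
  near=> y; have Sy : reg (dom j) i y.
    have y0 : halfspace n y by rewrite /halfspace /= ltW//; near: y.
    by move: y0; near: y.
  have Wy : W y by near: y.
  rewrite !FE// trans_crd// j0; have [iy jy <-] := reg_par Sy; rewrite trans_crd//.
  by apply: (@reg_halfspace setT j); exact: reg_crd.
have J0 a : jac i j (crd i p) a ord0 = 0.
  by rewrite mxE (pdE a rS Sx Wx sF FE); exact: dir_min sF Wx minF.
have /matrixP/(_ ord0 ord0) := jac_inv jp ip.
rewrite !mxE big1 => [/esym/eqP|b _]; first by rewrite oner_eq0.
by rewrite J0 mulr0.
Unshelve. all: by end_near. Qed.

Lemma interiorE i p : dom i p -> interior_part A p <-> 0 < crd i p 0 ord0.
Proof.
move=> ip; rewrite /interior_part /=; split=> [nb|p0 /(boundaryE ip) p0']; last first.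
  by rewrite p0' ltxx in p0.
rewrite lt_neqAle; apply/andP; split.
  by apply/eqP => e; apply: nb; apply/(boundaryE ip).
by apply: (@reg_halfspace setT i); exact: reg_crd.
Qed.

Lemma interior_open : open (interior_part A).
Proof.
rewrite openE => p pi; have [i ip] := covered p; have p0 := (interiorE ip).1 pi.
have H1 : \forall q \near p, dom i q by exact: (near_open (dom_open i) ip (fun y h => h)).
have H2 : \forall q \near p, 0 < crd i q 0 ord0.
  exact: (crd_continuous ip (near_coord_gt0 p0)).
by move: H1 H2; apply: filterS2 => q iq q0; apply/(interiorE iq).
Qed.

Lemma reg_interior U i x :
  reg (U `&` interior_part A) i x <-> reg U i x /\ 0 < x 0 ord0.
Proof.
split=> [[p [ip [Up pi]] <-]|[[p [ip Up] <-] x0]].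
  by split; [exact: reg_crd|exact/(interiorE ip)].
by apply: reg_crd => //; split => //; apply/(interiorE ip).
Qed.

(** Coordinate 0 of chart [j] vanishes along the whole boundary, and moving in a direction other
    than 0 stays in the boundary. *)
Lemma jac_boundary i j p a : dom i p -> dom j p -> boundary A p -> a != ord0 ->
  jac i j (crd i p) a ord0 = 0.
Proof.
move=> ip jp bp a0; rewrite mxE -[RHS](pd_cst 0 a (crd i p)).
apply: pd_eq; last by rewrite trans_crd//; exact/(boundaryE jp).
have rS := region_reg i (dom_open j).
have := region_shift a rS (reg_crd ip jp); apply: filterS => h Sh.
have [ih jh e] := reg_par Sh; rewrite /trans; apply/(boundaryE jh)/(boundaryE ih).
rewrite e !mxE eqxx /= eq_sym (negbTE a0) mulr0 addr0; exact/(boundaryE ip).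
Qed.

End Manifold.

(** * Projective changes of connections in a chart *)

Section Kronecker.
Context {R : comNzRingType} {d : nat}.
Implicit Types (F u T : 'I_d -> R) (g h : 'I_d -> 'I_d -> 'I_d -> R).

Lemma sum_deltar F b : \sum_c F c * (c == b)%:R = F b.
Proof.
rewrite (bigD1 b)//= eqxx mulr1 big1 ?addr0// => c cb.
by rewrite (negbTE cb) mulr0.
Qed.

Lemma sum_deltal F b : \sum_c F c * (b == c)%:R = F b.
Proof. by rewrite -[RHS]sum_deltar; apply: eq_bigr => c _; rewrite eq_sym. Qed.

Definition proj_pure g h u := forall c a b,
  h c a b = g c a b + u a * (c == b)%:R + u b * (c == a)%:R.

Lemma pure_contract g h u T a b : proj_pure g h u ->
  \sum_c T c * h c a b = \sum_c T c * g c a b + T b * u a + T a * u b.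
Proof.
move=> gh; rewrite -[T b * u a](sum_deltar (fun c => T c * u a)).
rewrite -[T a * u b](sum_deltar (fun c => T c * u b)) -!big_split /=.
by apply: eq_bigr => c _; rewrite gh !mulrDr !mulrA.
Qed.

(** The two Kronecker terms contribute [d * u a] and [u a]. Since [d + 1] is invertible over a field
    of characteristic 0, traces recover [u]. *)
Lemma pure_trace g h u a : proj_pure g h u ->
  \sum_c h c a c = \sum_c g c a c + d.+1%:R * u a.
Proof.
move=> gh; transitivity (\sum_c (g c a c + u a + u c * (c == a)%:R)).
  by apply: eq_bigr => c _; rewrite gh eqxx mulr1.
rewrite !big_split /= sum_deltar sumr_const card_ord -mulr_natl -addrA; congr (_ + _).
by rewrite -natr1; ring.
Qed.

Lemma pure_tracel g h u a : proj_pure g h u ->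
  \sum_c h c c a = \sum_c g c c a + d.+1%:R * u a.
Proof.
move=> gh; transitivity (\sum_c (g c c a + u a + u c * (c == a)%:R)).
  by apply: eq_bigr => c _; rewrite gh eqxx mulr1 addrAC.
rewrite !big_split /= sum_deltar sumr_const card_ord -mulr_natl -addrA; congr (_ + _).
by rewrite -natr1; ring.
Qed.

(** This and [pure_quadratic2] treat the two quadratic parts of [ricci]. In their difference the
    terms with traces of [g] cancel for symmetric [g]; the coefficient of [u a * u b] is
    [2 (d + 1) - (d + 3)] and that of the contraction of [u] with [g] is [(d + 1) - 2], both equal
    to [d - 1]. *)
Lemma pure_quadratic1 g h u a b : proj_pure g h u ->
  \sum_c \sum_e h c c e * h e a b =
  \sum_c \sum_e g c c e * g e a b + d.+1%:R * (\sum_e u e * g e a b) +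
  (\sum_c g c c b) * u a + (\sum_c g c c a) * u b + (d.+1%:R * u a * u b) *+ 2.
Proof.
move=> gh; rewrite exchange_big /=.
rewrite [X in _ = X + _ + _ + _ + _]exchange_big /=.
transitivity (\sum_e (\sum_c g c c e + d.+1%:R * u e) * h e a b).
  by apply: eq_bigr => e _; rewrite -mulr_suml (pure_tracel e gh).
rewrite (pure_contract (fun e => \sum_c g c c e + d.+1%:R * u e) _ _ gh).
have -> : \sum_c (\sum_e g e e c + d.+1%:R * u c) * g c a b =
   \sum_c \sum_e g e e c * g c a b + d.+1%:R * \sum_e u e * g e a b.
  rewrite mulr_sumr -big_split /=; apply: eq_bigr => e _.
  by rewrite mulrDl mulr_suml mulrA.
rewrite mulr2n; ring.
Qed.

Lemma pure_quadratic2 g h u a b : proj_pure g h u ->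
  \sum_c \sum_e h c a e * h e c b =
  \sum_c \sum_e g c a e * g e c b + (\sum_e u e * g e a b) *+ 2 +
  (\sum_c g c c b) * u a + (\sum_c g c a c) * u b + (d + 3)%:R * u a * u b.
Proof.
move=> gh.
transitivity (\sum_c (\sum_e h c a e * g e c b + h c a b * u c + h c a c * u b)).
  by apply: eq_bigr => c _; rewrite (pure_contract (fun e => h c a e) _ _ gh).
rewrite !big_split /= -mulr_suml (pure_trace a gh).
have -> : \sum_c h c a b * u c = \sum_c u c * g c a b + u b * u a + u a * u b.
  rewrite -(pure_contract u _ _ gh); apply: eq_bigr => c _; exact: mulrC.
have -> : \sum_c \sum_e h c a e * g e c b =
    \sum_c \sum_e g c a e * g e c b + u a * (\sum_c g c c b) + \sum_e u e * g e a b.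
  transitivity (\sum_c \sum_e (g c a e * g e c b + u a * g e c b * (c == e)%:R
      + (u e * g e c b) * (c == a)%:R)).
    by apply: eq_bigr => c _; apply: eq_bigr => e _; rewrite gh; ring.
  under eq_bigr do rewrite !big_split /=.
  rewrite !big_split /=; congr (_ + _ + _).
    by rewrite mulr_sumr; apply: eq_bigr => c _; rewrite (sum_deltal (fun e => u a * g e c b)).
  under eq_bigr do rewrite -mulr_suml.
  by rewrite (sum_deltar (fun c => \sum_e u e * g e c b)).
have -> : (d + 3)%:R = d.+1%:R + 2%:R :> R by rewrite -natrD addSnnS.
by rewrite mulr2n; ring.
Qed.

End Kronecker.

(** * Covariant derivatives, Ricci curvature and their projective change in one chart *)

Section Chart.
Context {R : realType} {n : nat}.
Local Notation V := 'rV[R]_n.+1.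
Context (S : set V) (rS : region S).
Implicit Types (G H : christoffel R n.+1) (s nu : V -> R) (u : V -> V) (x : V).

Definition smooth_sym G := (forall c a b, smooth_on S (fun x => G x c a b)) /\
  (forall x, S x -> forall c a b, G x c a b = G x c b a).

Lemma smooth_trace G a : smooth_sym G -> smooth_on S (fun x => \sum_c G x c a c).
Proof. by move=> [sG _]; apply: smooth_on_sum. Qed.

Definition smooth_row u := forall a, smooth_on S (fun x => u x 0 a).

Lemma smooth_nabla_density w G s a : smooth_sym G -> smooth_on S s ->
  smooth_on S (fun x => nabla_density w G s x 0 a).
Proof.
move=> sG ss.
apply: (smooth_on_ext (f := fun x => pd a s x + w / n.+2%:R * (\sum_c G x c a c) * s x)).
  by move=> x _; rewrite mxE.
apply: smooth_onD; first exact: smooth_on_pd.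
apply: smooth_onM => //; apply: smooth_onM; first exact: smooth_on_cst.
exact: smooth_trace.
Qed.

Lemma smooth_nabla_form w G u a b : smooth_sym G -> smooth_row u ->
  smooth_on S (fun x => nabla_form w G u x a b).
Proof.
move=> sG su.
apply: (smooth_on_ext (f := fun x => pd a (fun y => u y 0 b) x -
   \sum_c G x c a b * u x 0 c + w / n.+2%:R * (\sum_c G x c a c) * u x 0 b)).
  by move=> x _; rewrite mxE.
apply: smooth_onD; [apply: smooth_onB|].
- by apply: smooth_on_pd => //; exact: su.
- by apply: smooth_on_sum => c _; apply: smooth_onM; [exact: sG.1|exact: su].
- apply: smooth_onM => //; apply: smooth_onM; first exact: smooth_on_cst.
  exact: smooth_trace.
Qed.

Lemma smooth_ricci G a b : smooth_sym G -> smooth_on S (fun x => ricci G x a b).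
Proof.
move=> [sG _].
apply: (smooth_on_ext (f := fun x => \sum_c (pd c (fun y => G y c a b) x -
   pd a (fun y => G y c c b) x +
   \sum_e (G x c c e * G x e a b - G x c a e * G x e c b)))).
  by move=> x _; rewrite mxE.
apply: smooth_on_sum => c _; apply: smooth_onD; first by apply: smooth_onB; apply: smooth_on_pd.
by apply: smooth_on_sum => e _; apply: smooth_onB; apply: smooth_onM.
Qed.

Lemma ricciE G x a b : smooth_sym G -> S x ->
  ricci G x a b = \sum_c pd c (fun y => G y c a b) x - \sum_c pd a (fun y => G y c c b) x
  + (\sum_c \sum_e G x c c e * G x e a b - \sum_c \sum_e G x c a e * G x e c b).
Proof.
move=> [sG _] Sx; rewrite mxE big_split /= sumrB; congr (_ + _).
by rewrite -sumrB; apply: eq_bigr => c _; rewrite sumrB.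
Qed.

(** The derivative terms are the curl of [u] minus [n] times the derivative of [u] in direction [a].
    Division by [n] in [schouten] thus leaves the usual change of the Schouten tensor, plus the curl
    divided by [n]. *)
Lemma ricci_change G H u x a b : smooth_sym G -> smooth_row u ->
  (forall y, S y -> proj_pure (G y) (H y) (fun a => u y 0 a)) -> S x ->
  ricci H x a b = ricci G x a b + pd b (fun y => u y 0 a) x
    - n.+1%:R * pd a (fun y => u y 0 b) x
    + n%:R * (\sum_e u x 0 e * G x e a b + u x 0 a * u x 0 b).
Proof.
move=> sG su GH Sx.
have sH : forall c a b, smooth_on S (fun x => H x c a b).
  move=> c a' b'; apply: (smooth_on_ext (f := fun x => G x c a' b' +
    u x 0 a' * (c == b')%:R + u x 0 b' * (c == a')%:R)).
    by move=> y Sy; rewrite (GH y Sy).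
  apply: smooth_onD; first apply: smooth_onD; first exact: sG.1.
    by apply: smooth_onM => //; exact: smooth_on_cst.
  by apply: smooth_onM => //; exact: smooth_on_cst.
have pdH e c a' b' : pd e (fun y => H y c a' b') x = pd e (fun y => G y c a' b') x +
    pd e (fun y => u y 0 a') x * (c == b')%:R + pd e (fun y => u y 0 b') x * (c == a')%:R.
  have sk k (r : R) : smooth_on S (fun y => r * u y 0 k).
    by apply: smooth_onM => //; exact: smooth_on_cst.
  rewrite (pd_ext e rS Sx (g := fun y => (G y c a' b' + (c == b')%:R * u y 0 a') +
     (c == a')%:R * u y 0 b')); last first.
    by move=> y Sy; rewrite (GH y Sy) ![_%:R * _]mulrC.
  rewrite (pdD e rS _ _ Sx)//; last by apply: smooth_onD => //; exact: sG.1.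
  rewrite (pdD e rS _ _ Sx)//; last exact: sG.1.
  by rewrite !(pdZ _ _ rS _ Sx)// ![_%:R * _]mulrC.
have Hsym : smooth_sym H.
  split=> // y Sy c a' b'; rewrite !(GH y Sy) (sG.2 y Sy).
  by rewrite -!addrA; congr (_ + _); rewrite addrC.
rewrite (ricciE a b Hsym Sx) (ricciE a b sG Sx).
rewrite (pure_quadratic1 a b (GH x Sx)) (pure_quadratic2 a b (GH x Sx)).
have -> : \sum_c pd c (fun y => H y c a b) x = \sum_c pd c (fun y => G y c a b) x +
   pd b (fun y => u y 0 a) x + pd a (fun y => u y 0 b) x.
  under eq_bigr do rewrite pdH.
  rewrite !big_split /= (sum_deltar (fun c => pd c (fun y => u y 0 a) x)).
  by rewrite (sum_deltar (fun c => pd c (fun y => u y 0 b) x)).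
have -> : \sum_c pd a (fun y => H y c c b) x = \sum_c pd a (fun y => G y c c b) x +
   n.+2%:R * pd a (fun y => u y 0 b) x.
  under eq_bigr do rewrite pdH eqxx mulr1.
  rewrite !big_split /= (sum_deltar (fun c => pd a (fun y => u y 0 c) x)).
  rewrite sumr_const card_ord -mulr_natl -addrA; congr (_ + _).
  by rewrite -[n.+2]addn1 natrD; ring.
have -> : \sum_c G x c a c = \sum_c G x c c a.
  by apply: eq_bigr => c _; rewrite (sG.2 x Sx).
have -> : (n.+1 + 3)%:R = n%:R + 4%:R :> R by rewrite -natrD addSnnS.
have -> : n.+2%:R = n%:R + 2%:R :> R by rewrite -natrD addn2.
have -> : n.+1%:R = n%:R + 1 :> R by rewrite natr1.
rewrite !mulr2n; ring.
Qed.

(** The divergence term and both quadratic terms of [ricci] are symmetric for a torsion-free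
    connection; what remains is the derivative of the trace. *)
Lemma ricci_antisym G x a b : smooth_sym G -> S x ->
  ricci G x a b - ricci G x b a =
  pd b (fun y => \sum_c G y c a c) x - pd a (fun y => \sum_c G y c b c) x.
Proof.
move=> sG Sx; rewrite !ricciE//.
have E1 e k : \sum_c pd e (fun y => G y c c k) x = pd e (fun y => \sum_c G y c k c) x.
  rewrite -(pd_sum _ _ rS _ Sx); last by move=> c _; exact: sG.1.
  by apply: (pd_ext e rS Sx) => y Sy; apply: eq_bigr => c _; rewrite (sG.2 y Sy).
rewrite (E1 a b) (E1 b a).
have -> : \sum_c pd c (fun y => G y c b a) x = \sum_c pd c (fun y => G y c a b) x.
  by apply: eq_bigr => c _; apply: (pd_ext c rS Sx) => y Sy; rewrite (sG.2 y Sy).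
have -> : \sum_c \sum_e G x c c e * G x e b a = \sum_c \sum_e G x c c e * G x e a b.
  by apply: eq_bigr => c _; apply: eq_bigr => e _; rewrite [G x e b a](sG.2 x Sx).
have -> : \sum_c \sum_e G x c b e * G x e c a = \sum_c \sum_e G x c a e * G x e c b.
  rewrite exchange_big /=; apply: eq_bigr => c _; apply: eq_bigr => e _.
  by rewrite mulrC (sG.2 x Sx c) (sG.2 x Sx e).
ring.
Qed.

(** That [nu] is parallel says that the trace of the Christoffel symbols is the logarithmic
    derivative of [nu]. Its curl vanishes by the symmetry of second derivatives. *)
Lemma special_ricci_sym G nu x a b : smooth_sym G -> smooth_on S nu ->
  (forall y, S y -> nu y != 0) ->
  (forall y, S y -> nabla_density (- n.+2%:R) G nu y = 0) -> S x ->
  ricci G x a b = ricci G x b a.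
Proof.
move=> sG snu nu0 nabla0 Sx; apply/eqP; rewrite -subr_eq0 ricci_antisym//.
have E c y : S y -> pd c nu y = (\sum_e G y e c e) * nu y.
  move=> /nabla0/rowP/(_ c); rewrite !mxE mulNr divff ?pnatr_eq0// mulN1r => /eqP.
  by rewrite mulNr subr_eq0 => /eqP.
have Schwarz := pd_pd a b rS snu Sx.
rewrite (pd_ext a rS Sx (E b)) (pd_ext b rS Sx (E a)) in Schwarz.
rewrite !(pdM _ rS (smooth_trace _ sG) snu Sx) !E// in Schwarz.
apply/eqP/(mulfI (nu0 _ Sx)); rewrite mulr0 mulrBr.
move: Schwarz; set p := \sum_e _; set q := \sum_e _ => Sw.
by apply/eqP; rewrite subr_eq0; apply/eqP; move: Sw; lra.
Qed.

(* The Hessian of [s] vanishes for [G], so the left hand side is projectively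
   invariant up to the curl of [u]. *)
Lemma hessian_schouten_change G H u s x a b : (0 < n)%N ->
  smooth_sym G -> smooth_row u -> smooth_on S s ->
  (forall y, S y -> proj_pure (G y) (H y) (fun a => u y 0 a)) ->
  (forall y, S y -> nabla_density 1 G s y = 0) -> S x ->
  nabla_form 1 H (nabla_density 1 H s) x a b + s x * schouten H x a b =
  s x * (schouten G x a b +
    n%:R^-1 * (pd b (fun y => u y 0 a) x - pd a (fun y => u y 0 b) x)).
Proof.
move=> n0 sG su ss GH nabla0 Sx.
have N0 : n%:R != 0 :> R by rewrite pnatr_eq0 -lt0n.
have N2 : n.+2%:R != 0 :> R by rewrite pnatr_eq0.
have Ds c y : S y -> pd c s y = - (n.+2%:R^-1 * (\sum_e G y e c e) * s y).
  by move=> /nabla0/rowP/(_ c); rewrite !mxE mul1r => /eqP; rewrite addr_eq0 => /eqP.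
have mu c y : S y -> nabla_density 1 H s y 0 c = u y 0 c * s y.
  move=> Sy; rewrite mxE Ds// (pure_trace c (GH y Sy)) mul1r.
  by field.
have -> : nabla_form 1 H (nabla_density 1 H s) x a b =
    s x * (pd a (fun y => u y 0 b) x - \sum_e u x 0 e * G x e a b - u x 0 a * u x 0 b).
  rewrite mxE (pd_ext a rS Sx (mu b)) (pdM _ rS (su b) ss Sx) Ds// mu// mul1r.
  have -> : \sum_c H x c a b * nabla_density 1 H s x 0 c =
      (\sum_c u x 0 c * G x c a b + u x 0 b * u x 0 a + u x 0 a * u x 0 b) * s x.
    rewrite -(pure_contract (fun c => u x 0 c) a b (GH x Sx)) mulr_suml.
    by apply: eq_bigr => c _; rewrite mu// mulrCA mulrA.
  by rewrite (pure_trace a (GH x Sx)); field.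
have N1 : n.+1%:R - 1 = n%:R :> R by rewrite -natr1 addrK.
have sE K : schouten K x a b = n%:R^-1 * ricci K x a b by rewrite mxE N1.
rewrite !sE (ricci_change a b sG su GH Sx) -[n.+1%:R]natr1.
by field.
Qed.

End Chart.

(** * The BGG equation and Ricci flatness *)

Section PureRelation.
Context {R : realType} {d : nat}.
Implicit Types (g h k : 'I_d -> 'I_d -> 'I_d -> R).

Definition trace_diff g h (a : 'I_d) : R :=
  d.+1%:R^-1 * (\sum_c h c a c - \sum_c g c a c).

(** The only candidate for the change is the normalized trace of the difference, so projective
    equivalence at a point becomes an equation in the Christoffel symbols, without an existential;
    as such it passes to limits. *)
Definition proj_rel g h := proj_pure g h (trace_diff g h).

Lemma proj_relI g h u : proj_pure g h u -> proj_rel g h.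
Proof.
move=> gh c a b; have E e : trace_diff g h e = u e.
  by rewrite /trace_diff (pure_trace e gh) addrC addKr mulKf ?pnatr_eq0.
by rewrite !E gh.
Qed.

Lemma proj_rel_refl g : proj_rel g g.
Proof. by apply: (@proj_relI _ _ (fun=> 0)) => c a b; rewrite !mul0r !addr0. Qed.

Lemma proj_rel_sym g h : proj_rel g h -> proj_rel h g.
Proof.
move=> gh; apply: (@proj_relI _ _ (fun a => - trace_diff g h a)) => c a b.
by rewrite gh; ring.
Qed.

Lemma proj_rel_trans g h k : proj_rel g h -> proj_rel h k -> proj_rel g k.
Proof.
move=> gh hk; apply: (@proj_relI _ _ (fun a => trace_diff g h a + trace_diff h k a)).
by move=> c a b; rewrite hk gh; ring.
Qed.

End PureRelation.

Section ProjEquiv.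
Context {R : realType} {X : topologicalType} {d : nat} (A : atlas R X d).
Implicit Types (U : set X) (Gam : ix A -> christoffel R d).

Lemma proj_equiv_rel U Gam Gam' : proj_equiv U Gam Gam' ->
  forall i x, reg U i x -> proj_rel (Gam i x) (Gam' i x).
Proof.
move=> [ups [_ H]] i x Ux.
by apply: (@proj_relI _ _ _ _ (fun a => ups i x 0 a)) => c a b; exact: H.
Qed.

(* The trace of the difference tensor is automatically a one-form. *)
Lemma proj_rel_equiv U Gam Gam' :
  (forall (i j : ix A) p a, dom i p -> dom j p -> U p -> exists b, jac i j (crd i p) a b != 0) ->
  connection U Gam -> connection U Gam' ->
  (forall i x, reg U i x -> proj_rel (Gam i x) (Gam' i x)) -> proj_equiv U Gam Gam'.
Proof.
move=> J0 [sG _ lG] [sG' _ lG'] H.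
exists (fun i x => \row_a trace_diff (Gam i x) (Gam' i x) a); split; last first.
  by move=> i x Ux c a b; rewrite !mxE; exact: H.
split.
  move=> i a; apply: (smooth_on_ext (f := fun x => d.+1%:R^-1 *
    (\sum_c Gam' i x c a c - \sum_c Gam i x c a c))).
    by move=> x _; rewrite mxE.
  apply: smooth_onM; first exact: smooth_on_cst.
  by apply: smooth_onB; apply: smooth_on_sum.
move=> i j p ip jp Up a; set J := jac i j _.
pose u e := trace_diff (Gam i (crd i p)) (Gam' i (crd i p)) e.
pose v e := trace_diff (Gam j (crd j p)) (Gam' j (crd j p)) e.
have Hi : proj_rel (Gam i (crd i p)) (Gam' i (crd i p)) by apply: H; exists p.
have Hj : proj_rel (Gam j (crd j p)) (Gam' j (crd j p)) by apply: H; exists p.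
(* Subtracting the two transformation laws, with equal lower indices, leaves on each side twice a
   multiple of [J a f]. A nonzero entry in row [a] of the Jacobian can then be cancelled. *)
have key f : u a * J a f + u a * J a f =
    (\sum_k J a k * v k) * J a f + (\sum_k J a k * v k) * J a f.
  have := lG' i j p ip jp Up f a a; have := lG i j p ip jp Up f a a; rewrite -/J.
  have -> : \sum_c Gam' i (crd i p) c a a * J c f =
      \sum_c Gam i (crd i p) c a a * J c f + u a * J a f + u a * J a f.
    under eq_bigr do rewrite mulrC; under [in RHS]eq_bigr do rewrite mulrC.
    rewrite (pure_contract (fun c => J c f) a a Hi) -/(u a); ring.
  have -> : \sum_k \sum_l J a k * J a l * Gam' j (crd j p) f k l =
      \sum_k \sum_l J a k * J a l * Gam j (crd j p) f k l +
      (\sum_k J a k * v k) * J a f + (\sum_k J a k * v k) * J a f.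
    transitivity (\sum_k (\sum_l J a k * J a l * Gam j (crd j p) f k l +
       (J a k * v k) * J a f + (J a k * (\sum_l J a l * v l)) * (f == k)%:R)).
      apply: eq_bigr => k _.
      transitivity (\sum_l (J a k * J a l * Gam j (crd j p) f k l +
         (J a k * v k * J a l) * (f == l)%:R + J a k * (J a l * v l) * (f == k)%:R)).
        by apply: eq_bigr => l _; rewrite Hj -/(v k) -/(v l); ring.
      rewrite !big_split /= (sum_deltal (fun l => J a k * v k * J a l)).
      by congr (_ + _ + _); rewrite -mulr_suml -mulr_sumr.
    rewrite !big_split /= -[in X in _ + X + _]mulr_suml.
    rewrite (sum_deltal (fun k => J a k * (\sum_l J a l * v l))).
    by congr (_ + _ + _); rewrite mulrC.
  by move=> ->; rewrite -!addrA => /addrI/addrI.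
rewrite mxE -/(u a); under eq_bigr do rewrite mxE -/(v _).
have [f Jf] := J0 i j p a ip jp Up; apply: (mulIf Jf).
by have := key f; rewrite -!mulr2n => /eqP; rewrite eqr_pMn2r// => /eqP.
Qed.

Lemma connection_sub U U' Gam : U' `<=` U -> connection U Gam -> connection U' Gam.
Proof.
have regS (i : ix A) : U' `<=` U -> reg U' i `<=` reg U i.
  by move=> UU x [p [ip /UU Up] <-]; exists p.
move=> UU [sG symG lG]; split.
- by move=> i c a b; apply: (smooth_on_sub (regS i UU) (sG i c a b)).
- by move=> i x /(regS i UU); exact: symG.
- by move=> i j p ip jp /UU; exact: lG.
Qed.

End ProjEquiv.

(** * The extended projective class and the Hessian of the defining density *)

Section Extended.
Context {R : realType} {X : topologicalType} {n : nat} {A : atlas R X n.+1}.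
Context (HM : manifold_with_boundary A).
Context (Gam : ix A -> christoffel R n.+1).
Context (cGam : connection (interior_part A) Gam).
Implicit Types (i j : ix A) (U : set X) (tGam : ix A -> christoffel R n.+1).
Local Notation V := 'rV[R]_n.+1.

Lemma connection_smooth_sym U tGam i : connection U tGam -> smooth_sym (reg U i) (tGam i).
Proof. by move=> [sG symG _]; split; [exact: sG|exact: symG]. Qed.

Lemma proj_equivI U tGam tGam' : connection U tGam -> connection U tGam' ->
  (forall i x, reg U i x -> proj_rel (tGam i x) (tGam' i x)) -> proj_equiv U tGam tGam'.
Proof.
move=> c1 c2; apply: proj_rel_equiv => // i j p a ip jp _.
exact: (jac_row_neq0 HM).
Qed.

Lemma smooth_trace_diff (S : set V) G H a : smooth_sym S G -> smooth_sym S H ->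
  smooth_on S (fun x => trace_diff (G x) (H x) a).
Proof.
move=> sG sH; apply: smooth_onM; first exact: smooth_on_cst.
by apply: smooth_onB; exact: smooth_trace.
Qed.

(** [proj_rel] equates functions that are smooth up to the boundary. *)
Lemma proj_rel_closure (S : set V) (G H : christoffel R n.+1) : region S ->
  smooth_sym S G -> smooth_sym S H ->
  (forall x, S x -> 0 < x 0 ord0 -> proj_rel (G x) (H x)) ->
  forall x, S x -> proj_rel (G x) (H x).
Proof.
move=> rS sG sH GH x Sx c a b.
apply: (smooth_on_closure rS (f := fun x => H x c a b) (g := fun x => G x c a b +
   trace_diff (G x) (H x) a * (c == b)%:R + trace_diff (G x) (H x) b * (c == a)%:R)) => //.
- exact: sH.1.
- have sk e (r : R) : smooth_on S (fun y => trace_diff (G y) (H y) e * r).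
    by apply: smooth_onM; [exact: smooth_trace_diff|exact: smooth_on_cst].
  by apply: smooth_onD => //; apply: smooth_onD => //; exact: sG.1.
- by move=> y Sy y0; exact: GH.
Qed.

Lemma extended_rel U tGam i x : extended_class Gam U tGam ->
  reg (U `&` interior_part A) i x -> proj_rel (Gam i x) (tGam i x).
Proof. by move=> [_ _ /proj_equiv_rel]; exact. Qed.

(** The extension of the projective class is unique: on the interior the two connections are
    compared through [Gam], at the boundary by closure. *)
Lemma extended_rel2 U U' tGam tGam' i x :
  extended_class Gam U tGam -> extended_class Gam U' tGam' ->
  reg (U `&` U') i x -> proj_rel (tGam i x) (tGam' i x).
Proof.
move=> e1 e2; have [oU c1 _] := e1; have [oU' c2 _] := e2.
have rS : region (reg (U `&` U') i) by apply: (region_reg HM); exact: openI.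
have sub1 : U `&` U' `<=` U by move=> y [].
have sub2 : U `&` U' `<=` U' by move=> y [].
apply: (proj_rel_closure rS).
- exact: connection_smooth_sym (connection_sub sub1 c1).
- exact: connection_smooth_sym (connection_sub sub2 c2).
move=> y Sy y0.
have [p [ip [[Up U'p] pi] <-]] := (reg_interior HM _ _ _).2 (conj Sy y0).
apply: (@proj_rel_trans _ _ _ (Gam i (crd i p))).
  by apply/proj_rel_sym/(extended_rel e1); exists p.
by apply: (extended_rel e2); exists p.
Qed.

Lemma extended_interior : extended_class Gam (interior_part A) Gam.
Proof.
split; [exact: (interior_open HM)|exact: cGam|].
apply: proj_equivI; rewrite ?setIid// => i x _; exact: proj_rel_refl.
Qed.

Context (sigma : ix A -> V -> R) (Hs : canonical_defining_density 1 Gam sigma).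
Context (n_gt0 : (0 < n)%N).

Lemma sigma_smooth i : smooth_on (reg setT i) (sigma i).
Proof. by case: Hs => [[[]]]. Qed.

Lemma sigma_smooth_reg U i : smooth_on (reg U i) (sigma i).
Proof. by apply: (smooth_on_sub _ (@sigma_smooth i)) => x [p [ip _] <-]; exists p. Qed.

Lemma sigma_zero i p : dom i p -> sigma i (crd i p) = 0 <-> boundary A p.
Proof. by case: Hs => [[_ + _] _]; apply. Qed.

Lemma sigma_boundary i x : reg setT i x -> x 0 ord0 = 0 -> sigma i x = 0.
Proof. by move=> [p [ip _] <-] x0; apply/(sigma_zero ip)/(boundaryE HM ip). Qed.

Lemma pd_sigma_tangent i x a : reg setT i x -> x 0 ord0 = 0 -> a != ord0 ->
  pd a (sigma i) x = 0.
Proof.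
move=> Sx x0 a0; have rS := region_reg HM i openT.
rewrite -[RHS](pd_cst 0 a x); apply: pd_eq; last exact: sigma_boundary.
apply: filterS (region_shift a rS Sx) => h Sh; apply: sigma_boundary => //.
by rewrite !mxE eqxx /= eq_sym (negbTE a0) mulr0 addr0.
Qed.

(** A defining density has some nonzero partial derivative at a boundary point, and the tangential
    ones vanish. *)
Lemma pd_sigma_normal i p : dom i p -> boundary A p ->
  pd ord0 (sigma i) (crd i p) != 0.
Proof.
move=> ip bp; have [U [e [Up Ui _ df]]] : exists U e, [/\ U p, U `<=` dom i, e = 1 \/ e = -1 &
          defining_function A U (fun q => e * sigma i (crd i q))].
  by case: Hs => [[_ _ +] _]; apply.
have [oU _ _ _ /(_ i p ip Up bp)[a]] := df.
have Sp : reg U i (crd i p) by exact: reg_crd.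
have rS := region_reg HM i oU.
rewrite (pd_ext (g := fun x => e * sigma i x) a rS Sp); last first.
  by move=> y /(reg_par HM)[_ _ ->].
rewrite (pdZ _ _ rS (@sigma_smooth_reg U i) Sp) mulf_eq0 negb_or => /andP[_].
have [-> //|a0] := eqVneq a ord0; rewrite pd_sigma_tangent ?eqxx//; first exact: reg_crd.
by apply/(boundaryE HM ip).
Qed.

Lemma sigma_parallel i x : reg (interior_part A) i x ->
  nabla_density 1 (Gam i) (sigma i) x = 0.
Proof. by case: Hs => _; exact. Qed.

(** The lower slot of the tractor derivative of [L(sigma)]; [bgg] is its symmetric part. *)
Definition hessian_schouten (G : christoffel R n.+1) i x : 'M[R]_n.+1 :=
  nabla_form 1 G (nabla_density 1 G (sigma i)) x + sigma i x *: schouten G x.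

Lemma bggE G i x a b : bgg G (sigma i) x a b =
  2^-1 * (hessian_schouten G i x a b + hessian_schouten G i x b a).
Proof. by rewrite /bgg /hessian_schouten; rewrite !mxE; ring. Qed.

Lemma smooth_hessian_schouten U tGam i a b : open U -> connection U tGam ->
  smooth_on (reg U i) (fun x => hessian_schouten (tGam i) i x a b).
Proof.
move=> oU ct; have rS := region_reg HM i oU; have sG := connection_smooth_sym i ct.
apply: (smooth_on_ext (f := fun x => nabla_form 1 (tGam i) (nabla_density 1 (tGam i) (sigma i)) x a b
  + sigma i x * ((n.+1%:R - 1)^-1 * ricci (tGam i) x a b))).
  by move=> x _; rewrite !mxE.
apply: smooth_onD.
  apply: smooth_nabla_form => // c; apply: smooth_nabla_density => //.
  exact: sigma_smooth_reg.
apply: smooth_onM; first exact: sigma_smooth_reg.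
by apply: smooth_onM; [exact: smooth_on_cst|exact: smooth_ricci].
Qed.

Section InteriorFormula.
Context (U : set X) (tGam : ix A -> christoffel R n.+1).
Context (eU : extended_class Gam U tGam).
Let u i (x : V) : V := \row_a trace_diff (Gam i x) (tGam i x) a.
Let S i := reg (U `&` interior_part A) i.

Let rS i : region (S i).
Proof. by case: eU => oU _ _; apply: (region_reg HM); apply: openI => //; exact: interior_open. Qed.

Let sGam i : smooth_sym (S i) (Gam i).
Proof. by apply: connection_smooth_sym (connection_sub _ cGam) => y []. Qed.

Let stGam i : smooth_sym (S i) (tGam i).
Proof. by case: eU => _ ct _; apply: connection_smooth_sym (connection_sub _ ct) => y []. Qed.

Let su i : smooth_row (S i) (u i).
Proof.
move=> a; apply: (smooth_on_ext (f := fun x => trace_diff (Gam i x) (tGam i x) a)).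
  by move=> x _; rewrite mxE.
exact: smooth_trace_diff.
Qed.

Lemma hessian_schouten_interior i x a b : S i x ->
  hessian_schouten (tGam i) i x a b = sigma i x * (schouten (Gam i) x a b +
    n%:R^-1 * (pd b (fun y => u i y 0 a) x - pd a (fun y => u i y 0 b) x)).
Proof.
move=> Sx; rewrite -(hessian_schouten_change (rS i) a b n_gt0 (sGam i) (@su i)
  (@sigma_smooth_reg _ _) _ _ Sx (H := tGam i)); first by rewrite !mxE.
- move=> y Sy c e f; rewrite !mxE; exact: (extended_rel eU Sy).
- by move=> y [p [ip [_ pi]] <-]; apply: sigma_parallel; exists p.
Qed.

(** Both Ricci tensors are symmetric, so by [ricci_antisym] both traces are curl free, and [u] is a
    multiple of their difference. *)
Lemma special_curl_free i x a b : special (interior_part A) Gam -> special U tGam ->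
  S i x -> pd b (fun y => u i y 0 a) x = pd a (fun y => u i y 0 b) x.
Proof.
move=> [nu [[snu _] nu0 nnu]] [nu' [[snu' _] nu'0 nnu']] Sx.
have S1 : S i `<=` reg (interior_part A) i by move=> y [p [ip []]]; exists p.
have S2 : S i `<=` reg U i by move=> y [p [ip []]]; exists p.
have E1 : ricci (Gam i) x a b = ricci (Gam i) x b a.
  apply: (special_ricci_sym (rS i) a b (sGam i) (smooth_on_sub S1 (snu i))) => //.
    by move=> y /S1; exact: nu0.
  by move=> y /S1; exact: nnu.
have E2 : ricci (tGam i) x a b = ricci (tGam i) x b a.
  apply: (special_ricci_sym (rS i) a b (stGam i) (smooth_on_sub S2 (snu' i))) => //.
    by move=> y /S2; exact: nu'0.
  by move=> y /S2; exact: nnu'.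
have A1 := ricci_antisym (rS i) a b (sGam i) Sx.
have A2 := ricci_antisym (rS i) a b (stGam i) Sx.
rewrite E1 subrr in A1; rewrite E2 subrr in A2.
have P e c : pd e (fun y => u i y 0 c) x = n.+2%:R^-1 *
   (pd e (fun y => \sum_k tGam i y k c k) x - pd e (fun y => \sum_k Gam i y k c k) x).
  rewrite -(pdB e (rS i) _ _ Sx); [|exact: smooth_trace..].
  rewrite -(pdZ _ _ (rS i) _ Sx); last by apply: smooth_onB; exact: smooth_trace.
  by apply: (pd_ext e (rS i) Sx) => y _; rewrite mxE.
by rewrite !P; congr (_ * _); move: A1 A2; lra.
Qed.

End InteriorFormula.
Context (flat : ricci_flat (interior_part A) Gam).

Lemma flat_schouten U i x : reg (U `&` interior_part A) i x -> schouten (Gam i) x = 0.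
Proof.
move=> [p [ip [_ pi]] <-]; rewrite /schouten flat ?scaler0//; by exists p.
Qed.

(** The curl is skew, so this covers connections of the class that are not special; the second
    fundamental form, being symmetric, sees no more than this part. *)
Lemma hessian_schouten_antisym U tGam i x a b : extended_class Gam U tGam ->
  reg U i x -> hessian_schouten (tGam i) i x a b + hessian_schouten (tGam i) i x b a = 0.
Proof.
move=> eU; have [oU ct _] := eU.
apply: (smooth_on_closure (region_reg HM i oU) (g := fun=> 0)
  (f := fun x => hessian_schouten (tGam i) i x a b + hessian_schouten (tGam i) i x b a)).
- by apply: smooth_onD; exact: smooth_hessian_schouten.
- exact: smooth_on_cst.
move=> y Sy y0; have Sy' := (reg_interior HM _ _ _).2 (conj Sy y0).
rewrite !(hessian_schouten_interior eU _ _ Sy') (flat_schouten Sy') !mxE; ring.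
Qed.

(** With both connections special the curl is gone too, and the whole tensor vanishes on the
    interior, hence up to the boundary. *)
Lemma hessian_schouten_special U tGam i x : special (interior_part A) Gam ->
  special_in_class Gam U tGam -> reg U i x -> hessian_schouten (tGam i) i x = 0.
Proof.
move=> spG [eU sp] Ux; have [oU ct _] := eU; apply/matrixP => a b; rewrite [RHS]mxE.
move: x Ux; apply: (smooth_on_closure (region_reg HM i oU) (g := fun=> 0)
  (f := fun x => hessian_schouten (tGam i) i x a b)).
- exact: smooth_hessian_schouten.
- exact: smooth_on_cst.
move=> y Sy y0; have Sy' := (reg_interior HM _ _ _).2 (conj Sy y0).
rewrite (hessian_schouten_interior eU _ _ Sy') (flat_schouten Sy').
by rewrite (special_curl_free eU a b spG sp Sy') subrr mulr0 mxE addr0 mulr0.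
Qed.

Lemma flat_bgg_solution : special (interior_part A) Gam -> bgg_solution Gam sigma.
Proof.
move=> spG U tGam sp i x Ux; apply/matrixP => a b.
by rewrite bggE (hessian_schouten_special spG sp Ux) !mxE addr0 mulr0.
Qed.

(* At the boundary the Hessian of [sigma] in directions [a], [b] tangent to it
   reduces to [- Gamma^0_ab d_0 sigma]. *)
Lemma normal_christoffel U tGam i p a b : extended_class Gam U tGam ->
  dom i p -> U p -> boundary A p -> a != ord0 -> b != ord0 ->
  tGam i (crd i p) ord0 a b = 0.
Proof.
move=> eU ip Up bp a0 b0; have [oU ct _] := eU.
have Sx : reg U i (crd i p) by exact: reg_crd.
have rS := region_reg HM i oU; have x0 := (boundaryE HM ip).1 bp.
have sub y : reg U i y -> reg setT i y by move=> [q [iq _] <-]; exists q.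
have mu0 c y : c != ord0 -> reg U i y -> y 0 ord0 = 0 ->
    nabla_density 1 (tGam i) (sigma i) y 0 c = 0.
  move=> c0 /sub Sy y0; rewrite mxE pd_sigma_tangent//.
  by rewrite sigma_boundary// mulr0 addr0.
have pdmu c e : c != ord0 -> e != ord0 ->
    pd e (fun y => nabla_density 1 (tGam i) (sigma i) y 0 c) (crd i p) = 0.
  move=> c0 e0; rewrite -[RHS](pd_cst 0 e (crd i p)); apply: pd_eq; last exact: mu0.
  apply: filterS (region_shift e rS Sx) => h Sh; apply: mu0 => //.
  by rewrite !mxE eqxx /= eq_sym (negbTE e0) mulr0 addr0.
have E c e : c != ord0 -> e != ord0 -> hessian_schouten (tGam i) i (crd i p) c e =
    - (tGam i (crd i p) ord0 c e * pd ord0 (sigma i) (crd i p)).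
  move=> c0 e0; rewrite /hessian_schouten sigma_boundary//; last exact: sub.
  rewrite scale0r addr0 mxE pdmu// mu0// mulr0 addr0 sub0r; congr (- _).
  rewrite (bigD1 ord0)//= big1 ?addr0; last first.
    by move=> k k0; rewrite mu0// mulr0.
  rewrite [in LHS]mxE sigma_boundary; [|exact: sub|exact: x0].
  by rewrite mulr0 addr0.
have := hessian_schouten_antisym a b eU Sx; rewrite !E//.
have [_ symt _] := ct; rewrite [tGam i _ ord0 b a]symt// => /eqP.
rewrite -mulr2n mulrn_eq0 /= oppr_eq0 mulf_eq0 (negbTE (pd_sigma_normal ip bp)).
by rewrite orbF => /eqP.
Qed.

Lemma flat_totally_geodesic : totally_geodesic_boundary Gam.
Proof.
move=> U tGam eU xi eta [sxi _] [seta _] txi teta i p ip Up bp.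
have [oU ct _] := eU.
have Sx : reg U i (crd i p) by exact: reg_crd.
have rS := region_reg HM i oU; have x0 := (boundaryE HM ip).1 bp.
rewrite mxE big1// => a _; have [->|a0] := eqVneq a ord0; first by rewrite txi// mul0r.
(* The normal component of [eta] vanishes along the boundary, hence so do its tangential
   derivatives; the Christoffel term is left. *)
rewrite (_ : pd a _ _ = 0) ?add0r; last first.
  rewrite -[RHS](pd_cst 0 a (crd i p)); apply: pd_eq; last exact: teta.
  apply: filterS (region_shift a rS Sx) => h /(reg_par HM)[ih Uh e].
  rewrite -e; apply: teta => //; apply/(boundaryE HM ih); rewrite e.
  by rewrite !mxE eqxx /= eq_sym (negbTE a0) mulr0 addr0.
rewrite big1 ?mulr0// => b _; have [->|b0] := eqVneq b ord0.
  by rewrite teta// mulr0.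
by rewrite (normal_christoffel eU)// mul0r.
Qed.

End Extended.

(** * The parallel cotractor *)

Section RightDerivative.
Context {R : realType} {n : nat}.
Local Notation V := 'rV[R]_n.+1.
Implicit Types (f g : V -> R) (x : V) (a : 'I_n.+1) (l m : R).

(** Quotients are handled directly because [density_factor] is a real power of a smooth function: it
    is differentiated once, without passing through [smooth_on]. *)
Definition rquot f a x (h : R) := h^-1 * (f (x + h *: delta_mx 0 a) - f x).

Lemma rquot_cvg0 f a x l : rquot f a x @ 0^'+ --> l ->
  (fun h : R => f (x + h *: delta_mx 0 a)) @ 0^'+ --> f x.
Proof.
move=> L; have L2 : (fun h : R => f x + h * rquot f a x h) @ 0^'+ --> f x + 0 * l.
  apply: cvgD; first exact: cvg_cst.
  by apply: cvgM => //; exact: cvg_within.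
rewrite mul0r addr0 in L2; apply: cvg_trans L2; apply: near_eq_cvg.
apply: filterS (nbhs_right_gt (0 : R)) => h h0.
by rewrite /rquot mulrA divff ?gt_eqF// mul1r addrC subrK.
Qed.

Lemma rquotM f g a x l m : rquot f a x @ 0^'+ --> l -> rquot g a x @ 0^'+ --> m ->
  rquot (fun y => f y * g y) a x @ 0^'+ --> l * g x + f x * m.
Proof.
move=> Lf Lg; have Lg0 := rquot_cvg0 Lg.
have -> : rquot (fun y => f y * g y) a x =
   fun h => rquot f a x h * g (x + h *: delta_mx 0 a) + f x * rquot g a x h.
  by apply/funext => h; rewrite /rquot; ring.
by apply: cvgD; [exact: cvgM|apply: cvgM => //; exact: cvg_cst].
Qed.

Lemma rquot_comp (phi : R -> R) f a x l m : is_derive (f x) (1 : R) phi m ->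
  rquot f a x @ 0^'+ --> l -> rquot (phi \o f) a x @ 0^'+ --> m * l.
Proof.
(* In the form of Caratheodory the increment of [phi] is [g] times the increment of [f], so that
   nothing is divided by an increment of [f], which may be zero. *)
move=> /is_derive1_caratheodory[g [gE gc <-]] Lf; have Lf0 := rquot_cvg0 Lf.
have -> : rquot (phi \o f) a x = fun h => g (f (x + h *: delta_mx 0 a)) * rquot f a x h.
  by apply/funext => h; rewrite /rquot /= gE; ring.
apply: cvgM => //; exact: (cvg_comp _ _ Lf0 gc).
Qed.

End RightDerivative.

Section Cotractor.
Context {R : realType} {X : topologicalType} {n : nat} {A : atlas R X n.+1}.
Context (HM : manifold_with_boundary A).
Implicit Types (i j : ix A) (U : set X).

Lemma smooth_det i j : smooth_on (reg (dom j) i) (fun x => \det (jac i j x)).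
Proof.
apply: smooth_on_sum => s _; apply: smooth_onM; first exact: smooth_on_cst.
by apply: smooth_on_prod => a _; exact: (smooth_jac HM).
Qed.

Lemma det_jac_neq0 i j x : reg (dom j) i x -> \det (jac i j x) != 0.
Proof. by move=> [p [ip jp] <-]; rewrite -unitfE -unitmxE (jac_unit HM). Qed.

Lemma rquot_density_factor w i j x a : reg (dom j) i x ->
  rquot (density_factor w i j) a x @ 0^'+ --> pd a (density_factor w i j) x.
Proof.
move=> Sx; have rS := region_reg HM i (dom_open HM j).
have sn := smooth_on_norm (@smooth_det i j) (@det_jac_neq0 i j).
have n0 : 0 < `|\det (jac i j x)| by rewrite normr_gt0 det_jac_neq0.
have L := rquot_comp (is_derive1_powR (- w / n.+2%:R) n0) (pd_cvg (a := a) rS sn Sx).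
have e : pd a (density_factor w i j) x = _ := cvg_lim (@Rhausdorff R) L.
rewrite e; exact: L.
Qed.

(** Near [p] the density in chart [i] is [density_factor] times the pullback of the density in chart
    [j]; its product rule is the second clause of [jet_change]. *)
Lemma density_splitting_jet (s : ix A -> 'rV[R]_n.+1 -> R) i j p :
  density 1 setT s -> dom i p -> dom j p ->
  jet_change i j (crd i p) (splitting_operator (s i) (crd i p))
    (splitting_operator (s j) (crd j p)).
Proof.
move=> [ss sl] ip jp; split => [|a]; first exact: sl.
have Sx : reg (dom j) i (crd i p) by exact: reg_crd.
have rS := region_reg HM i (dom_open HM j); have rT := region_reg HM j openT.
rewrite /= mxE.
have E := pd_ext (f := s i) (g := fun y => density_factor 1 i j y * s j (trans i j y)) a rS Sx.
rewrite E; last first.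
  move=> y /(reg_par HM)[iy jy <-]; rewrite (trans_crd HM)//; exact: sl.
have Lt : rquot (fun y => s j (trans i j y)) a (crd i p) @ 0^'+ -->
    \sum_b jac i j (crd i p) a b * pd b (s j) (crd j p).
  have ST y : reg (dom j) i y -> reg setT j (trans i j y).
    by move=> /(reg_par HM)[iy jy <-]; rewrite (trans_crd HM)//; exact: reg_crd.
  have L := pd_comp (a := a) rS rT (@smooth_trans _ _ _ _ HM i j) (ss j) ST Sx.
  rewrite (eq_bigr (fun b => pd a (fun y => trans i j y 0 b) (crd i p) *
    pd b (s j) (trans i j (crd i p)))); first exact: L.
  by move=> b _; rewrite (trans_crd HM)// mxE.
rewrite [LHS](cvg_lim (@Rhausdorff R) (rquotM (@rquot_density_factor 1 _ _ _ a Sx) Lt)).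
rewrite (trans_crd HM)//; congr (_ + _ * _).
by apply: eq_bigr => b _; rewrite mxE.
Qed.

End Cotractor.

Section Normal.
Context {R : realType} {X : topologicalType} {n : nat} {A : atlas R X n.+1}.
Context (HM : manifold_with_boundary A).
Context (Gam : ix A -> christoffel R n.+1).
Context (cGam : connection (interior_part A) Gam).
Context (sigma : ix A -> 'rV[R]_n.+1 -> R) (Hs : canonical_defining_density 1 Gam sigma).
Context (n_gt0 : (0 < n)%N) (spG : special (interior_part A) Gam).
Implicit Types (i j : ix A) (U : set X).

(** The equation is tested on [Gam] itself, a special member of the class over the interior. There
    [sigma] is parallel, so only [sigma] times the Schouten tensor survives; this tensor is
    symmetric since [Gam] is special, and [sigma] has no zeros. *)
Lemma bgg_ricci_flat : bgg_solution Gam sigma -> ricci_flat (interior_part A) Gam.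
Proof.
move=> sol i x Sx; apply/matrixP => a b; rewrite [RHS]mxE.
have oI := interior_open HM; have rS := region_reg HM i oI.
have sG := connection_smooth_sym i cGam.
have eI : special_in_class Gam (interior_part A) Gam.
  by split => //; exact: extended_interior.
have /matrixP/(_ a b) := sol _ _ eI i x Sx; rewrite bggE [RHS]mxE.
have hess c e : hessian_schouten sigma (Gam i) i x c e = sigma i x * schouten (Gam i) x c e.
  rewrite /hessian_schouten mxE [X in _ + X]mxE [X in X + _](_ : _ = 0) ?add0r//.
  have N y : reg (interior_part A) i y -> nabla_density 1 (Gam i) (sigma i) y = 0.
    exact: sigma_parallel.
  rewrite mxE (pd_ext c rS Sx (g := fun=> 0)) ?pd_cst; last first.
    by move=> y /N ->; rewrite mxE.
  rewrite N// mxE mulr0 addr0 big1 ?subr0// => k _; by rewrite mxE mulr0.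
rewrite !hess; have [nu [[snu _] nu0 nnu]] := spG.
have sym := special_ricci_sym rS a b sG (snu i) (@nu0 i) (@nnu i) Sx.
rewrite ![schouten _ _ _ _]mxE -sym => /eqP.
rewrite -mulr2n mulf_eq0 invr_eq0 pnatr_eq0 /= mulrn_eq0 /= !mulf_eq0.
rewrite invr_eq0 -natr1 addrK pnatr_eq0 (gtn_eqF n_gt0) /= => /orP[/eqP s0|/eqP//].
case: Sx s0 => p [ip pi] <- /(sigma_zero Hs ip); exact.
Qed.

(** The upper slot of the tractor derivative cancels by the form of the splitting operator, and the
    lower slot in direction [a] is row [a] of [hessian_schouten]. *)
Lemma flat_normal : ricci_flat (interior_part A) Gam -> normal_bgg_solution Gam sigma.
Proof.
move=> flat; split; first exact: (flat_bgg_solution HM).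
have sd : density 1 setT sigma by case: Hs => [[]].
split; first split.
- by move=> i; exact: sd.1.
- move=> i a; apply: (smooth_on_ext (f := pd a (sigma i))); first by move=> x _; rewrite mxE.
  by apply: (smooth_on_pd a (region_reg HM i openT)); exact: sd.1.
- by move=> i j p ip jp _; exact: density_splitting_jet.
move=> U tGam sp i x Sx a; have H := hessian_schouten_special HM cGam Hs n_gt0 flat spG sp Sx.
rewrite /tractor_nabla splitting_operatorE /=.
have -> : (fun y => (splitting (tGam i) y (splitting_operator (sigma i) y)).2) =
    nabla_density 1 (tGam i) (sigma i).
  by apply/funext => y; rewrite splitting_operatorE.
rewrite subrr; congr pair; apply/rowP => b.
by have /matrixP/(_ a b) := H; rewrite !mxE.
Qed.

End Normal.

(** * The induced projective structure on the boundary *)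

Section Slice.
Context {R : realType} {n : nat}.
Implicit Types (y v : 'rV[R]_n) (f : 'rV[R]_n.+1 -> R) (k : 'I_n).

Definition slice y : 'rV[R]_n.+1 :=
  \row_a (if unlift ord0 a is Some k then y 0 k else 0).

Lemma slice_lift y k : slice y 0 (lift ord0 k) = y 0 k.
Proof. by rewrite mxE liftK. Qed.

Lemma slice0 y : slice y 0 ord0 = 0.
Proof. by rewrite mxE unlift_none. Qed.

Lemma slice_tail (x : 'rV[R]_n.+1) : x 0 ord0 = 0 ->
  slice (\row_k x 0 (lift ord0 k)) = x.
Proof.
move=> x0; apply/rowP => a; case: (unliftP ord0 a) => [k ->|->].
  by rewrite slice_lift mxE.
by rewrite slice0 x0.
Qed.

Lemma sliceD (h : R) y v : slice (h *: v + y) = h *: slice v + slice y.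
Proof.
apply/rowP => a; case: (unliftP ord0 a) => [k ->|->].
  by rewrite [RHS]mxE [in RHS]mxE !slice_lift !mxE.
by rewrite [RHS]mxE [in RHS]mxE !slice0 mulr0 addr0.
Qed.

Lemma slice_delta k : slice (delta_mx 0 k) = delta_mx 0 (lift ord0 k).
Proof.
apply/rowP => a; case: (unliftP ord0 a) => [l ->|->].
  by rewrite slice_lift !mxE (inj_eq lift_inj).
by rewrite slice0 !mxE.
Qed.

(** Valid for arbitrary [f]: both sides are limits of the same quotient. *)
Lemma pd_slice f k y : pd k (f \o slice) y = pd (lift ord0 k) f (slice y).
Proof.
rewrite /pd; set g := (X in lim (X @ _)); set g' := (X in _ = lim (X @ _)).
suff -> : g = g' by [].
apply/funext => h; rewrite /g /g' /=; congr (_ * (f _ - _)).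
by rewrite [y + _]addrC [RHS]addrC sliceD slice_delta.
Qed.

Lemma slice_continuous : continuous slice.
Proof.
move=> y; apply: (@cvg_row _ _ _ (nbhs y) (nbhs_filter y)) => a; case: (unliftP ord0 a) => [k ->|->].
  under eq_fun do rewrite slice_lift; rewrite slice_lift.
  exact: coord_continuous.
under eq_fun do rewrite slice0; rewrite slice0; exact: cvg_cst.
Qed.

Lemma quot_slice f y v :
  (fun h : R => h^-1 *: (((f \o slice : _ -> R^o) \o shift y) (h *: v) - (f \o slice) y)) =
  (fun h : R => h^-1 *: (((f : _ -> R^o) \o shift (slice y)) (h *: slice v) - f (slice y))).
Proof. by apply/funext => h /=; rewrite sliceD. Qed.

Lemma dir_slice f y v : dir v (f \o slice) y = dir (slice v) f (slice y).
Proof. by rewrite /dir /derive quot_slice. Qed.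

Lemma iter_derive_slice f vs :
  iter_derive vs (f \o slice) = iter_derive (map slice vs) f \o slice.
Proof.
elim: vs => [|v vs IH] //=; rewrite IH; apply/funext => y; exact: dir_slice.
Qed.

Lemma smooth_open_slice (O : set 'rV[R]_n.+1) f : smooth_open O f ->
  smooth_open (slice @^-1` O) (f \o slice).
Proof.
move=> [oO sf]; split; first by apply: open_comp => // y _; exact: slice_continuous.
move=> vs y Oy; rewrite iter_derive_slice; have [cf df] := sf (map slice vs) _ Oy.
split; first exact: (continuous_comp (@slice_continuous y) cf).
by move=> v; rewrite /derivable quot_slice; exact: df.
Qed.

Lemma smooth_on_slice (S : set 'rV[R]_n.+1) (T : set 'rV[R]_n) f :
  smooth_on S f -> (forall y, T y -> S (slice y)) -> smooth_on T (f \o slice).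
Proof.
move=> sf TS y Ty; have [W [F [Wy sF FE]]] := sf _ (TS y Ty).
exists (slice @^-1` W), (F \o slice); split; [exact: Wy|exact: smooth_open_slice|].
by move=> z Wz Tz /=; rewrite FE//; exact: TS.
Qed.

End Slice.

(** * Restriction of the extended class to the boundary *)

Section BoundaryStructure.
Context {R : realType} {X : topologicalType} {n : nat} {A : atlas R X n.+1}.
Context (HM : manifold_with_boundary A).
Context (Gam : ix A -> christoffel R n.+1).
Context (cGam : connection (interior_part A) Gam).
Context (sigma : ix A -> 'rV[R]_n.+1 -> R) (Hs : canonical_defining_density 1 Gam sigma).
Context (n_gt0 : (0 < n)%N) (flat : ricci_flat (interior_part A) Gam).
Implicit Types (U : set X).
Local Notation B := (boundary_atlas A).

(** [projectively_compact] provides the formula with [d rho / rho] in each chart; that the change is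
    a one-form on the interior is derived from traces by [proj_equivI]. *)
Lemma compact_extension p : projectively_compact 1 Gam -> boundary A p ->
  exists U hGam, U p /\ extended_class Gam U hGam.
Proof.
move=> pc bp; have [U [rho [hGam [Up [oU _ _ _ _] ch H]]]] := pc p bp.
exists U, hGam; split=> //; split => //.
apply: (proj_equivI HM).
- by apply: connection_sub cGam => q [].
- by apply: connection_sub ch => q [].
move=> i x Sx; apply: (@proj_relI _ _ _ _ (fun a => (\row_a (pd a (fun y => rho (par i y)) x /
                            (1 * rho (par i x)))) 0 a)) => c a b.
exact: H.
Qed.

Lemma slice_crd (i : ix A) p : dom i p -> boundary A p -> slice (@crd _ _ _ B i p) = crd i p.
Proof. by move=> ip bp; apply: slice_tail; apply/(boundaryE HM ip). Qed.

Lemma reg_slice U (i : ix A) y : @reg _ _ _ B U i y -> reg (U `&` boundary A) i (slice y).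
Proof. by move=> [p [[ip bp] Up] <-]; rewrite slice_crd//; exists p. Qed.

Lemma jac_slice (i j : ix A) y k l :
  @jac _ _ _ B i j y k l = jac i j (slice y) (lift ord0 k) (lift ord0 l).
Proof.
rewrite !mxE -(pd_slice (fun z => trans i j z 0 (lift ord0 l))).
by congr (pd k _ y); apply/funext => z; rewrite /trans /= mxE.
Qed.

(** A tangential row of the full Jacobian has a nonzero entry, which by [jac_boundary] is not in
    column 0. *)
Lemma jac_boundary_row_neq0 (i j : ix B) p a : dom i p -> dom j p ->
  exists b, jac i j (crd i p) a b != 0.
Proof.
move=> [ip bp] [jp _]; have [b] := jac_row_neq0 HM (lift ord0 a) ip jp.
case: (unliftP ord0 b) => [l ->|->]; last by rewrite (jac_boundary HM)// eqxx.
by exists l; rewrite jac_slice slice_crd.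
Qed.

(** The transformation law closes up on tangential indices: on the left the term [c = 0] vanishes
    because the boundary is totally geodesic, on the right the terms with [k = 0] or [l = 0] vanish
    by [jac_boundary]. *)
Lemma restrict_connection U tGam : extended_class Gam U tGam ->
  connection (A := B) (U `&` boundary A) (restrict_conn tGam).
Proof.
move=> eU; have [oU [st symt lt] _] := eU; split.
- move=> i c a b.
  apply: (smooth_on_slice (st i (lift ord0 c) (lift ord0 a) (lift ord0 b))).
  by move=> y /reg_slice [p [ip [[Up _] _]] <-]; exists p.
- move=> i y /reg_slice Sy c a b; apply: (symt i (slice y)).
  by case: Sy => [p [ip [[Up _] _]] <-]; exists p.
move=> i j p [ip bp] [jp _] [Up _] f a b.
have := lt i j p ip jp Up (lift ord0 f) (lift ord0 a) (lift ord0 b).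
have li k : lift ord0 k != ord0 :> 'I_n.+1 by rewrite eq_sym neq_lift.
rewrite big_ord_recl (normal_christoffel HM cGam Hs n_gt0 flat eU)// mul0r add0r.
have si : slice (@crd _ _ _ B i p) = @crd _ _ _ A i p by exact: slice_crd.
have sj : slice (@crd _ _ _ B j p) = @crd _ _ _ A j p by exact: slice_crd.
move=> E; transitivity (\sum_(c < n) tGam i (@crd _ _ _ A i p) (lift ord0 c) (lift ord0 a) (lift ord0 b) *
    @jac _ _ _ A i j (@crd _ _ _ A i p) (lift ord0 c) (lift ord0 f)).
  by apply: eq_bigr => c _; rewrite jac_slice si /restrict_conn -/(slice _) si.
rewrite E big_ord_recl [X in _ + (X + _)]big1 ?add0r; last first.
  by move=> l _; rewrite (jac_boundary HM ip jp bp)// !mul0r.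
congr (_ + _).
  rewrite -si -(pd_slice (fun z => @jac _ _ _ A i j z (lift ord0 b) (lift ord0 f))).
  by congr (pd a _ _); apply/funext => z; rewrite jac_slice.
apply: eq_bigr => k _; rewrite big_ord_recl (jac_boundary HM ip jp bp (li b)) mulr0 mul0r add0r.
by apply: eq_bigr => l _; rewrite !jac_slice si /restrict_conn -/(slice _) sj.
Qed.

Lemma restrict_rel (G H : christoffel R n.+1) y : proj_rel (G (slice y)) (H (slice y)) ->
  proj_rel (fun c a b => G (slice y) (lift ord0 c) (lift ord0 a) (lift ord0 b))
    (fun c a b => H (slice y) (lift ord0 c) (lift ord0 a) (lift ord0 b)).
Proof.
move=> GH; apply: (@proj_relI _ _ _ _
  (fun a => trace_diff (G (slice y)) (H (slice y)) (lift ord0 a))) => c a b.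
by rewrite GH !(inj_eq lift_inj).
Qed.

(** Comparison with all restricted connections at once avoids a choice and makes the maximality
    clause of [projective_structure] immediate. *)
Definition boundary_class U (bG : ix B -> christoffel R n) :=
  [/\ open_in B U, connection U bG & forall V tGam, extended_class Gam V tGam ->
    forall i y, reg (U `&` V) i y -> proj_rel (bG i y) (restrict_conn tGam i y)].

Lemma carrier_boundary : carrier B = boundary A.
Proof.
apply/seteqP; split => [p [i []]//|p bp].
by have [i ip] := covered HM p; exists i.
Qed.

Lemma restrict_boundary_class U tGam : extended_class Gam U tGam ->
  boundary_class (U `&` boundary A) (restrict_conn tGam).
Proof.
move=> eU; have [oU _ _] := eU; split.
- by exists U; rewrite carrier_boundary.
- exact: restrict_connection.
move=> V tGam' eV i y Sy; apply: restrict_rel; apply: (extended_rel2 HM eU eV).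
by move: (reg_slice Sy) => [p [ip [[[Up _] Vp] _]] <-]; exists p.
Qed.

Lemma flat_boundary_structure : projectively_compact 1 Gam ->
  boundary_inherits_projective_structure Gam.
Proof.
move=> pc; exists boundary_class; split; last exact: restrict_boundary_class.
have near_ext p : boundary A p -> exists U hGam, U p /\ extended_class Gam U hGam.
  exact: compact_extension.
split.
- by move=> U bG [].
- move=> p; rewrite carrier_boundary => bp; have [U [hGam [Up eU]]] := near_ext p bp.
  exists (U `&` boundary A), (restrict_conn hGam); split => //.
  exact: restrict_boundary_class.
- move=> U V bG bG' [_ cU rU] [_ cV rV]; apply: proj_rel_equiv.
  + by move=> i j p a ip jp _; exact: jac_boundary_row_neq0.
  + by apply: connection_sub cU => q [].
  + by apply: connection_sub cV => q [].
  (* The two connections are compared through the restriction of an extension near [p]. *)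
  move=> i y [p [[ip bp] [Up Vp]] <-]; have [W [hGam [Wp eW]]] := near_ext p bp.
  apply: (@proj_rel_trans _ _ _ (restrict_conn hGam i (@crd _ _ _ B i p))).
    by apply: (rU W hGam eW); exists p.
  by apply/proj_rel_sym; apply: (rV W hGam eW); exists p.
- move=> U bG oU cU H; split => // V tGam eV i y Sy.
  apply: (proj_equiv_rel (H _ _ (restrict_boundary_class eV))).
  by move: Sy => [p [[ip bp] [Up Vp]] <-]; exists p.
Qed.

End BoundaryStructure.

(** * Special connections near the boundary *)

Section Jacobi.
Context {R : realType} {n : nat}.
Local Notation V := 'rV[R]_n.+1.
Context (S : set V) (rS : region S).

Lemma pd_prod (I : eqType) (r : seq I) (F : I -> V -> R) a x : uniq r ->
  (forall i, smooth_on S (F i)) -> S x ->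
  pd a (fun y => \prod_(i <- r) F i y) x =
  \sum_(j <- r) \prod_(i <- r) (if i == j then pd a (F i) x else F i x).
Proof.
move=> + sF Sx; elim: r => [_|j r IH /= /andP[jr ur]].
  rewrite big_nil -[RHS](pd_cst 1 a x); congr (pd a _ x).
  by apply/funext => y; rewrite big_nil.
have -> : (fun y => \prod_(i <- j :: r) F i y) = (fun y => F j y * \prod_(i <- r) F i y).
  by apply/funext => y; rewrite big_cons.
rewrite (pdM a rS (sF j) _ Sx); last exact: smooth_on_prod.
rewrite IH// big_cons addrC; congr (_ + _).
  rewrite big_cons eqxx mulrC; congr (_ * _); apply: eq_big_seq => i ir.
  by case: eqP ir => // ->; rewrite (negbTE jr).
rewrite mulr_sumr; apply: eq_big_seq => k kr; rewrite big_cons.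
by case: eqP kr => // <-; rewrite (negbTE jr).
Qed.

(** Jacobi's formula: the Leibniz rule on the permutation expansion gives the sum over [b] of the
    determinants with row [b] differentiated, and each of these is expanded along that row. *)
Lemma pd_det m (M : V -> 'M[R]_m) a x : (forall b f, smooth_on S (fun y => M y b f)) ->
  S x -> pd a (fun y => \det (M y)) x =
  \sum_b \sum_f pd a (fun y => M y b f) x * cofactor (M x) b f.
Proof.
move=> sM Sx; have sP (s : {perm 'I_m}) : smooth_on S (fun y => \prod_b M y b (s b)).
  by apply: smooth_on_prod => b _; exact: sM.
rewrite (pd_sum _ _ rS _ Sx); last first.
  move=> s _; apply: smooth_onM; first exact: smooth_on_cst.
  exact: (sP s).
pose dM b := \matrix_(c, f) (if c == b then pd a (fun y => M y c f) x else M x c f).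
transitivity (\sum_b \det (dM b)).
  rewrite exchange_big /=; apply: eq_bigr => s _.
  rewrite (pdZ _ _ rS (sP s) Sx) (pd_prod _ (index_enum_uniq _) (fun b => sM b (s b)) Sx).
  rewrite -mulr_sumr; congr (_ * _); apply: eq_bigr => b _; apply: eq_bigr => c _.
  by rewrite mxE.
apply: eq_bigr => b _; rewrite (expand_det_row _ b); apply: eq_bigr => f _.
rewrite mxE eqxx; congr (_ * _); rewrite /cofactor; congr (_ * \det _).
by apply/matrixP => c e; rewrite !mxE eq_sym (negbTE (neq_lift _ _)).
Qed.

End Jacobi.

Section SpecialExtension.
Context {R : realType} {X : topologicalType} {n : nat} {A : atlas R X n.+1}.
Context (HM : manifold_with_boundary A).
Implicit Types (i j k : ix A) (U : set X).

Lemma cofactor_jac i j p b f : dom i p -> dom j p ->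
  cofactor (jac i j (crd i p)) b f =
  \det (jac i j (crd i p)) * jac j i (crd j p) f b.
Proof.
move=> ip jp; set J := jac i j _; set K := jac j i _.
have KJ : K *m J = 1%:M by exact: (jac_inv HM).
have : \adj J = \det J *: K.
  by rewrite -[LHS]mul1mx -KJ -mulmxA mul_mx_adj mul_mx_scalar.
by move=> /matrixP/(_ f b); rewrite !mxE.
Qed.

(* Jacobi's formula turns the trace of the transformation law of a connection
   into the statement that the coordinate volume forms differ by [det]. *)
Lemma trace_law U Gam i j p a : connection U Gam -> dom i p -> dom j p -> U p ->
  \sum_c Gam i (crd i p) c a c =
  pd a (fun x => \det (jac i j x)) (crd i p) / \det (jac i j (crd i p)) +
  \sum_k jac i j (crd i p) a k * \sum_l Gam j (crd j p) l k l.
Proof.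
move=> [_ _ lG] ip jp Up; set J := jac i j (crd i p); set K := jac j i (crd j p).
have Sx : reg (dom j) i (crd i p) by exact: reg_crd.
have rS := region_reg HM i (dom_open HM j).
have D0 : \det J != 0 by exact: (det_jac_neq0 HM).
have JK b c : \sum_f J b f * K f c = (b == c)%:R.
  by have /matrixP/(_ b c) := jac_inv HM ip jp; rewrite !mxE.
have KJ f e : \sum_b K f b * J b e = (f == e)%:R.
  by have /matrixP/(_ f e) := jac_inv HM jp ip; rewrite !mxE.
have -> : pd a (fun x => \det (jac i j x)) (crd i p) / \det J =
    \sum_b \sum_f pd a (fun y => jac i j y b f) (crd i p) * K f b.
  rewrite (pd_det rS a _ Sx); last by move=> b f; exact: (smooth_jac HM).
  rewrite mulr_suml; apply: eq_bigr => b _; rewrite mulr_suml; apply: eq_bigr => f _.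
  by rewrite cofactor_jac// -/J -/K; field.
transitivity (\sum_b \sum_f (\sum_c Gam i (crd i p) c a b * J c f) * K f b).
  apply: eq_bigr => b _.
  under eq_bigr do rewrite mulr_suml.
  rewrite exchange_big /= -[LHS](sum_deltar (fun c => Gam i (crd i p) c a b)).
  by apply: eq_bigr => c _; rewrite -JK mulr_sumr; apply: eq_bigr => f _; rewrite mulrA.
under eq_bigr do under eq_bigr do rewrite lG// -/J mulrDl.
under eq_bigr do rewrite big_split /=.
rewrite big_split /=; congr (_ + _).
transitivity (\sum_f \sum_k \sum_l J a k * Gam j (crd j p) f k l * \sum_b K f b * J b l).
  rewrite exchange_big /=; apply: eq_bigr => f _.
  under eq_bigr do rewrite mulr_suml; rewrite exchange_big /=; apply: eq_bigr => k _.
  under eq_bigr do rewrite mulr_suml; rewrite exchange_big /=; apply: eq_bigr => l _.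
  rewrite mulr_sumr; apply: eq_bigr => b _; rewrite -/J; ring.
rewrite exchange_big /=; apply: eq_bigr => k _; rewrite mulr_sumr.
apply: eq_bigr => f _; under eq_bigr do rewrite KJ.
by rewrite (sum_deltal (fun l => J a k * Gam j (crd j p) f k l)).
Qed.

Context (U : set X) (hGam : ix A -> christoffel R n.+1) (i0 : ix A).
Context (oU : open U) (ch : connection U hGam) (Ui0 : U `<=` dom i0).

Let D j x := \det (jac j i0 x).
(** By [pure_trace] the change adds [n + 2] times this to the trace, which becomes the logarithmic
    derivative of [D]. *)
Let ups j x a := n.+2%:R^-1 * (pd a (D j) x / D j x - \sum_c hGam j x c a c).

(* The connection in the projective class of [hGam] that preserves the
   coordinate volume of the chart [i0]. *)
Definition unimodular j x c a b :=
  hGam j x c a b + ups j x a * (c == b)%:R + ups j x b * (c == a)%:R.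

Lemma unimodular_pure j x : proj_pure (hGam j x) (unimodular j x) (ups j x).
Proof. by []. Qed.

Let regU j : reg U j `<=` reg (dom i0) j.
Proof. by move=> x [p [jp /Ui0 ip] <-]; exists p. Qed.

Let sD j : smooth_on (reg U j) (D j).
Proof. exact: (smooth_on_sub (@regU j) (@smooth_det _ _ _ _ HM j i0)). Qed.

Let D0 j x : reg U j x -> D j x != 0.
Proof. by move=> /regU; exact: (det_jac_neq0 HM). Qed.

(** In [trace_law] the logarithmic derivative of the determinant cancels, which exhibits [ups] as
    the pullback of a covector in the chart [i0]; [unimodular_law] then follows from the cocycle
    rule for Jacobians. *)
Lemma unimodular_form j p a : dom j p -> U p -> ups j (crd j p) a =
  \sum_k jac j i0 (crd j p) a k * (- n.+2%:R^-1 * \sum_l hGam i0 (crd i0 p) l k l).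
Proof.
move=> jp Up; have ip := Ui0 Up.
rewrite /ups (trace_law a ch jp ip Up) opprD addNKr mulrN -mulNr mulr_sumr.
by apply: eq_bigr => k _; rewrite mulrCA.
Qed.

Lemma unimodular_law j k p a : dom j p -> dom k p -> U p ->
  ups j (crd j p) a = \sum_b jac j k (crd j p) a b * ups k (crd k p) b.
Proof.
move=> jp kp Up; have ip := Ui0 Up; rewrite unimodular_form// (jac_cocycle HM jp kp ip).
under eq_bigr do rewrite mxE mulr_suml.
rewrite exchange_big /=; apply: eq_bigr => b _; rewrite unimodular_form// mulr_sumr.
by apply: eq_bigr => c _; rewrite mulrA.
Qed.

Lemma unimodular_smooth j a : smooth_on (reg U j) (fun x => ups j x a).
Proof.
have [sh _ _] := ch; have rS := region_reg HM j oU.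
apply: smooth_onM; first exact: smooth_on_cst.
apply: smooth_onB; last by apply: smooth_on_sum.
by apply: smooth_onM; [exact: smooth_on_pd|apply: smooth_onV => // x; exact: D0].
Qed.

Lemma unimodular_connection : connection U unimodular.
Proof.
have [sh symh lh] := ch; split.
- move=> j c a b; apply: smooth_onD; first apply: smooth_onD; first exact: sh.
    by apply: smooth_onM; [exact: unimodular_smooth|exact: smooth_on_cst].
  by apply: smooth_onM; [exact: unimodular_smooth|exact: smooth_on_cst].
- move=> j x Sx c a b; rewrite /unimodular symh// -!addrA; congr (_ + _).
  exact: addrC.
move=> j k p jp kp Up f a b; set J := jac j k (crd j p).
under eq_bigr do rewrite mulrC.
rewrite (pure_contract (fun c => J c f) a b (@unimodular_pure j (crd j p))).
have -> : \sum_c J c f * hGam j (crd j p) c a b = \sum_c hGam j (crd j p) c a b * J c f.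
  by apply: eq_bigr => c _; rewrite mulrC.
rewrite lh// -/J -!addrA; congr (_ + _).
have uE e : ups j (crd j p) e = \sum_b J e b * ups k (crd k p) b by exact: unimodular_law.
rewrite !uE; set u := ups k (crd k p); set g := hGam k (crd k p).
transitivity (\sum_m (\sum_l J a m * J b l * g f m l + (J a m * u m) * J b f +
   J a m * (\sum_l J b l * u l) * (f == m)%:R)).
  rewrite !big_split /= -mulr_suml.
  by rewrite (sum_deltal (fun m => J a m * (\sum_l J b l * u l))) -addrA mulrC.
apply: eq_bigr => m _.
transitivity (\sum_l (J a m * J b l * g f m l + (J a m * u m * J b l) * (f == l)%:R
   + J a m * (J b l * u l) * (f == m)%:R)).
  rewrite !big_split /= (sum_deltal (fun l => J a m * u m * J b l)).
  by rewrite -mulr_suml -mulr_sumr.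
by apply: eq_bigr => l _; rewrite /unimodular -/u -/g; ring.
Qed.

Lemma unimodular_special : special U unimodular.
Proof.
exists (fun j x => `|D j x|); split.
- split; first by move=> j; apply: smooth_on_norm => // x; exact: D0.
  move=> j k p jp kp Up; have ip := Ui0 Up.
  rewrite /density_factor /vol_weight opprK divff ?pnatr_eq0// powRr1//.
  by rewrite -normrM -det_mulmx /D (jac_cocycle HM jp kp ip).
- by move=> j x Sx; rewrite normr_eq0 D0.
move=> j x Sx; apply/rowP => a; rewrite !mxE.
have rS := region_reg HM j oU; have nD : `|D j x| != 0 by rewrite normr_eq0 D0.
have sn : smooth_on (reg U j) (fun x => `|D j x|).
  by apply: smooth_on_norm => // y; exact: D0.
have -> : \sum_c unimodular j x c a c = pd a (D j) x / D j x.
  rewrite (pure_trace a (@unimodular_pure j x)) /ups mulrA divff ?pnatr_eq0// mul1r.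
  by rewrite addrC subrK.
rewrite /vol_weight mulNr divff ?pnatr_eq0// mulN1r mulNr.
apply/eqP; rewrite subr_eq0; apply/eqP.
(* Differentiating [|D|^2 = D^2] gives the derivative of the norm without distinguishing the sign of
   [D]. *)
have E : pd a (fun x => `|D j x| * `|D j x|) x = pd a (fun x => D j x * D j x) x.
  congr (pd a _ x); apply/funext => y; rewrite -!expr2 real_normK//; exact: num_real.
move: E; rewrite !(pdM a rS _ _ Sx)// => E.
have E1 : `|D j x| * pd a (fun x => `|D j x|) x = D j x * pd a (D j) x by lra.
have N2 : `|D j x| * `|D j x| = D j x * D j x.
  by rewrite -!expr2 real_normK//; exact: num_real.
apply: (mulfI nD); rewrite E1.
transitivity (`|D j x| * `|D j x| * (pd a (D j) x / D j x)); last by ring.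
by rewrite N2; field; exact: D0.
Qed.

End SpecialExtension.

Section SpecialCover.
Context {R : realType} {X : topologicalType} {n : nat} {A : atlas R X n.+1}.
Context (HM : manifold_with_boundary A).
Context (Gam : ix A -> christoffel R n.+1).
Context (cGam : connection (interior_part A) Gam) (spG : special (interior_part A) Gam).

Lemma special_cover p : projectively_compact 1 Gam ->
  exists U tGam, U p /\ special_in_class Gam U tGam.
Proof.
move=> pc; have [bp|ip] := pselect (boundary A p); last first.
  exists (interior_part A), Gam; do 2!split=> //; exact: extended_interior.
have [U [hGam [Up eU]]] := compact_extension HM cGam pc bp.
have [oU ch _] := eU; have [i0 ip] := covered HM p.
(* Within one chart domain there is a coordinate volume to which the extension can be normalized. *)
have oU' : open (U `&` dom i0) by apply: openI => //; exact: dom_open.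
have ch' : connection (U `&` dom i0) hGam by apply: connection_sub ch => q [].
have Ui0 : U `&` dom i0 `<=` dom i0 by move=> q [].
exists (U `&` dom i0), (unimodular hGam i0); split => //; split; last first.
  exact: unimodular_special.
split => //; first exact: unimodular_connection.
apply: (proj_equivI HM).
- by apply: connection_sub cGam => q [].
- by apply: connection_sub (unimodular_connection HM oU' ch' Ui0) => q [].
move=> i x Sx; apply: (@proj_rel_trans _ _ _ (hGam i x)).
  by apply: (extended_rel eU); case: Sx => q [iq [[Uq _] qi] <-]; exists q.
exact: proj_relI (@unimodular_pure _ _ _ _ hGam i0 i x).
Qed.

End SpecialCover.

(** * Uniqueness for linear ODEs *)

Section LinearODE.
Context {R : realType} {m : nat}.
Implicit Types (a b s t M : R).

(** Each product satisfies [2 |w k * w l| <= w k ^+ 2 + w l ^+ 2]; summing over both indices counts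
    every square [2 m] times. *)
Lemma energy_bound (A : 'I_m -> 'I_m -> R) (w : 'I_m -> R) M :
  (forall k l, `|A k l| <= M) ->
  `|\sum_k 2 * (w k * \sum_l A k l * w l)| <= 2 * (M * m%:R) * \sum_k w k ^+ 2.
Proof.
move=> AM.
have -> : 2 * (M * m%:R) * \sum_k w k ^+ 2 = \sum_k \sum_l M * (w k ^+ 2 + w l ^+ 2).
  transitivity (\sum_k M * (m%:R * w k ^+ 2 + \sum_l w l ^+ 2)); last first.
    apply: eq_bigr => k _.
    by rewrite -mulr_sumr big_split /= sumr_const card_ord mulr_natl.
  by rewrite -mulr_sumr big_split /= sumr_const card_ord -mulr_sumr -mulr_natl; ring.
rewrite (le_trans (ler_norm_sum _ _ _))//; apply: ler_sum => k _.
rewrite mulrA mulr_sumr (le_trans (ler_norm_sum _ _ _))//; apply: ler_sum => l _.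
have -> : 2 * w k * (A k l * w l) = A k l * (2 * (w k * w l)) by ring.
rewrite normrM ler_pM//.
rewrite ler_norml; apply/andP; split.
  by have := sqr_ge0 (w k + w l); lra.
by have := sqr_ge0 (w k - w l); lra.
Qed.

Context (a b : R) (w : 'I_m -> R -> R) (A : 'I_m -> 'I_m -> R -> R) (M : R).
Context (cw : forall k, {within `[a, b], continuous (w k)})
  (dw : forall k t, a < t < b -> is_derive t 1 (w k) (\sum_l A k l t * w l t))
  (AM : forall k l t, a < t < b -> `|A k l t| <= M).

Let E t := \sum_k w k t ^+ 2.
Let C := 2 * (M * m%:R).

Let cE : {within `[a, b], continuous E}.
Proof.
move=> x; have -> : E = fun t => \sum_k w k t * w k t.
  by apply/funext => t; apply: eq_bigr => k _; rewrite expr2.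
apply: cvg_big => [|k _]; first exact: add_continuous.
by apply: cvgM; exact: cw.
Qed.

Let dE t : a < t < b ->
  is_derive t 1 E (\sum_k 2 * (w k t * \sum_l A k l t * w l t)).
Proof.
move=> tab; have dwt k := dw k tab.
have -> : E = \sum_k (w k ^+ 2) by apply/funext => s; rewrite /E fct_sumE.
apply: is_derive_eq; apply: eq_bigr => k _.
by rewrite expr1 /GRing.scale /= -mulrA.
Qed.

Let cexp c : {within `[a, b], continuous (fun t => expR (c * t))}.
Proof.
apply: continuous_subspaceT => x; apply: (@continuous_comp _ _ _ (fun t : R => c * t) expR).
  exact: mulrl_continuous.
exact: continuous_expR.
Qed.

Let dexp c t : is_derive t 1 (fun t => expR (c * t)) (c * expR (c * t)).
Proof.
have d1 : is_derive t (1:R) (fun t => c * t) c.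
  have -> : (fun s => c * s) = c *: (id : R -> R) by [].
  by apply: is_derive_eq; rewrite /GRing.scale /= mulr1.
have := @is_derive1_comp R expR (fun t => c * t) t _ _ (is_derive_expR _) d1.
by rewrite mulrC.
Qed.

(** Gronwall for the energy [E]: since the derivative of [E] is bounded by [C * E], the function
    [E * expR (- C * t)] is nonincreasing and [E * expR (C * t)] nondecreasing. The first settles
    times after [s], the second times before [s]. *)
Lemma linear_ode_unique (s t : R) : 0 <= M -> a <= s <= b -> a <= t <= b ->
  (forall k, w k s = 0) -> forall k, w k t = 0.
Proof.
move=> M0 sab tab ws0.
have Es : E s = 0 by rewrite /E big1// => k _; rewrite ws0 expr0n.
suff Et : E t <= 0.
  move=> k; apply/eqP; rewrite -sqrf_eq0 eq_le sqr_ge0 andbT.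
  rewrite (le_trans _ Et)// /E (bigD1 k)//= lerDl; apply: sumr_ge0 => l _; exact: sqr_ge0.
have dEc c r : a < r < b -> is_derive r 1 (fun t => E t * expR (c * t))
    ((\sum_k 2 * (w k r * \sum_l A k l r * w l r) + c * E r) * expR (c * r)).
  move=> rab; have := is_deriveM (dE rab) (dexp c r).
  by move=> H; apply: (is_derive_eq H); rewrite /GRing.scale /=; ring.
have cEc c : {within `[a, b], continuous (fun t => E t * expR (c * t))}.
  by move=> x; apply: cvgM; [exact: cE|exact: cexp].
have bd r : a < r < b -> `|\sum_k 2 * (w k r * \sum_l A k l r * w l r)| <= C * E r.
  by move=> rab; apply: energy_bound => k l; exact: AM.
have [st|ts] := leP s t.
  have H : E t * expR (- C * t) <= E s * expR (- C * s).
    apply: (@ler0_derive1_le_cc R (fun t => E t * expR (- C * t)) a b) => //.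
    - move=> r; rewrite in_itv /= => rab; exact: (@ex_derive _ _ _ _ _ _ _ (dEc _ r rab)).
    - move=> r; rewrite in_itv /= => rab.
      rewrite derive1E (@derive_val _ _ _ _ _ _ _ (dEc _ r rab)).
      rewrite pmulr_lle0 ?expR_gt0// mulNr subr_le0.
      exact: le_trans (ler_norm _) (bd r rab).
  by move: H; rewrite Es mul0r pmulr_lle0// expR_gt0.
have H : E t * expR (C * t) <= E s * expR (C * s).
  apply: (@ger0_derive1_le_cc R (fun t => E t * expR (C * t)) a b) => //.
  - move=> r; rewrite in_itv /= => rab; exact: (@ex_derive _ _ _ _ _ _ _ (dEc _ r rab)).
  - move=> r; rewrite in_itv /= => rab.
    rewrite derive1E (@derive_val _ _ _ _ _ _ _ (dEc _ r rab)).
    rewrite mulr_ge0 ?expR_ge0//.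
    by have := bd r rab; rewrite ler_norml => /andP[+ _]; lra.
  exact: ltW.
by move: H; rewrite Es mul0r pmulr_lle0// expR_gt0.
Qed.

End LinearODE.

(** * Curves in a chart *)

Section Locally.
Context {R : realType}.
Implicit Types (f g : R -> R) (S : set R) (t : R).

(** Uniqueness for the linear system asks for bounded coefficients. With [S] restricted to times in
    the open unit interval, such bounds make sense also near its end points. *)
Definition loc_bounded (S : set R) (t0 : R) f :=
  exists M, \forall t \near t0, S t -> `|f t| <= M.

Lemma loc_boundedD S t f g : loc_bounded S t f -> loc_bounded S t g ->
  loc_bounded S t (fun x => f x + g x).
Proof.
move=> [M fM] [N gN]; exists (M + N); move: fM gN; apply: filterS2 => s sM sN Ss.
by rewrite (le_trans (ler_normD _ _))// lerD// ?sM ?sN.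
Qed.

Lemma loc_boundedM S t f g : loc_bounded S t f -> loc_bounded S t g ->
  loc_bounded S t (fun x => f x * g x).
Proof.
move=> [M fM] [N gN]; exists (M * N); move: fM gN; apply: filterS2 => s sM sN Ss.
by rewrite normrM ler_pM// ?sM ?sN.
Qed.

Lemma loc_bounded_cst S t (k : R) : loc_bounded S t (fun=> k).
Proof. by exists `|k|; near=> s. Unshelve. all: by end_near. Qed.

Lemma loc_boundedN S t f : loc_bounded S t f -> loc_bounded S t (fun x => - f x).
Proof. by move=> [M fM]; exists M; apply: filterS fM => s sM Ss; rewrite normrN sM. Qed.

Lemma loc_bounded_sum (I : Type) (r : seq I) (F : I -> R -> R) S t :
  (forall i, loc_bounded S t (F i)) -> loc_bounded S t (fun x => \sum_(i <- r) F i x).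
Proof.
move=> FM; elim: r => [|i r [N rN]].
  by exists 0; near=> x => _; rewrite big_nil normr0.
have [M iM] := loc_boundedD (FM i) (ex_intro _ N rN).
by exists M; apply: filterS iM => s sM Ss; rewrite big_cons sM.
Unshelve. all: by end_near. Qed.

Lemma loc_bounded_cvg S t f (l : R) : f @ within S (nbhs t) --> l -> loc_bounded S t f.
Proof.
move=> /cvgrPdist_lt/(_ 1 ltr01); rewrite near_withinE => H.
exists (`|l| + 1); apply: filterS H => s Hs Ss.
rewrite -lerBlDl; apply: le_trans (lerB_dist _ _) _.
by rewrite distrC ltW// Hs.
Qed.

Lemma loc_bounded_family (K : finType) (F : K -> R -> R) S t :
  (forall k, loc_bounded S t (F k)) ->
  exists2 M, 0 <= M & \forall s \near t, S s -> forall k, `|F k s| <= M.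
Proof.
move=> H; have [M MP] := choice H.
exists (\sum_k `|M k|); first by apply: sumr_ge0.
have : \forall s \near t, forall k, S s -> `|F k s| <= M k.
  by apply: (@filter_forall _ _ (fun k s => S s -> `|F k s| <= M k)
    (nbhs t) (nbhs_filter t)) => k; exact: MP.
apply: filterS => s Hs Ss k; rewrite (le_trans (Hs k Ss))//.
by rewrite (le_trans (ler_norm _))// (bigD1 k)//= lerDl sumr_ge0.
Qed.

Lemma within_unit_dnbhs t : 0 < t < 1 ->
  within [set h | 0 <= t + h <= 1] 0^' = (0 : R)^'.
Proof.
move=> /andP[t0 t1]; rewrite eqEsubset; split => P; last exact: cvg_within.
move=> HP0; have HP : \forall h \near (0:R)^', 0 <= t + h <= 1 -> P h by exact: HP0.
have D : \forall h \near (0:R)^', 0 <= t + h <= 1.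
  have e0 : 0 < Num.min t (1 - t) by rewrite lt_min t0 subr_gt0.
  apply: filterS (dnbhs0_lt e0) => h; rewrite lt_min !ltr_norml => /andP[/andP[h1 _] /andP[_ h2]].
  by apply/andP; split; lra.
by move: HP D; apply: filterS2 => h; apply.
Qed.

Definition dquot f t (h : R) := h^-1 * (f (t + h) - f t).

Lemma unit_deriveE f t (l : R) : 0 < t < 1 -> dquot f t @ 0^' --> l -> unit_derive f t = l.
Proof.
move=> t01 H; rewrite /unit_derive within_unit_dnbhs//.
exact: (cvg_lim (@Rhausdorff R) H).
Qed.

Lemma dquotD f g t (l k : R) : dquot f t @ 0^' --> l -> dquot g t @ 0^' --> k ->
  dquot (fun x => f x + g x) t @ 0^' --> l + k.
Proof.
move=> Lf Lg; rewrite (_ : dquot _ _ = fun h => dquot f t h + dquot g t h); first exact: cvgD.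
by apply/funext => h; rewrite /dquot; ring.
Qed.

Lemma dquotN f t (l : R) : dquot f t @ 0^' --> l -> dquot (fun x => - f x) t @ 0^' --> - l.
Proof.
move=> Lf; rewrite (_ : dquot _ _ = fun h => - dquot f t h); first exact: cvgN.
by apply/funext => h; rewrite /dquot; ring.
Qed.

Lemma dquot_derive f t (l : R) : dquot f t @ 0^' --> l -> is_derive t 1 (f : R -> R^o) l.
Proof.
move=> L; have E : (fun h : R => h^-1 *: (((f : R -> R^o) \o shift t) (h *: 1) - f t)) = dquot f t.
  by apply/funext => h; rewrite /dquot /= [h *: 1]mulr1 [h + t]addrC.
split; first by rewrite /derivable E; apply/cvg_ex; exists l.
by rewrite /derive E; exact: (cvg_lim (@Rhausdorff R) L).
Qed.

Lemma derive_dquot f t (l : R) : is_derive t 1 (f : R -> R^o) l -> dquot f t @ 0^' --> l.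
Proof.
move=> [D <-]; have E : (fun h : R => h^-1 *: (((f : R -> R^o) \o shift t) (h *: 1) - f t)) = dquot f t.
  by apply/funext => h; rewrite /dquot /= [h *: 1]mulr1 [h + t]addrC.
by move: D; rewrite /derivable /derive E.
Qed.

Lemma dquotM f g t (l k : R) : dquot f t @ 0^' --> l -> dquot g t @ 0^' --> k ->
  dquot (fun x => f x * g x) t @ 0^' --> l * g t + f t * k.
Proof.
move=> /dquot_derive df /dquot_derive dg; apply: derive_dquot.
have := is_deriveM df dg => H; apply: (is_derive_eq H); rewrite /GRing.scale /=; ring.
Qed.

Lemma dquot0_continuous f t (l : R) : dquot f t @ 0^' --> l ->
  (fun h => f (t + h)) @ (0:R)^' --> f t.
Proof.
move=> L; have L2 : (fun h => f t + h * dquot f t h) @ (0:R)^' --> f t + 0 * l.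
  apply: cvgD; first exact: cvg_cst.
  by apply: cvgM => //; exact: cvg_within.
rewrite mul0r addr0 in L2; apply: cvg_trans L2; apply: near_eq_cvg.
have : \forall h \near (0:R)^', h != 0 by exact: nbhs_dnbhs_neq.
apply: filterS => h h0.
by rewrite /dquot mulrA divff// mul1r addrC subrK.
Qed.

Lemma dquot_ext f g t (l : R) : f t = g t -> (\forall s \near t, f s = g s) ->
  dquot f t @ 0^' --> l -> dquot g t @ 0^' --> l.
Proof.
move=> fgt fg; apply: cvg_trans; apply: near_eq_cvg.
have : \forall h \near (0:R), f (t + h) = g (t + h).
  have C : (fun h => t + h) @ (0:R) --> t.
    by rewrite -[X in _ --> X]addr0; apply: cvgD; [exact: cvg_cst|exact: cvg_id].
  exact: C _ fg.
by move=> H; apply: cvg_within; apply: filterS H => h H; rewrite /dquot H fgt.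
Qed.

End Locally.

Section Curve.
Context {R : realType} {X : topologicalType} {n : nat} {A : atlas R X n.+1}.
Context (HM : manifold_with_boundary A).
Context (gam : R -> X) (sg : smooth_curve A gam).
Context (i : ix A) (U : set X) (oU : open U).
Local Notation V := 'rV[R]_n.+1.

Definition chart_times : set R := [set t | 0 <= t <= 1 /\ (dom i (gam t) /\ U (gam t))].
Local Notation J := chart_times.
Let x r : V := crd i (gam r).
Definition velocity (a : 'I_n.+1) t := unit_derive (fun r => x r 0 a) t.

Lemma chart_times_unit : J `<=` unit_part gam i.
Proof. by move=> t [t01 [it _]]. Qed.

Lemma chart_times_reg t : J t -> reg U i (x t).
Proof. by move=> [_ [it Ut]]; exists (gam t). Qed.

Lemma chart_times_near t : J t -> \forall s \near t, 0 <= s <= 1 -> J s.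
Proof.
move=> [t01 [it Ut]]; have [cg _] := sg.
have C : gam @ within [set t | 0 <= t <= 1] (nbhs t) --> gam t.
  exact: (subspace_continuousP _ _).1 cg _ t01.
have oI : open (dom i `&` U) by apply: openI => //; exact: dom_open.
have H : \forall s \near t, 0 <= s <= 1 -> (dom i `&` U) (gam s).
  exact: (C _ (open_nbhs_nbhs (conj oI (conj it Ut)))).
by apply: filterS H => s Hs s01; have [] := Hs s01.
Qed.

Lemma chart_times_interior t : J t -> 0 < t < 1 -> \forall s \near t, J s.
Proof.
move=> Jt /andP[t0 t1]; near=> s.
have s01 : 0 <= s <= 1.
  by apply/andP; split; apply: ltW; near: s; [exact: lt_nbhsr|exact: lt_nbhsl].
by move: s01; near: s; exact: chart_times_near.
Unshelve. all: by end_near. Qed.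

Lemma within_sub (S T : set R) (t : R) (f : R -> R) (l : R) : T `<=` S ->
  f @ within S (nbhs t) --> l -> f @ within T (nbhs t) --> l.
Proof. by move=> TS; apply: cvg_trans; apply: cvg_app; exact: within_subset. Qed.

Lemma unit_part_continuous (g : R -> R) t :
  smooth_on (V := R^o) (unit_part gam i) g -> J t -> g @ within J (nbhs t) --> g t.
Proof.
move=> sg' Jt; apply: (within_sub chart_times_unit).
exact: (smooth_on_continuous sg' (chart_times_unit Jt)).
Qed.

Lemma curve_continuous (f : V -> R) t : smooth_on (reg U i) f -> J t ->
  (fun r => f (x r)) @ within J (nbhs t) --> f (x t).
Proof.
move=> sf Jt; have Cx : x @ within J (nbhs t) --> x t.
  apply: cvg_row => a; apply: (@unit_part_continuous (fun r => x r 0 a)) => //.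
  exact: sg.2.
move=> P /(smooth_on_continuous sf (chart_times_reg Jt)) /= HP.
have H1 : \forall y \near x t, reg U i y -> P (f y) by exact: HP.
have H2 : \forall r \near t, J r -> reg U i (x r) -> P (f (x r)) by exact: (Cx _ H1).
by apply: filterS H2 => r Hr Jr; apply: Hr => //; exact: chart_times_reg.
Qed.

(** A local extension of [g] is differentiable beyond an end point of the unit interval. Its
    derivative is continuous at [t0] and controls the derivatives of [g] at nearby interior
    times. *)
Lemma unit_part_extension (g : R -> R) t0 : smooth_on (V := R^o) (unit_part gam i) g ->
  J t0 -> exists dg : R -> R, {for t0, continuous dg} /\
   \forall t \near t0, J t -> 0 < t < 1 -> dquot g t @ 0^' --> dg t.
Proof.
move=> sg' Jt; have [W [F [Wt sF FE]]] := sg' _ (chart_times_unit Jt).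
exists (dir (1 : R^o) F); split.
  exact: (smooth_open_diffable (smooth_open_dir _ sF) Wt).1.
apply: filterS (near_open sF.1 Wt (fun s Ws => Ws)) => s Ws Js s01.
have := (smooth_open_diffable sF Ws).2 (1 : R^o).
move=> /derivableP; rewrite -/(dir _ F s) => dF.
have LF : dquot F s @ 0^' --> dir (1 : R^o) F s by exact: derive_dquot.
have N : \forall r \near s, F r = g r.
  have := near_open sF.1 Ws (fun r Wr => Wr).
  have := chart_times_interior Js s01; apply: filterS2 => r Jr Wr.
  exact: (FE _ Wr (chart_times_unit Jr)).
exact: (dquot_ext (nbhs_singleton N) N LF).
Qed.

Lemma unit_part_dquot (g : R -> R) t : smooth_on (V := R^o) (unit_part gam i) g ->
  J t -> 0 < t < 1 -> dquot g t @ 0^' --> unit_derive g t.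
Proof.
move=> sg' Jt t01; have [dg [_ H]] := unit_part_extension sg' Jt.
have L := nbhs_singleton H Jt t01.
by rewrite (unit_deriveE t01 L).
Qed.

Lemma velocity_bounded a t0 : J t0 ->
  loc_bounded (J `&` [set t | 0 < t < 1]) t0 (velocity a).
Proof.
move=> Jt; have [dg [cg H]] := @unit_part_extension (fun r => x r 0 a) t0 (sg.2 i a) Jt.
have [M bM] : loc_bounded setT t0 dg.
  by apply: (@loc_bounded_cvg _ _ _ _ (dg t0)); apply: cvg_trans cg; apply/cvg_app/cvg_within.
exists M; move: bM H; apply: filterS2 => s bs Hs [Js s01].
by rewrite /velocity (unit_deriveE s01 (Hs Js s01)); exact: bs.
Qed.

(** The curve may touch the boundary at time [t], so [f] is replaced by an extension before the
    two-sided chain rule is applied. *)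
Lemma curve_dquot (f : V -> R) t : smooth_on (reg U i) f -> J t -> 0 < t < 1 ->
  dquot (fun r => f (x r)) t @ 0^' --> \sum_a velocity a t * pd a f (x t).
Proof.
move=> sf Jt t01; have Sx := chart_times_reg Jt; have rS := region_reg HM i oU.
have [W [F [Wx sF FE]]] := sf _ Sx.
have Lx a := @unit_part_dquot (fun r => x r 0 a) t (sg.2 i a) Jt t01.
have Cx : (fun h => x (t + h)) @ (0 : R)^' --> x t.
  by apply: cvg_row => a; exact: (dquot0_continuous (Lx a)).
have L : (fun h => h^-1 * (F (x (t + h)) - F (x t))) @ (0:R)^' -->
    \sum_a (\row_b velocity b t) 0 a * partial a F (x t).
  by apply: (chain_cvg sF Wx Cx) => a; rewrite mxE; exact: Lx.
have -> : \sum_a velocity a t * pd a f (x t) =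
    \sum_a (\row_b velocity b t) 0 a * partial a F (x t).
  by apply: eq_bigr => a _; rewrite mxE (pdE a rS Sx Wx sF FE).
apply: cvg_trans L; apply: near_eq_cvg.
have N1 : \forall h \near (0:R)^', W (x (t + h)).
  exact: (Cx _ (near_open sF.1 Wx (fun y Wy => Wy))).
have N2 : \forall h \near (0:R)^', J (t + h).
  have C : (fun h => t + h) @ (0:R)^' --> t.
    by rewrite -[X in _ --> X]addr0; apply: cvgD; [exact: cvg_cst|exact: cvg_within].
  exact: C _ (chart_times_interior Jt t01).
move: N1 N2; apply: filterS2 => h Wh Jh.
by rewrite /dquot (FE _ Wh (chart_times_reg Jh)) (FE _ Wx Sx).
Qed.

End Curve.

(** * Parallel transport of the cotractor *)

Section Transport.
Context {R : realType} {X : topologicalType} {n : nat} {A : atlas R X n.+1}.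
Context (HM : manifold_with_boundary A).
Context (Gam : ix A -> christoffel R n.+1).
Context (cGam : connection (interior_part A) Gam).
Context (sigma : ix A -> 'rV[R]_n.+1 -> R) (Hs : canonical_defining_density 1 Gam sigma).
Context (n_gt0 : (0 < n)%N) (flat : ricci_flat (interior_part A) Gam).
Context (spG : special (interior_part A) Gam).
Local Notation V := 'rV[R]_n.+1.
Local Notation L i p := (splitting_operator (sigma i) (crd i p)).

Section Local.
Context (gam : R -> X) (sg : smooth_curve A gam) (u : R -> ix A -> jet R n.+1).
Context (pu : parallel_along Gam gam u).
Context (U : set X) (tGam : ix A -> christoffel R n.+1) (sp : special_in_class Gam U tGam).
Context (i : ix A).
Local Notation J := (chart_times gam i U).
Local Notation vel := (velocity gam i).
Let x r : V := crd i (gam r).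
Let G := tGam i.
Let mu r b := (u r i).2 0 b + 1 / n.+2%:R * (\sum_c G (x r) c b c) * (u r i).1.
Let mu0 b y := nabla_density 1 G (sigma i) y 0 b.
(** The difference of [u] and [L(sigma)] in the splitting given by [G]: index 0 is the density slot,
    the other indices are the form slot. *)
Let w (k : 'I_n.+2) r :=
  if unlift ord0 k is Some b then mu r b - mu0 b (x r) else (u r i).1 - sigma i (x r).
Let T t := \sum_a vel a t * (1 / n.+2%:R * \sum_c G (x t) c a c).
(** The coefficients of parallel transport along the curve, solved for the derivatives; [T] comes
    from the weight 1 of both slots. *)
Let M (k l : 'I_n.+2) t : R :=
  match unlift ord0 k, unlift ord0 l with
  | None, None => - T t
  | None, Some a => vel a t
  | Some b, None => - \sum_a vel a t * schouten G (x t) a b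
  | Some b, Some c => \sum_a vel a t * G (x t) c a b - T t * (b == c)%:R
  end.

Let oU : open U. Proof. by case: sp => [[]]. Qed.
Let sG : smooth_sym (reg U i) G.
Proof. by case: sp => [[_ ct _] _]; exact: (connection_smooth_sym i ct). Qed.
Let rS : region (reg U i). Proof. exact: (region_reg HM). Qed.
Let ssig : smooth_on (reg U i) (sigma i). Proof. exact: (sigma_smooth_reg Hs). Qed.
Let str b : smooth_on (reg U i) (fun y => 1 / n.+2%:R * \sum_c G y c b c).
Proof. by apply: smooth_onM; [exact: smooth_on_cst|exact: smooth_trace]. Qed.
Let smu0 b : smooth_on (reg U i) (mu0 b). Proof. exact: smooth_nabla_density. Qed.
Let su1 : smooth_on (V := R^o) (unit_part gam i) (fun t => (u t i).1).
Proof. by case: pu => [[]]. Qed.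
Let su2 b : smooth_on (V := R^o) (unit_part gam i) (fun t => (u t i).2 0 b).
Proof. by case: pu => [[_ + _] _]; apply. Qed.

Lemma transport_difference_zero r : J r ->
  (forall k, w k r = 0) <-> u r i = L i (gam r).
Proof.
move=> Jr; split=> [w0|e k]; last first.
  rewrite /w; case: unliftP => [b _|_]; last by rewrite e subrr.
  by rewrite /mu e /mu0 !mxE subrr.
have w00 := w0 ord0; rewrite /w unlift_none in w00.
have e1 : (u r i).1 = sigma i (x r) by apply/eqP; rewrite -subr_eq0 w00.
have e2 : (u r i).2 = \row_a pd a (sigma i) (x r).
  apply/rowP => b; have := w0 (lift ord0 b); rewrite /w liftK /mu /mu0 e1 !mxE.
  by move=> /eqP; rewrite subr_eq0 => /eqP/addIr.
by case: (u r i) e1 e2 => a b /= -> ->.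
Qed.

Let wcont k t : J t -> w k @ within J (nbhs t) --> w k t.
Proof.
move=> Jt; rewrite /w; case: (unlift ord0 k) => [b|].
  apply: cvgB; last exact: (curve_continuous sg (smu0 b)).
  apply: cvgD; first exact: (unit_part_continuous (su2 b)).
  apply: cvgM; first exact: (curve_continuous sg (str b)).
  exact: (unit_part_continuous su1).
apply: cvgB; last exact: (curve_continuous sg ssig).
exact: (unit_part_continuous su1).
Qed.

(** Both [u] and [L(sigma)] solve the same linear system, the former by being parallel along the
    curve, the latter by [hessian_schouten_special]; hence so does the difference. *)
Let wder k t : J t -> 0 < t < 1 -> dquot (w k) t @ 0^' --> \sum_l M k l t * w l t.
Proof.
move=> Jt t01; have Sx := chart_times_reg Jt.
have t01' : 0 <= t <= 1 by move/andP: t01 => [t0 t1]; rewrite !ltW.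
have [_ /(_ U tGam sp t i t01' Jt.2.1 Jt.2.2)[Es Em]] := pu.
pose mu' r := (splitting (tGam i) (crd i (gam r)) (u r i)).2.
pose ds := unit_derive (fun r => (u r i).1) t.
have {}Es : ds + T t * (u t i).1 - \sum_a vel a t * mu' t 0 a = 0 := Es.
have {}Em b : unit_derive (fun r => mu' r 0 b) t -
    \sum_a \sum_c vel a t * G (x t) c a b * mu' t 0 c + T t * mu' t 0 b +
    (\sum_a vel a t * schouten G (x t) a b) * (u t i).1 = 0 := Em b.
have Ds : dquot (fun r => (u r i).1) t @ 0^' --> ds by exact: (unit_part_dquot HM sg oU su1 Jt t01).
have Dmu b : dquot (fun r => mu r b) t @ 0^' --> unit_derive (fun r => mu r b) t.
  have D1 := unit_part_dquot HM sg oU (su2 b) Jt t01.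
  have D2 := dquotM (curve_dquot HM sg oU (str b) Jt t01) Ds.
  by have D := dquotD D1 D2; rewrite (unit_deriveE t01 D).
have mE r b : mu' r 0 b = mu r b by rewrite mxE.
have Es' : ds = - T t * (u t i).1 + \sum_a vel a t * mu t a.
  rewrite -(eq_bigr _ (fun a _ => congr1 (fun y => vel a t * y) (mE t a))).
  by apply/eqP; rewrite -subr_eq0 -[X in _ == X]Es; apply/eqP; ring.
have Em' b : unit_derive (fun r => mu r b) t =
    \sum_a \sum_c vel a t * G (x t) c a b * mu t c - T t * mu t b
    - (\sum_a vel a t * schouten G (x t) a b) * (u t i).1.
  have -> : \sum_a \sum_c vel a t * G (x t) c a b * mu t c =
     \sum_a \sum_c vel a t * G (x t) c a b * mu' t 0 c.
    by apply: eq_bigr => a _; apply: eq_bigr => c _; rewrite mE.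
  have -> : (fun r => mu r b) = (fun r => mu' r 0 b).
    by apply/funext => r; rewrite mE.
  rewrite -mE; apply/eqP; rewrite -subr_eq0 -[X in _ == X](Em b); apply/eqP; ring.
have Rs : \sum_a vel a t * pd a (sigma i) (x t) =
    - T t * sigma i (x t) + \sum_a vel a t * mu0 a (x t).
  rewrite /T mulNr mulr_suml -sumrN -big_split /=; apply: eq_bigr => a _.
  by rewrite /mu0 mxE; ring.
have H := hessian_schouten_special HM cGam Hs n_gt0 flat spG sp Sx.
(* Row by row, this is the vanishing of [hessian_schouten] contracted with the velocity. *)
have Rm b : \sum_a vel a t * pd a (mu0 b) (x t) =
    \sum_a \sum_c vel a t * G (x t) c a b * mu0 c (x t) - T t * mu0 b (x t)
    - (\sum_a vel a t * schouten G (x t) a b) * sigma i (x t).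
  rewrite /T !mulr_suml -!sumrB; apply: eq_bigr => a _.
  have E : pd a (mu0 b) (x t) - \sum_c G (x t) c a b * mu0 c (x t) +
     1 / n.+2%:R * (\sum_c G (x t) c a c) * mu0 b (x t) + sigma i (x t) * schouten G (x t) a b = 0.
    have /matrixP/(_ a b) := H; rewrite /hessian_schouten mxE [X in _ + X]mxE [RHS]mxE.
    by rewrite [X in X + _]mxE.
  have -> : \sum_c vel a t * G (x t) c a b * mu0 c (x t) =
    vel a t * \sum_c G (x t) c a b * mu0 c (x t).
    by rewrite mulr_sumr; apply: eq_bigr => c _; rewrite mulrA.
  have -> : pd a (mu0 b) (x t) = \sum_c G (x t) c a b * mu0 c (x t) -
     1 / n.+2%:R * (\sum_c G (x t) c a c) * mu0 b (x t) - sigma i (x t) * schouten G (x t) a b.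
    by apply/eqP; rewrite -subr_eq0 -[X in _ == X]E; apply/eqP; ring.
  ring.
have w0E : w ord0 t = (u t i).1 - sigma i (x t) by rewrite /w unlift_none.
have wSE c : w (lift ord0 c) t = mu t c - mu0 c (x t) by rewrite /w liftK.
have M00 : M ord0 ord0 t = - T t by rewrite /M unlift_none.
have M0S a : M ord0 (lift ord0 a) t = vel a t by rewrite /M unlift_none liftK.
have MS0 b : M (lift ord0 b) ord0 t = - \sum_a vel a t * schouten G (x t) a b.
  by rewrite /M unlift_none liftK.
have MSS b c : M (lift ord0 b) (lift ord0 c) t =
    \sum_a vel a t * G (x t) c a b - T t * (b == c)%:R by rewrite /M !liftK.
case: (unliftP ord0 k) => [b|] ->.
  have -> : \sum_l M (lift ord0 b) l t * w l t =
      unit_derive (fun r => mu r b) t - \sum_a vel a t * pd a (mu0 b) (x t).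
    rewrite big_ord_recl w0E MS0 Em' Rm.
    have -> : \sum_c M (lift ord0 b) (lift ord0 c) t * w (lift ord0 c) t =
        \sum_c ((\sum_a vel a t * G (x t) c a b) * (mu t c - mu0 c (x t)) -
          T t * (b == c)%:R * (mu t c - mu0 c (x t))).
      by apply: eq_bigr => c _; rewrite wSE MSS mulrBl.
    rewrite sumrB.
    have -> : \sum_c T t * (b == c)%:R * (mu t c - mu0 c (x t)) = T t * (mu t b - mu0 b (x t)).
      rewrite -(sum_deltal (fun c => T t * (mu t c - mu0 c (x t))) b).
      by apply: eq_bigr => c _; ring.
    have -> : \sum_c (\sum_a vel a t * G (x t) c a b) * (mu t c - mu0 c (x t)) =
        \sum_a \sum_c vel a t * G (x t) c a b * mu t c -
        \sum_a \sum_c vel a t * G (x t) c a b * mu0 c (x t).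
      rewrite -sumrB [RHS](eq_bigr (fun a => \sum_c vel a t * G (x t) c a b * (mu t c - mu0 c (x t)))).
        rewrite exchange_big /=; apply: eq_bigr => c _; exact: mulr_suml.
      by move=> a _; rewrite -sumrB; apply: eq_bigr => c _; rewrite mulrBr.
    ring.
  have -> : w (lift ord0 b) = fun r => mu r b - mu0 b (x r).
    by apply/funext => r; rewrite /w liftK.
  exact: dquotD (Dmu b) (dquotN (curve_dquot HM sg oU (smu0 b) Jt t01)).
have -> : \sum_l M ord0 l t * w l t = ds - \sum_a vel a t * pd a (sigma i) (x t).
  rewrite big_ord_recl w0E M00 Es' Rs.
  have -> : \sum_a M ord0 (lift ord0 a) t * w (lift ord0 a) t =
      \sum_a (vel a t * mu t a - vel a t * mu0 a (x t)).
    by apply: eq_bigr => a _; rewrite wSE M0S mulrBr.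
  rewrite sumrB; ring.
have -> : w ord0 = fun r => (u r i).1 - sigma i (x r).
  by apply/funext => r; rewrite /w unlift_none.
exact: dquotD Ds (dquotN (curve_dquot HM sg oU ssig Jt t01)).
Qed.

Let Mbounded t0 k l : J t0 -> loc_bounded (J `&` [set t | 0 < t < 1]) t0 (M k l).
Proof.
move=> Jt; have vb a := velocity_bounded HM sg oU a Jt.
have cb f : smooth_on (reg U i) f ->
    loc_bounded (J `&` [set t | 0 < t < 1]) t0 (fun r => f (x r)).
  move=> sf; apply: (@loc_bounded_cvg _ _ _ _ (f (x t0))).
  by apply: within_sub (curve_continuous sg sf Jt) => r [].
have Tb : loc_bounded (J `&` [set t | 0 < t < 1]) t0 T.
  apply: loc_bounded_sum => a; apply: loc_boundedM; first exact: vb.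
  exact: (cb _ (str a)).
rewrite /M; case: (unlift ord0 k) => [b|]; case: (unlift ord0 l) => [c|].
- apply: loc_boundedD; last first.
    by apply: loc_boundedN; apply: loc_boundedM => //; exact: loc_bounded_cst.
  apply: loc_bounded_sum => a; apply: loc_boundedM; first exact: vb.
  exact: (cb _ (sG.1 c a b)).
- apply: loc_boundedN; apply: loc_bounded_sum => a; apply: loc_boundedM; first exact: vb.
  apply: (cb (fun y => schouten G y a b)).
  apply: (smooth_on_ext (f := fun y => (n.+1%:R - 1)^-1 * ricci G y a b)).
    by move=> y _; rewrite [RHS]mxE.
  by apply: smooth_onM; [exact: smooth_on_cst|exact: smooth_ricci].
- exact: vb.
- exact: loc_boundedN.
Qed.

(** Uniqueness is applied on the interval between [s] and [t0] in both directions. The resulting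
    equivalence makes the times of vanishing and those of non-vanishing both relatively open. *)
Lemma transport_difference_near t0 : J t0 -> \forall s \near t0, 0 <= s <= 1 ->
  J s /\ ((forall k, w k s = 0) <-> (forall k, w k t0 = 0)).
Proof.
move=> Jt0.
have [B B0 MB] := loc_bounded_family (fun kl : 'I_n.+2 * 'I_n.+2 => Mbounded kl.1 kl.2 Jt0).
have JN := chart_times_near HM sg oU Jt0.
have : \forall s \near t0, (0 <= s <= 1 -> J s) /\
    ((J `&` [set t | 0 < t < 1]) s -> forall kl : 'I_n.+2 * 'I_n.+2, `|M kl.1 kl.2 s| <= B).
  by move: JN MB; apply: filterS2 => s.
move=> /nbhs_ballP[e /= e0 eP]; apply/nbhs_ballP; exists e => //= s es s01.
have t001 : 0 <= t0 <= 1 by case: Jt0.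
have inball r : Num.min s t0 <= r <= Num.max s t0 -> ball t0 e r.
  move: es; rewrite -!ball_normE /= !ltr_norml => /andP[e1 e2].
  rewrite ge_min le_max => /andP[/orP[h1|h1] /orP[h2|h2]]; apply/andP; split; lra.
have in01 r : Num.min s t0 <= r <= Num.max s t0 -> 0 <= r <= 1.
  move: s01 t001 => /andP[s0 s1] /andP[t00 t01].
  rewrite ge_min le_max => /andP[/orP[h1|h1] /orP[h2|h2]]; apply/andP; split; lra.
have inJ r : Num.min s t0 <= r <= Num.max s t0 -> J r.
  by move=> rI; exact: ((eP r (inball r rI)).1 (in01 r rI)).
have sI : Num.min s t0 <= s <= Num.max s t0 by rewrite ge_min le_max lexx.
have tI : Num.min s t0 <= t0 <= Num.max s t0 by rewrite ge_min le_max lexx !orbT.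
split; first exact: inJ.
have int01 r : Num.min s t0 < r < Num.max s t0 -> 0 < r < 1.
  move: s01 t001 => /andP[s0 s1] /andP[t00 t01].
  by rewrite gt_min lt_max => /andP[/orP[h1|h1] /orP[h2|h2]]; apply/andP; split; lra.
have weakI r : Num.min s t0 < r < Num.max s t0 -> Num.min s t0 <= r <= Num.max s t0.
  by move=> /andP[h1 h2]; rewrite !ltW.
have cw k : {within `[Num.min s t0, Num.max s t0], continuous (w k)}.
  apply/subspace_continuousP => r /= rI; rewrite in_itv /= in rI.
  have sub : `[Num.min s t0, Num.max s t0]%classic `<=` J.
    by move=> q; rewrite /= in_itv /=; exact: inJ.
  exact: (within_sub sub (wcont (k := k) (inJ r rI))).
have dw k r : Num.min s t0 < r < Num.max s t0 ->
    is_derive r 1 (w k) (\sum_l M k l r * w l r).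
  move=> rI; apply: dquot_derive; apply: wder; first exact/inJ/weakI.
  exact: int01.
have AM k l r : Num.min s t0 < r < Num.max s t0 -> `|M k l r| <= B.
  move=> rI; apply: ((eP r (inball r (weakI r rI))).2 _ (k, l)).
  by split; [exact/inJ/weakI|exact: int01].
by split => H; apply: (linear_ode_unique cw dw AM B0 _ _ H).
Qed.

End Local.

Context (pc : projectively_compact 1 Gam).

Lemma parallel_unique gam u i0 : smooth_curve A gam -> parallel_along Gam gam u ->
  dom i0 (gam 0) -> u 0 i0 = L i0 (gam 0) ->
  forall t i, 0 <= t <= 1 -> dom i (gam t) -> u t i = L i (gam t).
Proof.
move=> sg pu d0 u0.
(* All charts at once, since the curve need not stay in one; by [change] a single chart decides. *)
pose good t := forall i, dom i (gam t) -> u t i = L i (gam t).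
have change t i j : 0 <= t <= 1 -> dom i (gam t) -> dom j (gam t) ->
    u t j = L j (gam t) -> u t i = L i (gam t).
  move=> t01 it jt e; have [[_ _ ch] _] := pu.
  have [c1 c2] := ch t i j t01 it jt.
  have sd : density 1 setT sigma by case: Hs => [[]].
  have [c1' c2'] := density_splitting_jet HM sd it jt.
  rewrite [LHS]surjective_pairing [RHS]surjective_pairing; congr pair.
    by rewrite c1 c1' e.
  by apply/rowP => a; rewrite c2 c2' e.
have local (t0 : R) : 0 <= t0 <= 1 -> \forall s \near t0, 0 <= s <= 1 -> (good s <-> good t0).
  move=> t001; have [U [tGam [Ut sp]]] := special_cover HM cGam spG (gam t0) pc.
  have [i it] := covered HM (gam t0).
  have Jt : chart_times gam i U t0 by [].
  have := transport_difference_near sg pu sp Jt; apply: filterS => s Hs' s01.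
  have [Js E] := Hs' s01.
  have E1 := transport_difference_zero u tGam Js.
  have E2 := transport_difference_zero u tGam Jt.
  have G1 r : chart_times gam i U r -> good r <-> u r i = L i (gam r).
    move=> [r01 [ir _]]; split=> [|e j jr]; first exact.
    exact: (change r j i r01 jr ir e).
  by split => /G1 H; apply/G1 => //; [apply/E2/E/E1/H|apply/E1/E/E2/H].
have good0 : good 0 by move=> j jd; apply: (change 0 j i0) => //; rewrite lexx ler01.
suff H : [set t | 0 <= t <= 1] `&` good = [set t : R | 0 <= t <= 1].
  move=> t i t01 it.
  have : ([set t | 0 <= t <= 1] `&` good) t by rewrite H.
  by case=> _; exact.
have conn : connected [set t : R | 0 <= t <= 1].
  have -> : [set t : R | 0 <= t <= 1] = `[0, 1]%classic.
    by apply/seteqP; split => t; rewrite /= in_itv.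
  exact: segment_connected.
(* The good times include 0, and by [local] they form a relatively open and closed subset of the
   unit interval. *)
apply: conn.
- by exists 0; split => //=; rewrite lexx ler01.
- exists (interior [set t | 0 <= t <= 1 -> good t]); first exact: open_interior.
  apply/seteqP; split => t [t01 gt]; split => //.
    by apply: filterS (local t t01) => s Hs' s01; apply/(Hs' s01).
  exact: (nbhs_singleton gt t01).
- exists (~` interior [set t | 0 <= t <= 1 -> ~ good t]).
    by apply: open_closedC; exact: open_interior.
  apply/seteqP; split => t [t01 gt]; split => //.
    by move=> /nbhs_singleton/(_ t01); exact.
  apply: contrapT => ng; apply: gt.
  by apply: filterS (local t t01) => s Hs' s01 /(Hs' s01).
Qed.

(** For the initial value [L(sigma)], [transport_smooth] supplies a parallel section ending at the
    value of [F], and [parallel_unique] identifies it. Concatenation is immediate. *)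
Lemma transport_splitting p i q j F : transport Gam p i q j F ->
  [/\ dom i p, dom j q & F (L i p) = L j q].
Proof.
elim=> [gam i' j' F' sg d0 d1 HF|p' i' q' j' r' k' F1 F2 _ [d1 d2 e1] _ [_ d3 e2]].
  split=> //; have [u [pu u0 u1]] := HF (L i' (gam 0)).
  rewrite -u1; apply: (parallel_unique sg pu d0 u0) => //.
  by rewrite lexx ler01.
by split=> //=; rewrite e1.
Qed.

(** [L(sigma)] has no zeros: on the interior [sigma] is nonzero, and on the boundary its normal
    derivative is. *)
Lemma flat_holonomy : holonomy_stabilizes_covector Gam.
Proof.
move=> p i ip; exists (L i p); split; last by move=> F /transport_splitting[].
have [bp|np] := pselect (boundary A p).
  move=> [_] /rowP/(_ ord0); rewrite !mxE; apply/eqP.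
  exact: (pd_sigma_normal HM Hs).
by move=> [/(sigma_zero Hs ip)].
Qed.

End Transport.

Theorem theorem3p2 (R : realType) (X : topologicalType) (n : nat)
    (A : atlas R X n.+1) (Gam : ix A -> christoffel R n.+1)
    (sigma : ix A -> 'rV[R]_n.+1 -> R) :
  (0 < n)%N ->
  manifold_with_boundary A ->
  connection (interior_part A) Gam ->
  special (interior_part A) Gam ->
  projectively_compact 1 Gam ->
  canonical_defining_density 1 Gam sigma ->
  (bgg_solution Gam sigma <-> ricci_flat (interior_part A) Gam) /\
  (bgg_solution Gam sigma ->
     [/\ totally_geodesic_boundary Gam,
         boundary_inherits_projective_structure Gam,
         normal_bgg_solution Gam sigma &
         holonomy_stabilizes_covector Gam]).
Proof.
move=> n0 HM cGam spG pc Hs.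
have equiv : bgg_solution Gam sigma <-> ricci_flat (interior_part A) Gam.
  split; first exact: (bgg_ricci_flat HM cGam Hs n0 spG).
  by move=> flat; exact: (flat_bgg_solution HM cGam Hs n0 flat spG).
split=> // /equiv flat; split.
- exact: (flat_totally_geodesic HM cGam Hs n0 flat).
- exact: (flat_boundary_structure HM cGam Hs n0 flat pc).
- exact: (flat_normal HM cGam Hs n0 spG flat).
- exact: (flat_holonomy HM cGam Hs n0 flat spG pc).
Qed.
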